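(* Consider the bipedal robot with inertial disc described in the context (a hybrid model with $N$ rigid links satisfying the listed robot hypotheses), and suppose that there exist functions $\mathbf{h}_r^{ref}(q_N)$, $V(q_N)>0$ and $S(q_N)$ with $\frac{\partial S}{\partial q_N}(q_N)\,V(q_N)=k_2(\mathbf{0},q_N)$ such that the manifolds $\mathcal{W}$ and $\mathcal{Z}$ are hybrid invariant. Suppose moreover that the linearizing input $\mathbf{u}^*=(\mathcal{L}_g\mathcal{L}_f\mathbf{h})^{-1}\{\mathbf{v}-\mathcal{L}_f^2\mathbf{h}\}$ exists for every possible value of the state $\mathbf{x}$ (i.e. the decoupling matrix $\mathcal{L}_g\mathcal{L}_f\mathbf{h}$ is invertible at every $\mathbf{x}\in\mathcal{X}$). Then the hybrid system $$\dot{\mathbf{x}}=\mathbf{f}(\mathbf{x})+\mathbf{g}(\mathbf{x})\mathbf{u}\ \ (\mathbf{x}\notin\mathcal{S}),\qquad \mathbf{x}^+=\Delta(\mathbf{x}^-)\ \ (\mathbf{x}^-\in\mathcal{S}),$$ except for the disc position $q_d$, can be made exponentially stable in some neighborhood $\mathcal{U}$ of $\mathcal{Z}$ by using $\mathbf{u}=\mathbf{u}^*$ with $\mathbf{v}=(\mathbf{v}_r,v_N)^T$, $$\mathbf{v}_r=-K_P\mathbf{h}_r-K_V\mathcal{L}_f\mathbf{h}_r,\qquad v_N=\frac{\partial V}{\partial q_N}\dot q_N+\gamma\frac{\partial S}{\partial q_N}b-\beta_0(\dot q_N-V)+\frac{d}{dt}\Big(\frac{\gamma}{\beta_0}\frac{\partial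 S}{\partial q_N}b\Big),$$ and adjusting the parameters $K_P,K_V$ (positive definite) and $\beta_0,\gamma>0$. That is, for suitable parameters there are a neighborhood $\mathcal{U}$ of $\mathcal{Z}$ and constants $M\ge1$, $\lambda>0$ such that every closed-loop solution starting in $\mathcal{U}$ satisfies $\|\mathbf{y}(t)\|\le Me^{-\lambda t}\|\mathbf{y}(0)\|$ for all $t\ge 0$, where $\mathbf{y}=(\mathbf{h}_r,\dot{\mathbf{h}}_r,b,c)$ vanishes exactly on $\mathcal{Z}$.
   Context: **Robot and hypotheses.** The robot is a planar chain of $N$ rigid links (known masses, centers of mass, inertias), one of them an inertial disc, connected by $N-1$ frictionless, independently actuated joints. There are at least one and at most two contact points with the ground (feet), which are punctual and unactuated. Walking takes place on a surface, in the sagittal plane, as alternating phases of single support (the stance foot is an ideal pivot) and instantaneous double support (impact). At impact the swing leg touches the ground with neither slip nor rebound, and the former stance leg releases without interaction. The coordinates are $\mathbf{q}=(q_d,\mathbf{q}_r,q_N)^T$, with $q_d\in\mathbb{R}$ the relative disc angle (a cyclic coordinate), $\mathbf{q}_r\in\mathbb{R}^{N-2}$ the relative angles of the rest of the body, and $q_N\in\mathbb{R}$ the only absolute angle. **Continuous phase.** $\mathbf{D}(\mathbf{q}_r)\ddot{\mathbf{q}}+\mathbf{C}(\mathbf{q}_r,\dot{\mathbf{q}}_r,\dot q_N)\dot{\mathbf{q}}+\mathbf{G}(\mathbf{q}_r,q_N)=\mathbf{B}(\mathbf{q}_r)\mathbf{u}$, with $\mathbf{u}\in\mathbb{R}^{N-1}$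 the actuator torques ($\mathbf{D}$ inertia matrix, $\mathbf{C}$ Coriolis matrix, $\mathbf{G}$ gravity vector). The angular momentum is $\sigma_N=\mathbf{D}_N(\mathbf{q}_r)\dot{\mathbf{q}}$, with $\mathbf{D}_N$ the last row of $\mathbf{D}$; it satisfies $\dot\sigma_N=-\mathbf{G}_N(\mathbf{q}_r,q_N)$, with $\mathbf{G}_N$ the last entry of $\mathbf{G}$. Put $\omega=(\sigma_N,\dot{\mathbf{q}}_r,\dot q_N)^T$, which is related to $\dot{\mathbf{q}}$ by a diffeomorphism. The state is $\mathbf{x}=(\mathbf{q},\omega)^T$, in the set $\mathcal{X}\subset\mathbb{R}^{2N}$ of valid states, and the continuous phase is written $\dot{\mathbf{x}}=\mathbf{f}(\mathbf{x})+\mathbf{g}(\mathbf{x})\mathbf{u}$. All data are smooth. **Impact.** $\mathcal{S}=\{\mathbf{x}\in\mathcal{X}: p_2(\mathbf{q})=0,\ \dot p_2(\mathbf{x})<0\}$, where $p_2(\mathbf{q})\ge 0$ is e.g. the height of the swing foot (a function of $\mathbf{q}_r,q_N$), with $\dot p_2(\mathbf{x}^+)>0$ and $\dot p_2(\mathbf{x}^-)<0$. The walking gait is assumed transversal to the impact surface. At impact $\mathbf{x}^+=\Delta(\mathbf{x}^-)=(\Delta_{\mathbf{q}}\mathbf{q}^-,\ \Delta_\omega(\mathbf{q}_r^-,q_N^-)\omega^-)$, where $\Delta_{\mathbf{q}}$ is a constant involutive matrix and $\Delta_\omega$ is a matrix function whose first column is $(1,0,\dots,0)^T$. Superscripts $-$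 and $+$ denote values just before and just after impact. **Output and linearizing input.** $\mathbf{h}_r^{ref}(q_N)\in\mathbb{R}^{N-2}$ is the desired value of $\mathbf{q}_r$; $\mathbf{h}_r=\mathbf{q}_r-\mathbf{h}_r^{ref}(q_N)$; the output is $\mathbf{h}=(\mathbf{h}_r,q_N)^T\in\mathbb{R}^{N-1}$. $\mathcal{L}_f,\mathcal{L}_g$ are Lie derivatives along $\mathbf{f},\mathbf{g}$, so $\mathcal{L}_f\mathbf{h}_r=\dot{\mathbf{h}}_r$, and under $\mathbf{u}=\mathbf{u}^*$ one has $\ddot{\mathbf{h}}_r=\mathbf{v}_r$, $\ddot q_N=v_N$. The change of coordinates $\mathbf{x}\mapsto(\mathbf{h},q_d,\dot{\mathbf{h}},\sigma_N)$ is a global diffeomorphism. **Reference functions and manifolds.** $k_2(\mathbf{h}_r,q_N)=-\mathbf{G}_N(\mathbf{h}_r+\mathbf{h}_r^{ref}(q_N),q_N)$, so $\dot\sigma_N=k_2(\mathbf{h}_r,q_N)$. $V(q_N)>0$ and $S(q_N)$ are the references for $\dot q_N$ and $\sigma_N$, related by $\frac{\partial S}{\partial q_N}V=k_2(\mathbf{0},q_N)$. There is a bounded function $\mathbf{f}_2$ with $k_2(\mathbf{h}_r,q_N)-\frac{\partial S}{\partial q_N}V=\langle\mathbf{h}_r,\mathbf{f}_2(\mathbf{h}_r,q_N)\rangle$. With positive constants $\gamma,\beta_0$, define $$b=\sigma_N-S(q_N),\qquad c=\dot q_N-V(q_N)-\frac{\gamma}{\beta_0}\frac{\partial S}{\partial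 q_N}b,$$ $$\mathcal{W}=\{\mathbf{x}\in\mathcal{X}:\mathbf{h}_r=0,\ \dot{\mathbf{h}}_r=0\},\qquad \mathcal{Z}=\{\mathbf{x}\in\mathcal{W}: b=0,\ c=0\}.$$ A manifold $\mathcal{M}$ is forward invariant if solutions (of the continuous closed-loop dynamics) starting in $\mathcal{M}$ remain in $\mathcal{M}$; impact invariant if $\mathcal{M}\cap\mathcal{S}\ne\emptyset$ and $\Delta(\mathcal{M}\cap\mathcal{S})\subset\mathcal{M}$; hybrid invariant if both. On the nominal step, $q_N$ goes monotonically from $\bar q_N^+$ to $\bar q_N^->\bar q_N^+$.
   Formalization: Added hypothesis: k_2(0,q_N) is nonzero for some q_N on the nominal step (gravity has a moment about the stance foot at some instant); without it S' vanishes on the step and b can stay constant for all gains, so the claim fails. *)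

(* Defs.v *)
From HB Require Import structures.
From mathcomp Require Import all_boot all_order all_algebra.
From mathcomp Require Import all_classical all_reals all_analysis.

Set Implicit Arguments.
Unset Strict Implicit.
Unset Printing Implicit Defensive.

Import Order.TTheory GRing.Theory Num.Theory.
Import numFieldNormedType.Exports.

Local Open Scope classical_set_scope.
Local Open Scope ring_scope.

(* Every normed module below has finite dimension, so [smooth] is C^infinity:
   all iterated directional derivatives exist and are continuous. *)
Fixpoint Ck (R : realType) (k : nat) (V W : normedModType R) (f : V -> W)
    : Prop :=
  match k with
  | 0 => continuous f
  | k'.+1 => (forall x, differentiable f x) /\
             (forall v, Ck k' (fun x => 'D_v f x))
  end.

Definition smooth (R : realType) (V W : normedModType R) (f : V -> W) : Prop :=
  forall k, Ck k f.

Definition posdefmx (R : realType) (m : nat) (A : 'M[R]_m) : Prop :=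
  A^T = A /\ forall v : 'cV[R]_m, v != 0 -> 0 < (v^T *m A *m v) 0 0.

(* There are N = n + 2 links. The index type is kept in the block form
   1 + n + 1, matching q = (q_d, q_r, q_N) and omega = (sigma_N, q_r', q_N'). *)
Notation links n := (1 + n + 1)%N.

(* x = (q, omega), i.e. R^(2N). *)
Definition state (R : realType) (n : nat) :=
  ('cV[R]_(links n) * 'cV[R]_(links n))%type.

Section Coordinates.
Variables (R : realType) (n : nat).

Definition first (v : 'cV[R]_(links n)) : R := (usubmx (usubmx v)) 0 0.
Definition middle (v : 'cV[R]_(links n)) : 'cV[R]_n := dsubmx (usubmx v).
Definition final (v : 'cV[R]_(links n)) : R := (dsubmx v) 0 0.

(* The coordinates (q_r, q_N) on which mass distribution and gravity depend. *)
Definition shape (v : 'cV[R]_(links n)) : 'cV[R]_n * R := (middle v, final v).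

Definition sigmaN (x : state R n) : R := first x.2.
Definition qr (x : state R n) : 'cV[R]_n := middle x.1.
Definition qN (x : state R n) : R := final x.1.
Definition dqN (x : state R n) : R := final x.2.

End Coordinates.

Record robot (R : realType) (n : nat) := Robot {
  inertia : 'cV[R]_n -> 'M[R]_(links n);
  coriolis : 'cV[R]_n * 'cV[R]_n * R -> 'M[R]_(links n);
  potential : 'cV[R]_n * R -> R;
  actuation : 'cV[R]_n -> 'M[R]_(links n, n + 1);
  swing_height : 'cV[R]_n * R -> R;
  impact_q : 'M[R]_(links n);
  impact_omega : 'cV[R]_n * R -> 'M[R]_(links n);
  valid : set (state R n)
}.

Section Model.
Variables (R : realType) (n : nat) (rb : robot R n).

(* The disc angle is cyclic, so the kinetic energy q'^T D q' / 2 depends on the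
   configuration through q_r only, and the potential energy through (q_r, q_N);
   e_i below is the i-th basis vector of configuration space. *)
Definition gravity (z : 'cV[R]_n * R) : 'cV[R]_(links n) :=
  \col_i 'D_(shape (delta_mx i 0)) (potential rb) z.

Definition gravityN (z : 'cV[R]_n * R) : R := final (gravity z).

Definition inertia_rate (r : 'cV[R]_n) (dq : 'cV[R]_(links n))
    : 'M[R]_(links n) :=
  'D_(middle dq) (inertia rb) r.

(* (dD/dt) q' - (1/2) grad_q (q'^T D q'), which every choice of Coriolis matrix
   must produce when applied to q'. *)
Definition coriolis_force (r : 'cV[R]_n) (dq : 'cV[R]_(links n))
    : 'cV[R]_(links n) :=
  inertia_rate r dq *m dq -
  \col_i (2^-1 * 'D_(middle (delta_mx i 0))
                   (fun s => (dq^T *m inertia rb s *m dq) 0 0) r).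

(* The matrix T(q_r) with omega = T(q_r) q'. *)
Definition to_omega (r : 'cV[R]_n) : 'M[R]_(links n) :=
  col_mx
    (col_mx (dsubmx (inertia rb r) : 'M[R]_(1, links n))
            (row_mx (row_mx 0 1%:M) 0 : 'M[R]_(n, links n)))
    (row_mx 0 1%:M : 'M[R]_(1, links n)).

Definition qdot (x : state R n) : 'cV[R]_(links n) :=
  invmx (to_omega (qr x)) *m x.2.

(* omega' = T' q' + T q'' with q'' = D^-1 (B u - C q' - G). *)
Definition drift (x : state R n) : state R n :=
  (qdot x,
   'D_(middle (qdot x)) to_omega (qr x) *m qdot x -
   to_omega (qr x) *m invmx (inertia rb (qr x)) *m
     (coriolis rb (qr x, middle x.2, dqN x) *m qdot x +
      gravity (shape x.1))).

Definition control (x : state R n) (u : 'cV[R]_(n + 1)) : state R n :=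
  (0, to_omega (qr x) *m invmx (inertia rb (qr x)) *m
        actuation rb (qr x) *m u).

Definition p2 (x : state R n) : R := swing_height rb (shape x.1).
Definition dp2 (x : state R n) : R := 'D_(shape x.2) (swing_height rb) (shape x.1).

Definition impact_surface : set (state R n) :=
  [set x | [/\ valid rb x, p2 x = 0 & dp2 x < 0]].

Definition impact (x : state R n) : state R n :=
  (impact_q rb *m x.1, impact_omega rb (shape x.1) *m x.2).

Record bipedal_robot_with_disc : Prop := BipedalRobot {
  inertia_posdef : forall r, posdefmx (inertia rb r);
  coriolisE : forall (r : 'cV[R]_n) (dq : 'cV[R]_(links n)),
    coriolis rb (r, middle dq, final dq) *m dq = coriolis_force r dq;
  (* q_N carries no actuator; the N - 1 joints are actuated independently *)
  unactuatedN : forall r, dsubmx (actuation rb r : 'M[R]_(1 + n + 1, n + 1)) = 0;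
  independent_actuators : forall r, \rank (actuation rb r) = (n + 1)%N;
  to_omega_diffeo : forall r, to_omega r \in unitmx;
  smooth_inertia : smooth (inertia rb);
  smooth_coriolis : smooth (coriolis rb);
  smooth_potential : smooth (potential rb);
  smooth_actuation : smooth (actuation rb);
  smooth_swing_height : smooth (swing_height rb);
  smooth_impact : smooth (impact_omega rb);
  impact_q_involutive : impact_q rb *m impact_q rb = 1%:M;
  impact_omega_col0 : forall z,
    lsubmx (lsubmx (impact_omega rb z)) = col_mx (col_mx 1%:M 0) 0;
  valid_above_ground : forall x, valid rb x -> 0 <= p2 x;
  (* q_d is cyclic *)
  valid_cyclic : forall (x : state R n) (a : R),
    valid rb x -> valid rb (x.1 + a *: col_mx (col_mx 1%:M 0) 0, x.2);
  foot_lifts_off : forall x, impact_surface x -> 0 < dp2 (impact x)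
}.

Definition lie (V : normedModType R) (F : state R n -> state R n)
    (phi : state R n -> V) (x : state R n) : V := 'D_(F x) phi x.

Section Trajectories.
Variable F : state R n -> state R n.

Definition flow_on (a b : R) (x : R -> state R n) : Prop :=
  [/\ {within `[a, b], continuous x},
      forall t, t \in `[a, b] -> valid rb (x t) &
      forall t : R, t \in `]a, b[ -> is_derive t (1 : R) x (F (x t))].

Definition forward_invariant (A : set (state R n)) : Prop :=
  forall (T : R) (x : R -> state R n), 0 <= T -> flow_on 0 T x ->
    A (x 0) -> forall t, t \in `[0, T] -> A (x t).

Definition impact_invariant (A : set (state R n)) : Prop :=
  A `&` impact_surface !=set0 /\ impact @` (A `&` impact_surface) `<=` A.

Definition hybrid_invariant (A : set (state R n)) : Prop :=
  forward_invariant A /\ impact_invariant A.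

(* A solution on [0, tau m.+1] with m impacts, at the times tau 1, ..., tau m;
   phi j is the arc between impacts j and j + 1, so at an impact time both x^-
   and x^+ are values of the solution. The horizon tau m.+1 is arbitrary, and a
   solution with infinitely many impacts or on an infinite horizon is the union
   of its truncations, which are of this form. *)
Definition hybrid_solution (m : nat) (tau : nat -> R)
    (phi : nat -> R -> state R n) : Prop :=
  [/\ tau 0%N = 0,
      forall j, (j <= m)%N -> tau j <= tau j.+1 /\
                              flow_on (tau j) (tau j.+1) (phi j),
      forall j, (j <= m)%N -> forall t, t \in `[tau j, tau j.+1[ ->
        ~ impact_surface (phi j t) &
      forall j, (j < m)%N -> impact_surface (phi j (tau j.+1)) /\
        phi j.+1 (tau j.+1) = impact (phi j (tau j.+1))].

(* Exponential decay, along all solutions starting in U, of a transverse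
   coordinate y. Norms are sup norms; M absorbs the choice of norm. *)
Definition exponentially_stable_on (Y : normedModType R) (U : set (state R n))
    (y : state R n -> Y) : Prop :=
  exists M lambda : R, [/\ 1 <= M, 0 < lambda &
    forall m tau phi, hybrid_solution m tau phi -> U (phi 0%N 0) ->
      forall j t, (j <= m)%N -> t \in `[tau j, tau j.+1] ->
        `|y (phi j t)| <= M * expR (- lambda * t) * `|y (phi 0%N 0)| ].

End Trajectories.

End Model.

Record reference (R : realType) (n : nat) := Reference {
  href : R -> 'cV[R]_n;
  Vref : R -> R;
  Sref : R -> R
}.

Record gains (R : realType) (n : nat) := Gains {
  KP : 'M[R]_n;
  KV : 'M[R]_n;
  beta0 : R;
  gamma : R
}.

Definition admissible (R : realType) (n : nat) (p : gains R n) : Prop :=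
  [/\ posdefmx (KP p), posdefmx (KV p), 0 < beta0 p & 0 < gamma p].

Section Control.
Variables (R : realType) (n : nat) (rb : robot R n) (rf : reference R n).

Let S := Sref rf.
Let V := Vref rf.

Definition k2 (h : 'cV[R]_n) (q : R) : R := - gravityN rb (h + href rf q, q).

Record reference_functions : Prop := ReferenceFunctions {
  smooth_href : smooth (href rf : R -> 'cV[R]_n);
  smooth_Vref : smooth (Vref rf : R -> R);
  smooth_Sref : smooth (Sref rf : R -> R);
  Vref_gt0 : forall q, 0 < V q;
  SrefE : forall q, S^`()%classic q * V q = k2 0 q;
  k2_factor : exists f2 : 'cV[R]_n * R -> 'cV[R]_n,
    (exists B : R, forall z, `|f2 z| <= B) /\
    (forall h q, k2 h q - S^`()%classic q * V q = (h^T *m f2 (h, q)) 0 0)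
}.

Definition hr (x : state R n) : 'cV[R]_n := qr x - href rf (qN x).
Definition dhr (x : state R n) : 'cV[R]_n := lie (drift rb) hr x.

Definition output (x : state R n) : 'cV[R]_(n + 1) :=
  col_mx (hr x) (qN x)%:M.

Definition decoupling (x : state R n) : 'M[R]_(n + 1) :=
  \matrix_(i, j) lie (fun z => control rb z (delta_mx j 0))
                     (lie (drift rb) output) x i 0.

Definition linearizing_input (v : state R n -> 'cV[R]_(n + 1)) (x : state R n)
    : 'cV[R]_(n + 1) :=
  invmx (decoupling x) *m (v x - lie (drift rb) (lie (drift rb) output) x).

Section Gains.
Variable p : gains R n.

Definition bvar (x : state R n) : R := sigmaN x - S (qN x).
Definition shaping (x : state R n) : R :=
  gamma p / beta0 p * S^`()%classic (qN x) * bvar x.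
Definition cvar (x : state R n) : R := dqN x - V (qN x) - shaping x.

Definition v_r (x : state R n) : 'cV[R]_n := - (KP p *m hr x) - KV p *m dhr x.

(* The time derivative of [shaping] is taken along the drift: [shaping] depends
   on (q_N, sigma_N) only, whose derivatives do not involve the input. *)
Definition v_N (x : state R n) : R :=
  V^`()%classic (qN x) * dqN x + gamma p * S^`()%classic (qN x) * bvar x
  - beta0 p * (dqN x - V (qN x)) + lie (drift rb) shaping x.

Definition ustar : state R n -> 'cV[R]_(n + 1) :=
  linearizing_input (fun x => col_mx (v_r x) (v_N x)%:M).

Definition closed_loop (x : state R n) : state R n :=
  drift rb x + control rb x (ustar x).

Definition manifoldZ : set (state R n) :=
  [set x | [/\ valid rb x, hr x = 0, dhr x = 0, bvar x = 0 & cvar x = 0]].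

Definition transverse (x : state R n) : 'cV[R]_n * 'cV[R]_n * R * R :=
  (hr x, dhr x, bvar x, cvar x).

(* The nominal step sweeps Z: q_N runs over [qplus, qminus], increasingly since
   q_N' = V > 0 on Z, and an impact at qminus resets it to qplus. On the step
   the foot meets the ground transversally, and gravity has a nonzero moment
   about the stance foot at some instant, i.e. the centre of mass does not stay
   above the stance foot throughout. *)
Record nominal_step (qplus qminus : R) : Prop := NominalStep {
  nominal_lt : qplus < qminus;
  nominal_range : forall q,
    (exists2 x, manifoldZ x & qN x = q) <-> q \in `[qplus, qminus];
  nominal_impact : forall x, manifoldZ x -> impact_surface rb x ->
    qN x = qminus /\ qN (impact rb x) = qplus;
  nominal_transversal : forall x, manifoldZ x -> p2 rb x = 0 -> dp2 rb x != 0;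
  nominal_moment : exists2 q, q \in `[qplus, qminus] & k2 0 q != 0
}.

End Gains.

Definition manifoldW : set (state R n) :=
  [set x | [/\ valid rb x, hr x = 0 & dhr x = 0]].

End Control.

(* Main.v *)
(* In the transverse coordinates the closed loop is a cascade,
     h_r'' = - K_P h_r - K_V h_r',    c' = - beta0 c,
     b' = <h_r, f2> - S' c - (gamma / beta0) S'^2 b,
   driving q_N' = V + c + (gamma / beta0) S' b.  Put K_P = k^2, K_V = 2 k,
   beta0 = k and gamma = e k.  Along a step, h_r and c contract by a factor that
   tends to 0 as k grows, and b by exp (- e A) up to an error O(1 / k), where A
   bounds the time integral of S'^2 from below; A > 0 because gravity has a
   nonzero moment somewhere on the step.  Transversality pins the impact to
   |q_N - qminus| = O(|h_r|), so near Z the impact map is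
     (h_r, h_r')+ = O(|h_r| + |h_r'|),
     b+ = (1 + a e) b + O(|h_r| + |h_r'| + |c|),
     c+ = O(|h_r| + |h_r'| + |b| + |c|)
   with constants that depend on e but not on k.  Choose e so large that
   |1 + a e| exp (- e A / 2) <= 1/4, whatever the sign of a, and then k so large
   that a weighted sum of |h_r|, |h_r'|, |b|, |c| halves from one step to the
   next. *)
Require Import Defs.
From mathcomp Require Import all_boot all_order all_algebra.
From mathcomp Require Import all_classical all_reals all_analysis.
From mathcomp Require Import ring lra.
Import Order.TTheory GRing.Theory Num.Theory.
Import numFieldNormedType.Exports.
Local Open Scope classical_set_scope.
Local Open Scope ring_scope.

Set Implicit Arguments.
Unset Strict Implicit.
Unset Printing Implicit Defensive.

(** * Differential inequalities on the line *)

Section RealLine.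
Variable R : realType.
Implicit Types (f df : R -> R) (a b k r s t : R).

(** The obstacle is the mutual dependence of the constants. All bounds hold in a strip of q_N
    slightly longer than the nominal step, yet nothing assumes that solutions stay there. The ground
    is the barrier: valid states have [p2 >= 0], which near Z forces q_N <= qminus + O(|h_r|), while
    q_N' > 0 guards the other end. Within an arc the error may grow by a factor of order k, so the
    neighbourhood is chosen last and shrinks with k. The ratio e and the impact constants are fixed
    before k; this is possible because the gains enter c only through gamma / beta0 = e. The first
    arc may start anywhere near Z, so it can be too short to contract anything; together with the
    first impact it costs a fixed factor, and the halving begins with the second arc. Since q_N' is
    bounded below, every arc lasts at most some T, and one factor 1/2 per step becomes the rate ln 2
    / T. The disc angle stays out of all estimates: by the cyclicity of q_d and the impact
    invariance of Z, it cannot influence the shape after impact. *)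

Definition has_derivative_on (a b : R) (f df : R -> R) : Prop :=
  {within `[a, b], continuous f} /\
  forall t : R, t \in `]a, b[ -> is_derive t (1 : R) f (df t).

Lemma has_derivative_onW a b s t f df : a <= s -> t <= b ->
  has_derivative_on a b f df -> has_derivative_on s t f df.
Proof.
move=> als tb [cf df']; split.
  by apply: continuous_subspaceW cf; apply: subset_itv; rewrite bnd_simp.
move=> u; rewrite in_itv/= => /andP[su ut]; apply: df'.
by rewrite in_itv/= (le_lt_trans als su) (lt_le_trans ut tb).
Qed.

Lemma has_derivative_on_nincr a b f df : a <= b ->
  has_derivative_on a b f df -> (forall t, t \in `]a, b[ -> df t <= 0) ->
  f b <= f a.
Proof.
move=> ab [cf df'] d0.
have [->|anb] := eqVneq a b; first by [].
have altb : a < b by rewrite lt_neqAle anb.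
have [c cab E] := MVT altb df' cf.
by rewrite -subr_le0 E mulr_le0_ge0 ?d0 // subr_ge0.
Qed.

Lemma has_derivative_on_ndecr a b f df : a <= b ->
  has_derivative_on a b f df -> (forall t, t \in `]a, b[ -> 0 <= df t) ->
  f a <= f b.
Proof.
move=> ab [cf df'] d0.
have [->|anb] := eqVneq a b; first by [].
have altb : a < b by rewrite lt_neqAle anb.
have [c cab E] := MVT altb df' cf.
by rewrite -subr_ge0 E mulr_ge0 ?d0 // subr_ge0.
Qed.

Lemma has_derivative_onM a b f df g dg :
  has_derivative_on a b f df -> has_derivative_on a b g dg ->
  has_derivative_on a b (fun t => f t * g t)
    (fun t => f t * dg t + g t * df t).
Proof.
move=> [cf df'] [cg dg']; split=> [x|t tab].
  by apply: continuousM; [exact: cf|exact: cg].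
have := df' t tab; have := dg' t tab => ? ?.
exact: is_deriveM.
Qed.

Lemma has_derivative_onD a b f df g dg :
  has_derivative_on a b f df -> has_derivative_on a b g dg ->
  has_derivative_on a b (fun t => f t + g t) (fun t => df t + dg t).
Proof.
move=> [cf df'] [cg dg']; split=> [x|t tab].
  by apply: continuousD; [exact: cf|exact: cg].
have := df' t tab; have := dg' t tab => ? ?.
exact: is_deriveD.
Qed.

Lemma has_derivative_onN a b f df :
  has_derivative_on a b f df ->
  has_derivative_on a b (fun t => - f t) (fun t => - df t).
Proof.
move=> [cf df']; split=> [x|t tab]; first by apply: continuousN; exact: cf.
have := df' t tab => ?; exact: is_deriveN.
Qed.

Lemma has_derivative_on_comp a b f df (g dg : R -> R) :
  (forall t, t \in `[a, b] -> is_derive (f t) (1 : R) g (dg (f t))) ->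
  has_derivative_on a b f df ->
  has_derivative_on a b (fun t => g (f t)) (fun t => dg (f t) * df t).
Proof.
move=> dg' [cf df']; split=> [|t tab].
  move/subspace_continuousP : cf => cf; apply/subspace_continuousP => x xab.
  apply: (@cvg_comp _ _ _ _ _ _ (nbhs (f x))); first exact: cf.
  have /derivable1_diffP/differentiable_continuous : derivable g (f x) 1.
    by apply: ex_derive; exact: dg'.
  exact.
have := df' t tab; have := dg' t (subset_itv_oo_cc tab) => ? ?.
exact: is_derive1_comp.
Qed.

Lemma has_derivative_onT a b f df :
  (forall x, is_derive x (1 : R) f (df x)) -> has_derivative_on a b f df.
Proof.
move=> d; split=> [|t _]; last exact: d.
apply: continuous_subspaceT => x.
by apply/differentiable_continuous/derivable1_diffP; apply: ex_derive; exact: d.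
Qed.

Lemma has_derivative_on_eq a b f df dg : has_derivative_on a b f df ->
  (forall t, t \in `]a, b[ -> df t = dg t) -> has_derivative_on a b f dg.
Proof. by move=> [cf df'] E; split=> // t tab; rewrite -E //; exact: df'. Qed.

Lemma has_derivative_on_cst a b k :
  has_derivative_on a b (fun=> k) (fun=> 0).
Proof. by apply: has_derivative_onT => x; exact: is_derive_cst. Qed.

Lemma has_derivative_on_id a b : has_derivative_on a b id (fun=> 1).
Proof. by apply: has_derivative_onT => x; exact: is_derive_id. Qed.

Lemma has_derivative_on_expR a b k s :
  has_derivative_on a b (fun t => expR (k * (t - s)))
    (fun t => k * expR (k * (t - s))).
Proof.
have H : has_derivative_on a b (fun t => k * (t - s)) (fun t => k).
  apply: (has_derivative_on_eq (has_derivative_onM (has_derivative_on_cst a b k)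
    (has_derivative_onD (has_derivative_on_id a b)
       (has_derivative_on_cst a b (- s))))) => t _ /=; ring.
apply: (has_derivative_on_eq (has_derivative_on_comp (fun t _ => is_derive_expR _) H)).
by move=> t _; rewrite mulrC.
Qed.

Lemma has_derivative_on0 a b f df : a <= b ->
  has_derivative_on a b f df -> (forall t, t \in `]a, b[ -> df t = 0) ->
  f b = f a.
Proof.
move=> ab Hf d0; apply/eqP; rewrite eq_le.
rewrite (has_derivative_on_nincr ab Hf) ?(has_derivative_on_ndecr ab Hf) //.
  by move=> t /d0 ->.
by move=> t /d0 ->.
Qed.

Lemma exp_decay a b k f df : a <= b -> has_derivative_on a b f df ->
  (forall t, t \in `]a, b[ -> df t = - k * f t) ->
  f b = expR (- k * (b - a)) * f a.
Proof.
move=> ab Hf E.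
have H := has_derivative_onM (has_derivative_on_expR a b k a) Hf.
have := has_derivative_on0 ab H _; rewrite subrr mulr0 expR0 mul1r => <-.
  by rewrite mulrA -expRD mulNr addNr expR0 mul1r.
by move=> t tab; rewrite E //; ring.
Qed.

(** The combination h' + k h solves a first-order equation and equals exp(- k (t - a)) g. Hence
    exp(k (t - a)) h - (t - a) g is constant, which gives the closed form. *)
Lemma critically_damped a b k h dh : 0 <= b - a ->
  has_derivative_on a b h dh ->
  has_derivative_on a b dh (fun t => - (k ^+ 2 * h t) - 2 * k * dh t) ->
  let g := dh a + k * h a in
  h b = expR (- k * (b - a)) * (h a + (b - a) * g) /\
  dh b = expR (- k * (b - a)) * (dh a - k * (b - a) * g).
Proof.
rewrite subr_ge0 => ab Hh Hdh g.
have Hg : has_derivative_on a b (fun t => dh t + k * h t)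
    (fun t => - k * (dh t + k * h t)).
  apply: (has_derivative_on_eq (has_derivative_onD Hdh
    (has_derivative_onM (has_derivative_on_cst a b k) Hh))) => t _.
  ring.
have gE t : t \in `[a, b] -> dh t + k * h t = expR (- k * (t - a)) * g.
  rewrite in_itv/= => /andP[at_ tb].
  exact: (exp_decay at_ (has_derivative_onW (lexx a) tb Hg)).
pose e t := expR (k * (t - a)).
have eE t : e t * expR (- k * (t - a)) = 1.
  by rewrite /e -expRD mulNr subrr expR0.
have Hu : has_derivative_on a b
    (fun t => e t * h t + - ((t - a) * g)) (fun=> 0).
  apply: (has_derivative_on_eq (has_derivative_onD
    (has_derivative_onM (has_derivative_on_expR a b k a) Hh)
    (has_derivative_onN (has_derivative_onM
       (has_derivative_onD (has_derivative_on_id a b)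
          (has_derivative_on_cst a b (- a)))
       (has_derivative_on_cst a b g))))) => t tab.
  have /gE E : t \in `[a, b] by apply: subset_itv_oo_cc.
  have -> : e t * dh t + h t * (k * e t) = e t * (dh t + k * h t) by ring.
  by rewrite E mulrA eE; ring.
have := has_derivative_on0 ab Hu (fun _ _ => erefl).
rewrite {2}/e !subrr !mul0r mulr0 expR0 mul1r oppr0 addr0 => E.
have hE : h b = expR (- k * (b - a)) * (h a + (b - a) * g).
  have -> : h a + (b - a) * g = e b * h b by rewrite -E; ring.
  by rewrite mulrA [expR _ * e b]mulrC eE mul1r.
split=> //; have := gE b; rewrite bound_itvE => /(_ ab) E2.
by rewrite -[dh b](addrK (k * h b)) E2 hE /g; ring.
Qed.

(* [sqrt (y^2 + d^2)] is a differentiable majorant of [|y|]; let [d] tend to 0. *)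
Lemma gronwall_abs a b (y dy A dA g dg : R -> R) (L : R) : a <= b ->
  has_derivative_on a b y dy -> has_derivative_on a b A dA ->
  has_derivative_on a b g dg ->
  (forall t, t \in `[a, b] -> g a <= g t) ->
  (forall t, t \in `]a, b[ -> exists w u : R, [/\ dy t = - w * y t + u,
      dA t <= w, 0 <= dA t, w <= L & `|u| <= dg t]) ->
  `|y b| <= expR (- (A b - A a)) * `|y a| + (g b - g a).
Proof.
move=> ab Hy HA Hg ga Hdy.
have L0 : a < b -> 0 <= L.
  move=> altb; have /Hdy[w [u [_ h1 h2 h3 _]]] : (a + b) / 2 \in `]a, b[.
    by rewrite in_itv/=; apply/andP; split; lra.
  lra.
suff key d : 0 < d ->
    `|y b| <= expR (- (A b - A a)) * (`|y a| + d) + (g b - g a) + L * d * (b - a).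
  have [ab'|ab'] := ltP a b; last first.
    have -> : b = a by apply/eqP; rewrite eq_le ab' ab.
    by rewrite !subrr oppr0 expR0 mul1r addr0.
  apply/ler_addgt0Pr => e e0.
  pose D := expR (- (A b - A a)) + L * (b - a).
  have D0 : 0 < D.
    apply: ltr_pwDl; first exact: expR_gt0.
    by rewrite mulr_ge0 ?L0 // subr_ge0.
  have := key (e / D) (divr_gt0 e0 D0); move=> /le_trans; apply.
  have -> : expR (- (A b - A a)) * (`|y a| + e / D) + (g b - g a) + L * (e / D) * (b - a)
     = expR (- (A b - A a)) * `|y a| + (g b - g a) + D * (e / D) by rewrite /D; ring.
  by rewrite [D * _]mulrC divfK // gt_eqF.
move=> d0.
pose q t := y t ^+ 2 + d ^+ 2.
have q0 t : 0 < q t by rewrite /q; have := sqr_ge0 (y t); have := exprn_gt0 2 d0; lra.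
pose r t := Num.sqrt (q t).
have r0 t : 0 < r t by rewrite sqrtr_gt0.
have rr t : r t * r t = q t by rewrite -expr2 sqr_sqrtr // ltW.
have yr t : `|y t| <= r t.
  rewrite -(ger0_norm (ltW (r0 t))) -ler_sqr ?nnegrE // !real_normK ?num_real //.
  by rewrite [r t ^+ 2]expr2 rr /q; have := exprn_gt0 2 d0; lra.
have ryd t : r t <= `|y t| + d.
  rewrite -(ger0_norm (ltW (r0 t))) -ler_sqr ?nnegrE ?addr_ge0 ?(ltW d0) //.
  rewrite real_normK ?num_real // [r t ^+ 2]expr2 rr /q sqrrD real_normK ?num_real //.
  have := mulr_ge0 (normr_ge0 (y t)) (ltW d0).
  by rewrite -mulr_natr; lra.
have dr t : d <= r t.
  rewrite -(ger0_norm (ltW (r0 t))) -(ger0_norm (ltW d0)) -ler_sqr ?nnegrE //.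
  by rewrite !real_normK ?num_real // [r t ^+ 2]expr2 rr /q; have := sqr_ge0 (y t); lra.
have Hq : has_derivative_on a b q (fun t => 2 * y t * dy t).
  apply: (has_derivative_on_eq (has_derivative_onD (has_derivative_onM Hy Hy)
    (has_derivative_on_cst a b (d ^+ 2)))) => t _; ring.
have Hr : has_derivative_on a b r (fun t => y t * dy t / r t).
  apply: (has_derivative_on_eq (has_derivative_on_comp (dg := fun x => (2 * Num.sqrt x)^-1)
    (fun t _ => is_derive1_sqrt (q0 t)) Hq)) => t _.
  have := r0 t; rewrite /r /= => /lt0r_neq0 h; by field.
(* The product of exp(A) with [v] is nonincreasing. Replacing y^2 by r^2 - d^2 in the damping term
   costs at most w d, which the slope L d pays for; the bound [v <= r] is where [g a <= g t]
   enters. *)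
pose v t := r t + - (g t - g a + L * d * (t - a)).
have Hv : has_derivative_on a b v
    (fun t => y t * dy t / r t - (dg t + L * d)).
  apply: (has_derivative_on_eq (has_derivative_onD Hr (has_derivative_onN
    (has_derivative_onD (has_derivative_onD Hg (has_derivative_on_cst a b (- g a)))
    (has_derivative_onM (has_derivative_on_cst a b (L * d))
       (has_derivative_onD (has_derivative_on_id a b)
          (has_derivative_on_cst a b (- a)))))))) => t _; ring.
have Hw := has_derivative_onM
  (has_derivative_on_comp (fun t _ => is_derive_expR _) HA) Hv.
have := has_derivative_on_nincr ab Hw _.
have va : v a = r a by rewrite /v !subrr mulr0 addr0 subr0.
rewrite va => H; have {}H : expR (A b) * v b <= expR (A a) * r a.
  apply: H => t tab; have [w [u [-> h1 h2 h3 h4]]] := Hdy t tab.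
  have -> : expR (A t) * (y t * (- w * y t + u) / r t - (dg t + L * d)) +
    v t * (expR (A t) * dA t) = expR (A t) *
      (y t * (- w * y t + u) / r t - (dg t + L * d) + dA t * v t) by ring.
  rewrite pmulr_rle0 ?expR_gt0 //.
  have tab' : t \in `[a, b] by apply: subset_itv_oo_cc.
  have vr : v t <= r t.
    have := ga t tab'; move: tab'; rewrite in_itv/= => /andP[at_ tb] gat.
    have : 0 <= L * d * (t - a) by rewrite !mulr_ge0 ?(ltW d0) ?subr_ge0 //; lra.
    rewrite /v; lra.
  have h5 : dA t * v t <= w * r t.
    apply: le_trans (ler_wpM2l h2 vr) _.
    by rewrite ler_wpM2r // ltW.
  have h6 : y t * u <= r t * dg t.
    apply: le_trans (ler_norm _) _; rewrite normrM.
    by rewrite ler_pM.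
  have h7 : d ^+ 2 <= d * r t by rewrite expr2 ler_wpM2l // ltW.
  have h8 : y t * (- w * y t + u) / r t <= - w * r t + w * d + dg t.
    rewrite ler_pdivrMr //.
    have -> : y t * (- w * y t + u) = - w * (r t * r t) + w * d ^+ 2 + y t * u.
      by rewrite rr /q; ring.
    have : w * d ^+ 2 <= w * (d * r t) by rewrite ler_wpM2l //; lra.
    lra.
  have : w * d <= L * d by rewrite ler_wpM2r // ltW.
  lra.
have h1 : v b <= expR (- (A b - A a)) * r a.
  have -> : v b = expR (- A b) * (expR (A b) * v b).
    by rewrite mulrA -expRD addNr expR0 mul1r.
  by rewrite opprB [A a - _]addrC expRD -mulrA ler_wpM2l // ltW ?expR_gt0.
have h2 : expR (- (A b - A a)) * r a <= expR (- (A b - A a)) * (`|y a| + d).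
  by rewrite ler_wpM2l ?ryd // ltW ?expR_gt0.
have := yr b; rewrite /v in h1; lra.
Qed.

Lemma within_continuous_dist a b f t e : {within `[a, b], continuous f} ->
  t \in `[a, b] -> 0 < e ->
  exists2 d : R, 0 < d & forall s, s \in `[a, b] -> `|s - t| < d -> `|f s - f t| < e.
Proof.
move=> /subspace_continuousP cf tab e0; have := cf t tab.
move=> /cvgrPdist_lt /(_ e e0) [d /= d0 Hd]; exists d => // s sab sd.
by rewrite distrC; apply: (Hd s) => //=; rewrite distrC.
Qed.

(** Continuous induction: let T be the supremum of the times up to which the bound holds strictly.
    Continuity gives [f T <= k], the hypothesis makes this strict, and continuity then carries the
    bound beyond T. *)
Lemma first_exit a b f k : {within `[a, b], continuous f} -> f a < k ->
  (forall t, t \in `[a, b] -> (forall s, s \in `[a, t] -> f s <= k) -> f t < k) ->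
  forall t, t \in `[a, b] -> f t < k.
Proof.
move=> cf fa H t0 t0ab; rewrite ltNge; apply/negP => ft0.
have [at0 t0b] : a <= t0 /\ t0 <= b by move: t0ab; rewrite in_itv/= => /andP.
pose E := [set t | t \in `[a, t0] /\ forall s, s \in `[a, t] -> f s < k].
have Ea : E a.
  split; first by rewrite bound_itvE.
  by move=> s; rewrite itvxx => /eqP ->.
have Eub : ubound E t0 by move=> s [+ _]; rewrite in_itv/= => /andP[].
have hsE : has_sup E by split; [exists a|exists t0].
pose T := sup E.
have aT : a <= T by apply: sup_upper_bound.
have Tt0 : T <= t0 by apply: sup_le_ub => //; exists a.
have below s : a <= s -> s < T -> f s < k.
  move=> as_ sT; have := sup_adherent (_ : 0 < T - s) hsE.
  rewrite subr_gt0 => /(_ sT)[e [_ He]]; rewrite -/T subKr => se.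
  by apply: He; rewrite in_itv/= as_ ltW.
have Tab : T \in `[a, b] by rewrite in_itv/= aT (le_trans Tt0).
have fTk : f T <= k.
  rewrite leNgt; apply/negP => kfT.
  have k0 : 0 < f T - k by rewrite subr_gt0.
  have [d d0 Hd] := within_continuous_dist cf Tab k0.
  have aT' : a < T.
    rewrite lt_neqAle aT andbT; apply/eqP => aTE; move: kfT fa; rewrite -aTE; lra.
  pose s := Num.max a (T - d / 2).
  have sT : s < T by rewrite /s gt_max aT'; lra.
  have as_ : a <= s by rewrite /s le_max lexx.
  have sd : T - d / 2 <= s by rewrite /s le_max lexx orbT.
  have := Hd s; rewrite in_itv/= as_ (le_trans (ltW sT) (le_trans Tt0 t0b)) => /(_ isT).
  rewrite !ltr_norml; have := below s as_ sT; lra.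
have fTk' : f T < k.
  apply: H => // s; rewrite in_itv/= => /andP[as_]; rewrite le_eqVlt.
  by case/predU1P => [->//|/(below s as_)/ltW].
have Tlt : T < t0.
  rewrite lt_neqAle Tt0 andbT; apply/eqP => E0; move: ft0; rewrite -E0; lra.
have k0 : 0 < k - f T by rewrite subr_gt0.
have [d d0 Hd] := within_continuous_dist cf Tab k0.
pose s := Num.min t0 (T + d / 2).
have Ts : T < s by rewrite /s lt_min Tlt; lra.
have st0 : s <= t0 by rewrite /s ge_min lexx.
have sd : s <= T + d / 2 by rewrite /s ge_min lexx orbT.
have : s <= T.
  apply: sup_upper_bound => //; split.
    by rewrite in_itv/= st0 andbT (le_trans aT) // ltW.
  move=> u; rewrite in_itv/= => /andP[au us].
  have [uT|Tu] := ltP u T; first exact: below.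
  have := Hd u; rewrite in_itv/= au (le_trans us (le_trans st0 t0b)) => /(_ isT).
  rewrite !ltr_norml; lra.
by rewrite leNgt Ts.
Qed.

(** Because k <= (1 + k/4)^2 <= exp(k/4)^2. The high-gain estimates use it to spend half of an
    exponential on a factor that grows with the gain. *)
Lemma mulr_expR_le k : k * expR (- (k / 2)) <= 1.
Proof.
rewrite expRN ler_pdivrMr ?expR_gt0 // mul1r.
have -> : expR (k / 2) = expR (k / 4) ^+ 2.
  by rewrite expr2 -expRD; congr expR; lra.
have [k0|k0] := leP k 0.
  exact: le_trans k0 (exprn_ge0 _ (expR_ge0 _)).
have h : 1 + k / 4 <= expR (k / 4) by exact: expR_ge1Dx.
apply: (@le_trans _ _ ((1 + k / 4) ^+ 2)).
  have := sqr_ge0 (k / 4 - 1); lra.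
by rewrite ler_sqr ?nnegrE ?expR_ge0 //; lra.
Qed.

Lemma continuous_antiderivative a b f : a < b -> continuous f ->
  exists A : R -> R, forall x, a < x < b -> is_derive x (1 : R) A (f x).
Proof.
move=> ab cf; have intf : (@lebesgue_measure R).-integrable `[a, b] (EFin \o f).
  apply: continuous_compact_integrable; first exact: segment_compact.
  exact: continuous_subspaceT.
exists (fun x => \int[lebesgue_measure]_(t in [set` `[a, x]]) f t) => x /andP[ax xb].
have [d E] := continuous_FTC1_closed xb intf ax (cf x).
by rewrite -E derive1E; exact: derivableP.
Qed.

Lemma antiderivative_lt a b x0 f A : a < b -> continuous f ->
  (forall x, x \in `[a, b] -> 0 <= f x) -> x0 \in `[a, b] -> f x0 != 0 ->
  has_derivative_on a b A f -> A a < A b.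
Proof.
move=> ab cf f0 x0ab fx0 HA.
have fx0' : 0 < f x0 by rewrite lt_def fx0 f0.
have mono u v : a <= u -> u <= v -> v <= b -> A u <= A v.
  move=> au uv vb; apply: (has_derivative_on_ndecr uv (has_derivative_onW au vb HA)).
  move=> t; rewrite in_itv/= => /andP[ut tv]; apply: f0.
  by rewrite in_itv/= (le_trans au (ltW ut)) (le_trans (ltW tv) vb).
have cfw : {within `[a, b], continuous f} by exact: continuous_subspaceT.
have [d d0 Hd] := within_continuous_dist cfw x0ab fx0'.
(* The interval around [x0] is clipped to [a, b], since [x0] may be an endpoint. *)
pose u := Num.max a (x0 - d / 2); pose v := Num.min b (x0 + d / 2).
move: x0ab; rewrite in_itv/= => /andP[ax0 x0b].
have au : a <= u by rewrite le_max lexx.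
have vb : v <= b by rewrite ge_min lexx.
have uv : u < v by rewrite gt_max !lt_min ab; apply/andP; split; lra.
have ud : x0 - d / 2 <= u by rewrite le_max lexx orbT.
have vd : v <= x0 + d / 2 by rewrite ge_min lexx orbT.
have [cA dA] := has_derivative_onW au vb HA.
have [c cuv E] := MVT uv dA cA.
move: cuv; rewrite in_itv/= => /andP[uc cv].
have fc : 0 < f c.
  have := Hd c; rewrite in_itv/= (le_trans au (ltW uc)) (le_trans (ltW cv) vb).
  move=> /(_ isT); rewrite !ltr_norml; lra.
have h1 : A a <= A u by apply: mono => //; lra.
have h2 : A v <= A b by apply: mono => //; lra.
have : 0 < f c * (v - u) by rewrite mulr_gt0 // subr_gt0.
lra.
Qed.

End RealLine.

(** * Directional derivatives *)

Section DirectionalDerivatives.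
Variable R : realType.
Implicit Types V W : normedModType R.

Lemma is_derive_linear V W (f : V -> W) (x v : V) :
  linear f -> is_derive x v f (f v).
Proof.
move=> lf.
have E : (fun h : R => h^-1 *: (f (h *: v + x) - f x)) @ 0^' --> f v.
  apply/cvgrPdist_le => e e0; near=> h => /=.
  rewrite lf addrK scalerA mulVf ?scale1r ?subrr ?normr0 ?(ltW e0) //.
  by near: h; exact: nbhs_dnbhs_neq.
by split; [apply/cvg_ex; exists (f v)|exact: cvg_lim E].
Unshelve. all: by end_near. Qed.

Lemma differentiable_mx V m n (M : V -> 'M[R]_(m, n)) x :
  (forall i j, differentiable (fun y => M y i j) x) -> differentiable M x.
Proof.
move=> H.
have -> : M = (\sum_(i < m) \sum_(j < n) (fun y => M y i j *: delta_mx i j)).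
  apply/funext => y; rewrite fct_sumE [LHS]matrix_sum_delta.
  by apply: eq_bigr => i _; rewrite fct_sumE.
apply: differentiable_sum => i; apply: differentiable_sum => j.
exact: differentiableZl.
Qed.

Lemma derivable_coord V m n (M : V -> 'M[R]_(m, n)) x v i j :
  derivable M x v -> is_derive x v (fun y => M y i j) ('D_v M x i j).
Proof.
move=> dM; rewrite derive_mx // mxE; apply: derivableP.
by move/derivable_mxP : dM.
Qed.

Lemma is_derive_diff V W (f : V -> W) (x v : V) :
  differentiable f x -> is_derive x v f ('D_v f x).
Proof. by move=> df; apply/derivableP/diff_derivable. Qed.

Lemma derive_linear_dir V W (f : V -> W) (x : V) : differentiable f x ->
  linear (fun v => 'D_v f x).
Proof. by move=> df a u v; rewrite !deriveE // linearP. Qed.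

Lemma is_derive_comp V W (f : R -> W) (g : V -> R) (x v : V) (dg : R) :
  differentiable f (g x) -> differentiable g x -> is_derive x v g dg ->
  is_derive x v (f \o g) (dg *: 'D_1 f (g x)).
Proof.
move=> df dgx [_ <-].
have dc : differentiable (f \o g) x by exact: differentiable_comp.
split; first exact: diff_derivable.
rewrite deriveE // diff_comp //= (deriveE v dgx).
rewrite (deriveE (1 : R) df) -linearZ /=; congr (_ _).
by rewrite /GRing.scale /= mulr1.
Qed.

(** The chain rule along a curve, which turns derivatives in the direction of the vector field into
    time derivatives along a solution. *)
Lemma is_derive_along V W (f : V -> W) (g : R -> V) (t : R) (v : V) :
  differentiable f (g t) -> is_derive t (1 : R) g v ->
  is_derive t (1 : R) (f \o g) ('D_v f (g t)).
Proof.
move=> df [dg <-].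
have dg' : differentiable g t by apply/derivable1_diffP.
have dc : differentiable (f \o g) t by exact: differentiable_comp.
split; first exact: diff_derivable.
by rewrite deriveE // diff_comp //= -deriveE // -deriveE.
Qed.

End DirectionalDerivatives.

(** * Block coordinates of the state and their derivatives *)

Section Model.
Variables (R : realType) (n : nat).
Implicit Types (x v : state R n) (q : 'cV[R]_(links n)).

Lemma final_linear : linear (@final R n).
Proof. by move=> a u v; rewrite /final linearP /= !mxE. Qed.

Lemma first_linear : linear (@first R n).
Proof. by move=> a u v; rewrite /first !linearP /= !mxE. Qed.

Lemma middle_linear : linear (@middle R n).
Proof. by move=> a u v; rewrite /middle !linearP. Qed.

Lemma finalE q : final q = q (rshift _ 0) 0.
Proof. by rewrite /final !mxE. Qed.

Lemma firstE q : first q = q (lshift _ (lshift _ 0)) 0.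
Proof. by rewrite /first !mxE. Qed.

Lemma middleE q i : middle q i 0 = q (lshift _ (rshift _ i)) 0.
Proof. by rewrite /middle !mxE. Qed.

Lemma coordsE q : q = col_mx (col_mx (first q)%:M (middle q)) (final q)%:M.
Proof.
by rewrite /first /middle /final -!mx11_scalar !vsubmxK.
Qed.

Lemma differentiable_entry1 x i j :
  differentiable (fun y : state R n => y.1 i j) x.
Proof.
apply: (@differentiable_comp _ _ _ _ fst (fun M : 'cV[R]_(links n) => M i j)).
  by apply: linear_differentiable => p; exact: cvg_fst.
exact: differentiable_coord.
Qed.

Lemma differentiable_entry2 x i j :
  differentiable (fun y : state R n => y.2 i j) x.
Proof.
apply: (@differentiable_comp _ _ _ _ snd (fun M : 'cV[R]_(links n) => M i j)).
  by apply: linear_differentiable => p; exact: cvg_snd.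
exact: differentiable_coord.
Qed.

Lemma differentiable_qN x : differentiable (@qN R n) x.
Proof.
rewrite (_ : @qN R n = fun y => y.1 (rshift _ 0) 0); last first.
  by apply/funext => y; rewrite /qN finalE.
exact: differentiable_entry1.
Qed.

Lemma differentiable_dqN x : differentiable (@dqN R n) x.
Proof.
rewrite (_ : @dqN R n = fun y => y.2 (rshift _ 0) 0); last first.
  by apply/funext => y; rewrite /dqN finalE.
exact: differentiable_entry2.
Qed.

Lemma differentiable_sigmaN x : differentiable (@sigmaN R n) x.
Proof.
rewrite (_ : @sigmaN R n = fun y => y.2 (lshift _ (lshift _ 0)) 0); last first.
  by apply/funext => y; rewrite /sigmaN firstE.
exact: differentiable_entry2.
Qed.

Lemma differentiable_qr x : differentiable (@qr R n) x.
Proof.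
apply: differentiable_mx => i j; rewrite ord1.
rewrite (_ : (fun y => _) = fun y : state R n => y.1 (lshift _ (rshift _ i)) 0).
  exact: differentiable_entry1.
by apply/funext => y; rewrite /qr middleE.
Qed.

Lemma differentiable_dqr x :
  differentiable (fun y : state R n => middle y.2) x.
Proof.
apply: differentiable_mx => i j; rewrite ord1.
rewrite (_ : (fun y => _) = fun y : state R n => y.2 (lshift _ (rshift _ i)) 0).
  exact: differentiable_entry2.
by apply/funext => y; rewrite middleE.
Qed.

Lemma is_derive_qN x v : is_derive x v (@qN R n) (final v.1).
Proof. by apply: is_derive_linear => a y z; rewrite /qN -final_linear. Qed.

Lemma is_derive_sigmaN x v : is_derive x v (@sigmaN R n) (first v.2).
Proof. by apply: is_derive_linear => a y z; rewrite /sigmaN -first_linear. Qed.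

Lemma is_derive_qr x v : is_derive x v (@qr R n) (middle v.1).
Proof. by apply: is_derive_linear => a y z; rewrite /qr -middle_linear. Qed.

End Model.

(** * The closed loop *)

Section Smooth.
Variables (R : realType) (V W : normedModType R) (f : V -> W).
Hypothesis sf : smooth f.

Lemma smooth_differentiable x : differentiable f x.
Proof. by have [] := sf 1%N. Qed.

Lemma smooth_derive v : smooth (fun x => 'D_v f x).
Proof. by move=> k; have [_] := sf k.+1; exact. Qed.

Lemma smooth_continuous : continuous f.
Proof. exact: sf 0%N. Qed.

End Smooth.

Lemma smooth_derive1 (R : realType) (W : normedModType R) (f : R -> W) :
  smooth f -> smooth (f^`()%classic : R -> W).
Proof.
move=> /smooth_derive/(_ 1); congr smooth.
by apply/funext => x; rewrite derive1E.
Qed.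

Definition dhref (R : realType) n (rf : reference R n) (q : R) : 'cV[R]_n :=
  'D_1 (href rf) q.

Section ClosedLoop.
Variables (R : realType) (n : nat) (rb : robot R n) (rf : reference R n).
Hypothesis rbH : bipedal_robot_with_disc rb.
Hypothesis rfH : reference_functions rb rf.
Implicit Types (x : state R n) (w : 'cV[R]_(links n)).

Lemma to_omega_mul (r : 'cV[R]_n) w :
  to_omega rb r *m w =
  col_mx (col_mx (dsubmx (inertia rb r) *m w) (middle w)) (final w)%:M.
Proof.
rewrite /to_omega !mul_col_mx; congr (col_mx (col_mx _ _) _).
  rewrite {1}[w]coordsE !mul_row_col !mul0mx mul1mx add0r addr0.
  by rewrite [w in RHS]coordsE /middle ?col_mxKu ?col_mxKd.
rewrite {1}[w]coordsE !mul_row_col !mul0mx mul1mx add0r.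
by [].
Qed.

Lemma to_omega_qdot x : to_omega rb (qr x) *m qdot rb x = x.2.
Proof. by rewrite /qdot mulKVmx //; exact: to_omega_diffeo. Qed.

Lemma qdotE x :
  [/\ dsubmx (inertia rb (qr x)) *m qdot rb x = (first x.2)%:M,
      middle (qdot rb x) = middle x.2 & final (qdot rb x) = final x.2].
Proof.
have := to_omega_qdot x; rewrite to_omega_mul [in RHS](coordsE x.2).
move=> /eq_col_mx[/eq_col_mx[-> ->] E]; split=> //.
by have := congr1 (fun M : 'M[R]_1 => M 0 0) E; rewrite !mxE /= !mulr1n.
Qed.

Lemma control_linear x : linear (control rb x).
Proof.
by move=> a u v; rewrite /control linearP /=; congr (_, _); rewrite /= scaler0 addr0.
Qed.

Lemma posdefmx_unit m (A : 'M[R]_m) : posdefmx A -> A \in unitmx.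
Proof.
move=> [_ pA]; rewrite -row_free_unit -kermx_eq0; apply/eqP/row_matrixP => i.
rewrite row0; apply/eqP; apply: contraT => nz.
have := pA (row i (kermx A))^T.
rewrite -(inj_eq (@trmx_inj _ _ _)) trmxK trmx0 => /(_ nz).
by rewrite -row_mul mulmx_ker row0 mul0mx mxE ltxx.
Qed.

(* The first row of [to_omega] is the last row of the inertia matrix [D], which
   [D^-1] turns into the last basis covector. *)
Lemma first_to_omega_invmx r w :
  first (to_omega rb r *m invmx (inertia rb r) *m w) = final w.
Proof.
rewrite -mulmxA to_omega_mul /first !col_mxKu /final.
have Iu := posdefmx_unit (inertia_posdef rbH r).
have E : dsubmx w = dsubmx (inertia rb r) *m (invmx (inertia rb r) *m w).
  by rewrite mul_dsub_mx mulKVmx.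
by rewrite E.
Qed.

(** The last row of the actuation matrix vanishes, so no torque acts on sigma_N. *)
Lemma first_control x u : first (control rb x u).2 = 0.
Proof.
rewrite /control /= -mulmxA first_to_omega_invmx /final.
by rewrite -mul_dsub_mx unactuatedN // mul0mx mxE.
Qed.

Lemma to_omega_row0 r j :
  to_omega rb r (lshift _ (lshift _ 0)) j = inertia rb r (rshift _ 0) j.
Proof. by rewrite /to_omega !col_mxEu !mxE. Qed.

Lemma derivable_to_omega r v : derivable (to_omega rb) r v.
Proof.
apply/derivable_mxP => i j.
have dI k l : derivable (fun s => inertia rb s k l) r v.
  have dD : derivable (inertia rb) r v.
    by apply/diff_derivable/smooth_differentiable; exact: smooth_inertia.
  by move/derivable_mxP : dD.
case: (split_ordP i) => [k ->|k ->]; last first.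
  rewrite (_ : (fun s => _) = cst (row_mx (0 : 'M[R]_(1, _)) (1%:M : 'M[R]_1) k j)).
    exact: derivable_cst.
  by apply/funext => s; rewrite /to_omega col_mxEd.
case: (split_ordP k) => [l ->|l ->].
  rewrite (_ : (fun s => _) = (fun s => inertia rb s (rshift _ 0) j)); first exact: dI.
  by apply/funext => s; rewrite ord1 to_omega_row0.
rewrite (_ : (fun s => _) =
    cst (row_mx (row_mx (0 : 'M[R]_(n, 1)) (1%:M : 'M[R]_n)) (0 : 'M[R]_(n, 1)) l j)).
  exact: derivable_cst.
by apply/funext => s; rewrite /to_omega col_mxEu col_mxEd.
Qed.

(** This is sigma_N' = - G_N. The term T' q' contributes the last entry of D' q', which cancels
    against the Coriolis force: the remaining part of that force, the derivative of the kinetic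
    energy in the direction of q_N, is zero because the inertia depends on q_r only. *)
Lemma first_drift x : first (drift rb x).2 = - gravityN rb (Defs.shape x.1).
Proof.
have [_ mE fE] := qdotE x.
have -> : (drift rb x).2 = (-1) *: (to_omega rb (qr x) *m invmx (inertia rb (qr x)) *m
    (coriolis rb (qr x, middle x.2, dqN x) *m qdot rb x + gravity rb (Defs.shape x.1)))
    + 'D_(middle (qdot rb x)) (to_omega rb) (qr x) *m qdot rb x.
  by rewrite scaleN1r addrC.
rewrite first_linear first_to_omega_invmx scaleN1r.
have -> : coriolis rb (qr x, middle x.2, dqN x) *m qdot rb x =
    coriolis_force rb (qr x) (qdot rb x).
  by rewrite -(coriolisE rbH) mE fE.
rewrite -[coriolis_force _ _ _]scale1r final_linear scale1r.
have -> : final (coriolis_force rb (qr x) (qdot rb x)) =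
    final (inertia_rate rb (qr x) (qdot rb x) *m qdot rb x).
  rewrite /coriolis_force addrC -scaleN1r final_linear [X in _ *: X]finalE !mxE.
  rewrite (_ : middle _ = 0); last first.
    apply/matrixP => i j; rewrite ord1 middleE !mxE.
    by rewrite eq_lrshift.
  by rewrite derive0 mulr0 scaler0 add0r.
rewrite -[final (gravity _ _)]/(gravityN _ _) finalE firstE !mxE opprD addrAC [X in X + _ = _]addrC.
rewrite (_ : \sum_j 'D_(middle (qdot rb x)) (to_omega rb) (qr x) _ j * _ =
   \sum_j inertia_rate rb (qr x) (qdot rb x) (rshift (1 + n) 0) j * qdot rb x j 0).
  by rewrite subrr add0r.
apply: eq_bigr => j _; congr (_ * _).
have dT : derivable (to_omega rb) (qr x) (middle (qdot rb x)).
  exact: derivable_to_omega.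
have [_ <-] := derivable_coord (lshift 1 (lshift n 0)) j dT.
rewrite (_ : (fun y => _) = fun s => inertia rb s (rshift _ 0) j).
  have dD : derivable (inertia rb) (qr x) (middle (qdot rb x)).
    by apply/diff_derivable/smooth_differentiable; exact: smooth_inertia.
  by have [_ ->] := derivable_coord (rshift (1 + n) 0) j dD.
by apply/funext => s; rewrite to_omega_row0.
Qed.


Lemma differentiable_href (q : R) : differentiable (href rf) q.
Proof. exact/smooth_differentiable/(smooth_href rfH). Qed.

Lemma differentiable_dhref (q : R) : differentiable (dhref rf) q.
Proof. by apply/smooth_differentiable/smooth_derive/(smooth_href rfH). Qed.

Lemma differentiable_hr x : differentiable (hr rf) x.
Proof.
apply: differentiableB; first exact: differentiable_qr.
apply: (@differentiable_comp _ _ _ _ (@qN R n) (href rf)).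
  exact: differentiable_qN.
exact: differentiable_href.
Qed.

Lemma is_derive_hr x v :
  is_derive x v (hr rf) (middle v.1 - final v.1 *: dhref rf (qN x)).
Proof.
have ? := is_derive_qr x v.
have ? := is_derive_comp (differentiable_href (qN x)) (differentiable_qN x)
  (is_derive_qN x v).
exact: is_deriveB.
Qed.

Lemma dhrE x : dhr rb rf x = middle x.2 - dqN x *: dhref rf (qN x).
Proof.
rewrite /dhr /lie; have [_ ->] := is_derive_hr x (drift rb x).
by have [_ -> ->] := qdotE x.
Qed.

Lemma differentiable_dhr x : differentiable (dhr rb rf) x.
Proof.
rewrite (_ : dhr rb rf = (fun y : state R n => middle y.2) -
    (fun y => dqN y *: dhref rf (qN y))); last by apply/funext => y; rewrite dhrE.
apply: differentiableB; first exact: differentiable_dqr.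
apply: differentiable_mx => i j.
rewrite (_ : (fun y => _) = fun y : state R n => dqN y * dhref rf (qN y) i j); last first.
  by apply/funext => y; rewrite mxE.
apply: differentiableM; first exact: differentiable_dqN.
apply: (@differentiable_comp _ _ _ _ (@qN R n) (fun q => dhref rf q i j)).
  exact: differentiable_qN.
apply: (@differentiable_comp _ _ _ _ (dhref rf) (fun M : 'cV[R]_n => M i j)).
  exact: differentiable_dhref.
exact: differentiable_coord.
Qed.

Lemma lie_output x :
  lie (drift rb) (output rf) x = col_mx (dhr rb rf x) (dqN x)%:M.
Proof.
have dO : derivable (output rf) x (drift rb x).
  apply/derivable_mxP => i j; rewrite ord1.
  case: (split_ordP i) => [k ->|k ->].
    rewrite (_ : (fun y => _) = fun y => hr rf y k 0).
      have dh : derivable (hr rf) x (drift rb x).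
        exact/diff_derivable/differentiable_hr.
      by move/derivable_mxP : dh.
    by apply/funext => y; rewrite /output col_mxEu.
  rewrite (_ : (fun y => _) = @qN R n); last first.
    by apply/funext => y; rewrite /output col_mxEd !mxE ord1.
  exact/diff_derivable/differentiable_qN.
apply/matrixP => i j; rewrite ord1 /lie.
have [_ <-] := derivable_coord i 0 dO.
case: (split_ordP i) => [k ->|k ->].
  rewrite col_mxEu (_ : (fun y => _) = fun y => hr rf y k 0); last first.
    by apply/funext => y; rewrite /output col_mxEu.
  have dh : derivable (hr rf) x (drift rb x).
    exact/diff_derivable/differentiable_hr.
  by have [_ ->] := derivable_coord k 0 dh.
rewrite col_mxEd (_ : (fun y => _) = @qN R n); last first.
  by apply/funext => y; rewrite /output col_mxEd !mxE ord1.
have [_ ->] := is_derive_qN x (drift rb x).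
by have [_ _ ->] := qdotE x; rewrite !mxE ord1.
Qed.

Lemma differentiable_lie_output x :
  differentiable (lie (drift rb) (output rf)) x.
Proof.
apply: differentiable_mx => i j; rewrite ord1.
case: (split_ordP i) => [k ->|k ->].
  rewrite (_ : (fun y => _) = fun y => dhr rb rf y k 0); last first.
    by apply/funext => y; rewrite lie_output col_mxEu.
  apply: (@differentiable_comp _ _ _ _ (dhr rb rf) (fun M : 'cV[R]_n => M k 0)).
    exact: differentiable_dhr.
  exact: differentiable_coord.
rewrite (_ : (fun y => _) = @dqN R n); last first.
  by apply/funext => y; rewrite lie_output col_mxEd mxE ord1.
exact: differentiable_dqN.
Qed.

Section Feedback.
Variable p : gains R n.
Local Notation F := (closed_loop rb rf p).

(** Exact linearization. The derivative in the direction [control rb x u] is linear in [u] with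
    matrix [decoupling]; once this matrix is inverted, [ustar] cancels the second Lie derivative
    along the drift and puts [v] in its place. *)
Lemma lie_lie_output_closed_loop x : decoupling rb rf x \in unitmx ->
  'D_(F x) (lie (drift rb) (output rf)) x = col_mx (v_r rb rf p x) (v_N rb rf p x)%:M.
Proof.
move=> dU; pose psi := lie (drift rb) (output rf).
have dpsi : differentiable psi x := differentiable_lie_output x.
have lin a u v : 'D_(a *: u + v) psi x = a *: 'D_u psi x + 'D_v psi x.
  exact: derive_linear_dir.
have dec u : 'D_(control rb x u) psi x = decoupling rb rf x *m u.
  have lc : linear (fun u => 'D_(control rb x u) psi x).
    by move=> a u1 u2; rewrite control_linear lin.
  have E0 : 'D_(control rb x 0) psi x = 0.
    by have := lc (-1) 0 0; rewrite !scaleN1r oppr0 addr0 addNr.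
  have lcs (I : Type) (r : seq I) (P : pred I) (a : I -> R) (w : I -> 'cV[R]_(n + 1)) :
      'D_(control rb x (\sum_(i <- r | P i) a i *: w i)) psi x =
      \sum_(i <- r | P i) a i *: 'D_(control rb x (w i)) psi x.
    elim: r => [|i r IH]; first by rewrite !big_nil.
    by rewrite !big_cons; case: ifP => _; rewrite ?lc ?IH.
  rewrite {1}[u]matrix_sum_delta (eq_bigr (fun i => u i 0 *: delta_mx i 0)); last first.
    by move=> i _; rewrite big_ord1.
  rewrite lcs; apply/matrixP => i j; rewrite ord1 summxE mxE.
  by apply: eq_bigr => k _; rewrite !mxE mulrC.
rewrite /closed_loop -[drift rb x]scale1r lin scale1r dec.
rewrite /ustar /linearizing_input mulKVmx // -/psi /lie.
by rewrite addrC subrK.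
Qed.

Lemma derive_dhr_closed_loop x : decoupling rb rf x \in unitmx ->
  'D_(F x) (dhr rb rf) x = v_r rb rf p x.
Proof.
move=> /lie_lie_output_closed_loop E; apply/matrixP => i j; rewrite ord1.
have dd : derivable (dhr rb rf) x (F x) by exact/diff_derivable/differentiable_dhr.
have [_ <-] := derivable_coord i 0 dd.
have dd' : derivable (lie (drift rb) (output rf)) x (F x).
  exact/diff_derivable/differentiable_lie_output.
have [_] := derivable_coord (lshift 1 i) 0 dd'; rewrite E col_mxEu => <-.
rewrite (_ : (fun y => lie (drift rb) (output rf) y _ 0) = fun y => dhr rb rf y i 0) //.
by apply/funext => y; rewrite lie_output col_mxEu.
Qed.

Lemma derive_dqN_closed_loop x : decoupling rb rf x \in unitmx ->
  'D_(F x) (@dqN R n) x = v_N rb rf p x.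
Proof.
move=> /lie_lie_output_closed_loop E.
have dd' : derivable (lie (drift rb) (output rf)) x (F x).
  exact/diff_derivable/differentiable_lie_output.
have [_] := derivable_coord (rshift n 0) 0 dd'; rewrite E col_mxEd mxE mulr1n => <-.
rewrite (_ : (fun y => lie (drift rb) (output rf) y _ 0) = @dqN R n) //.
by apply/funext => y; rewrite lie_output col_mxEd mxE mulr1n.
Qed.

Lemma closed_loop1 x : (F x).1 = qdot rb x.
Proof. by rewrite /closed_loop /control /= addr0. Qed.

Lemma derive_hr_closed_loop x : 'D_(F x) (hr rf) x = dhr rb rf x.
Proof.
have [_ ->] := is_derive_hr x (F x); rewrite closed_loop1 dhrE.
by have [_ -> ->] := qdotE x.
Qed.

Lemma derive_qN_closed_loop x : 'D_(F x) (@qN R n) x = dqN x.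
Proof.
have [_ ->] := is_derive_qN x (F x); rewrite closed_loop1.
by have [_ _ ->] := qdotE x.
Qed.

Lemma derive_sigmaN_closed_loop x :
  'D_(F x) (@sigmaN R n) x = k2 rb rf (hr rf x) (qN x).
Proof.
have [_ ->] := is_derive_sigmaN x (F x).
have -> : (F x).2 = 1 *: (drift rb x).2 + (control rb x (ustar rb rf p x)).2.
  by rewrite scale1r.
rewrite first_linear.
by rewrite first_control addr0 first_drift /k2 /hr /shape subrK scale1r.
Qed.

Lemma differentiable_Sref_qN x : differentiable (Sref rf \o @qN R n) x.
Proof.
apply: differentiable_comp; first exact: differentiable_qN.
exact: (smooth_differentiable (smooth_Sref rfH)).
Qed.

Lemma differentiable_Vref_qN x : differentiable (Vref rf \o @qN R n) x.
Proof.
apply: differentiable_comp; first exact: differentiable_qN.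
exact: (smooth_differentiable (smooth_Vref rfH)).
Qed.

Lemma differentiable_dSref_qN x : differentiable ((Sref rf)^`()%classic \o @qN R n) x.
Proof.
apply: differentiable_comp; first exact: differentiable_qN.
exact: (smooth_differentiable (smooth_derive1 (smooth_Sref rfH))).
Qed.

Lemma differentiable_bvar x : differentiable (bvar rf) x.
Proof.
apply: differentiableB; first exact: differentiable_sigmaN.
exact: differentiable_Sref_qN.
Qed.

Lemma is_derive_bvar x v : is_derive x v (bvar rf)
  (first v.2 - (Sref rf)^`()%classic (qN x) * final v.1).
Proof.
have d1 := is_derive_sigmaN x v.
have d2 := is_derive_comp (smooth_differentiable (smooth_Sref rfH) (qN x))
  (differentiable_qN x) (is_derive_qN x v).
by apply: (is_derive_eq (is_deriveB d1 d2)); rewrite derive1E mulrC.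
Qed.

Lemma is_derive_shaping x v : is_derive x v (shaping rf p)
  (gamma p / beta0 p * ((Sref rf)^`()%classic (qN x) *
     (first v.2 - (Sref rf)^`()%classic (qN x) * final v.1) +
   bvar rf x * (final v.1 * 'D_1 ((Sref rf)^`()%classic) (qN x)))).
Proof.
have d1 := is_derive_bvar x v.
have d2 := is_derive_comp
  (smooth_differentiable (smooth_derive1 (smooth_Sref rfH)) (qN x))
  (differentiable_qN x) (is_derive_qN x v).
have d3 := is_deriveZ (gamma p / beta0 p) (is_deriveM d2 d1).
rewrite (_ : shaping rf p = (gamma p / beta0 p) *:
   ((((Sref rf)^`()%classic \o @qN R n) * bvar rf) : state R n -> R)) //.
by apply/funext => y; rewrite /shaping -mulrA.
Qed.

Lemma differentiable_shaping x : differentiable (shaping rf p) x.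
Proof.
apply: differentiableM; last exact: differentiable_bvar.
apply: differentiableM; first exact: differentiable_cst.
exact: differentiable_dSref_qN.
Qed.

Lemma differentiable_cvar x : differentiable (cvar rf p) x.
Proof.
apply: differentiableB; last exact: differentiable_shaping.
apply: differentiableB; first exact: differentiable_dqN.
exact: differentiable_Vref_qN.
Qed.

Lemma derive_shaping_closed_loop x :
  'D_(F x) (shaping rf p) x = lie (drift rb) (shaping rf p) x.
Proof.
rewrite /lie; have [_ ->] := is_derive_shaping x (F x).
have [_ ->] := is_derive_shaping x (drift rb x).
have -> : (F x).2 = 1 *: (drift rb x).2 + (control rb x (ustar rb rf p x)).2.
  by rewrite scale1r.
by rewrite first_linear first_control addr0 scale1r closed_loop1.
Qed.

Lemma derive_bvar_closed_loop x : 'D_(F x) (bvar rf) x =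
  k2 rb rf (hr rf x) (qN x) - (Sref rf)^`()%classic (qN x) * dqN x.
Proof.
have [_ ->] := is_derive_bvar x (F x).
have [_ E1] := is_derive_sigmaN x (F x).
have [_ E2] := is_derive_qN x (F x).
by rewrite -E1 -E2 derive_sigmaN_closed_loop derive_qN_closed_loop.
Qed.

(** The input [v_N] is designed for this: its last term cancels the derivative of [shaping], and
    gamma S' b is beta0 times [shaping], so that the rest combines to - beta0 c. *)
Lemma derive_cvar_closed_loop x : decoupling rb rf x \in unitmx ->
  beta0 p != 0 -> 'D_(F x) (cvar rf p) x = - beta0 p * cvar rf p x.
Proof.
move=> dU b0.
have d1 := is_derive_diff (F x) (differentiable_dqN x).
have d2 := is_derive_diff (F x) (differentiable_shaping x).
have d3 := is_derive_comp (smooth_differentiable (smooth_Vref rfH) (qN x))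
  (differentiable_qN x) (is_derive_diff (F x) (differentiable_qN x)).
have [_ ->] := is_deriveB (is_deriveB d1 d3) d2.
rewrite derive_dqN_closed_loop // derive_qN_closed_loop derive_shaping_closed_loop.
rewrite /v_N /cvar -derive1E /shaping /GRing.scale /=; by field.
Qed.

(** A solution is continuous on its closed time interval and satisfies the equation only in the
    interior; [has_derivative_on] has the same form for this reason. *)
Lemma flow_has_derivative_on a b (x : R -> state R n) (phi : state R n -> R) :
  flow_on rb F a b x -> (forall y, differentiable phi y) ->
  has_derivative_on a b (fun t => phi (x t)) (fun t => 'D_(F (x t)) phi (x t)).
Proof.
move=> [cx _ dx] dphi; split=> [t|t tab].
  apply: (@continuous_comp _ _ _ (x : subspace `[a, b] -> _) phi); first exact: cx.
  exact/differentiable_continuous.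
exact: (is_derive_along (dphi _) (dx t tab)).
Qed.

End Feedback.

End ClosedLoop.

(** * High-gain estimates along an arc *)

Section MatrixNorm.
Variable R : realType.

Lemma normr_entry_le m n (M : 'M[R]_(m, n)) i j : `|M i j| <= `|M|.
Proof.
rewrite [leRHS]/Num.Def.normr/= mx_normrE.
exact: (le_bigmax _ (fun ij => `|M ij.1 ij.2|) (i, j)).
Qed.

Lemma normr_mx_le m n (M : 'M[R]_(m, n)) r :
  0 <= r -> (forall i j, `|M i j| <= r) -> `|M| <= r.
Proof.
move=> r0 H; rewrite [leLHS]/Num.Def.normr/= mx_normrE.
by apply: bigmax_le => // -[i j] _; exact: H.
Qed.

Lemma normr_mulmx_le m n k (A : 'M[R]_(m, n)) (B : 'M[R]_(n, k)) :
  `|A *m B| <= n%:R * `|A| * `|B|.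
Proof.
apply: normr_mx_le => [|i j]; first by rewrite !mulr_ge0.
rewrite mxE (le_trans (ler_norm_sum _ _ _)) //.
apply: (@le_trans _ _ (\sum_(l < n) `|A| * `|B|)).
  by apply: ler_sum => l _; rewrite normrM ler_pM // normr_entry_le.
by rewrite sumr_const card_ord -mulrA mulr_natl.
Qed.

Lemma normr_trmx_le m n (A : 'M[R]_(m, n)) : `|A^T| <= `|A|.
Proof. by apply: normr_mx_le => // i j; rewrite mxE normr_entry_le. Qed.

End MatrixNorm.

Section HighGain.
Variables (R : realType) (n : nat).

(* Critically damped position loop with rate [k]; [e] is the ratio gamma/beta0. *)
Definition high_gain (e k : R) : gains R n :=
  Gains (k ^+ 2)%:M (2 * k)%:M k (e * k).

Lemma posdef_scalar (a : R) : 0 < a -> posdefmx (a%:M : 'M[R]_n).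
Proof.
move=> a0; split; first by rewrite tr_scalar_mx.
move=> v v0; rewrite -mulmxA mul_scalar_mx -scalemxAr mxE pmulr_rgt0 // mxE.
have [i vi] : exists i, v i 0 != 0.
  apply/existsP; apply: contraNT v0 => /existsPn H; apply/eqP/matrixP => i j.
  by rewrite ord1 mxE; apply/eqP; rewrite -[_ == _]negbK; exact: H.
rewrite (bigD1 i) //= mxE ltr_pwDl //; first by rewrite -expr2 exprn_even_gt0.
by apply: sumr_ge0 => l _; rewrite mxE -expr2 sqr_ge0.
Qed.

Lemma high_gain_admissible e k : 0 < e -> 0 < k -> admissible (high_gain e k).
Proof.
move=> e0 k0; split=> //=; last exact: mulr_gt0.
  by apply: posdef_scalar; rewrite exprn_gt0.
by apply: posdef_scalar; rewrite mulr_gt0.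
Qed.

End HighGain.

(** * Decay of h_r and c, and the forced equation for b *)

Section FlowBounds.
Variables (R : realType) (n : nat) (rb : robot R n) (rf : reference R n).
Hypothesis rbH : bipedal_robot_with_disc rb.
Hypothesis rfH : reference_functions rb rf.
Hypothesis dU : forall x, valid rb x -> decoupling rb rf x \in unitmx.

Definition tracking_error (x : state R n) : R := `|hr rf x| + `|dhr rb rf x|.

Lemma tracking_error_ge0 x : 0 <= tracking_error x.
Proof. exact: addr_ge0. Qed.

Variables (e k : R).
Hypotheses (e0 : 0 < e) (k1 : 1 <= k).
Local Notation p := (high_gain n e k).
Local Notation F := (closed_loop rb rf p).
Local Notation c := (cvar rf p).
Local Notation b := (bvar rf).
Local Notation E := tracking_error.
Local Notation dS := ((Sref rf)^`()%classic).

Let k0 : 0 < k. Proof. exact: lt_le_trans k1. Qed.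

Lemma flow_prefix s u t x : u <= t -> flow_on rb F s t x -> flow_on rb F s u x.
Proof.
move=> ut [c1 c2 c3]; split.
- by apply: continuous_subspaceW c1; apply: subset_itv; rewrite bnd_simp.
- move=> y; rewrite in_itv/= => /andP[y1 y2]; apply: c2.
  by rewrite in_itv/= y1 (le_trans y2).
- move=> y; rewrite in_itv/= => /andP[y1 y2]; apply: c3.
  by rewrite in_itv/= y1 (lt_le_trans y2).
Qed.

(** The gains enter only through gamma / beta0 = e; every velocity estimate near the impact is
    thereby independent of [k]. *)
Lemma dqN_shaping x : dqN x = Vref rf (qN x) + c x + e * dS (qN x) * b x.
Proof.
rewrite /cvar /shaping /= mulfK; last by rewrite gt_eqF.
by ring.
Qed.

Section Arc.
Variables (s t : R) (x : R -> state R n).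
Hypotheses (st : s <= t) (fx : flow_on rb F s t x).

Lemma flow_valid u : u \in `[s, t] -> valid rb (x u).
Proof. by case: fx => _ + _; apply. Qed.

Lemma flow_unit u : u \in `]s, t[ -> decoupling rb rf (x u) \in unitmx.
Proof. by move=> uI; apply/dU/flow_valid; apply: subset_itv_oo_cc. Qed.

Lemma flow_cvar : c (x t) = expR (- k * (t - s)) * c (x s).
Proof.
apply: (exp_decay st (flow_has_derivative_on fx (differentiable_cvar rfH _))).
move=> u uI; apply: (derive_cvar_closed_loop rbH rfH) (flow_unit uI) _.
by rewrite /= gt_eqF.
Qed.

Lemma flow_hr i : 
  let g := dhr rb rf (x s) i 0 + k * hr rf (x s) i 0 in
  hr rf (x t) i 0 = expR (- k * (t - s)) * (hr rf (x s) i 0 + (t - s) * g) /\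
  dhr rb rf (x t) i 0 =
    expR (- k * (t - s)) * (dhr rb rf (x s) i 0 - k * (t - s) * g).
Proof.
have dh y : differentiable (fun z => hr rf z i 0) y.
  apply: (@differentiable_comp _ _ _ _ (hr rf) (fun M : 'cV[R]_n => M i 0)).
    exact: (differentiable_hr rfH).
  exact: differentiable_coord.
have ddh y : differentiable (fun z => dhr rb rf z i 0) y.
  apply: (@differentiable_comp _ _ _ _ (dhr rb rf) (fun M : 'cV[R]_n => M i 0)).
    exact: (differentiable_dhr rbH rfH).
  exact: differentiable_coord.
apply: (@critically_damped R s t k (fun u => hr rf (x u) i 0)
  (fun u => dhr rb rf (x u) i 0)); first by rewrite subr_ge0.
  apply: (has_derivative_on_eq (flow_has_derivative_on fx dh)) => u uI.
  have d : derivable (hr rf) (x u) (F (x u)).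
    exact/diff_derivable/(differentiable_hr rfH).
  have [_ ->] := derivable_coord i 0 d.
  by rewrite (derive_hr_closed_loop rbH rfH).
apply: (has_derivative_on_eq (flow_has_derivative_on fx ddh)) => u uI.
have d : derivable (dhr rb rf) (x u) (F (x u)).
  exact/diff_derivable/(differentiable_dhr rbH rfH).
have [_ ->] := derivable_coord i 0 d.
rewrite (derive_dhr_closed_loop rbH rfH) ?flow_unit //.
by rewrite /v_r /= !mul_scalar_mx !mxE.
Qed.

(** Half of the exponential exp(- k (t - s)). The other half absorbs the factor k (t - s) of the
    critically damped solution. *)
Let decay := expR (- (k * (t - s) / 2)).

Let kt0 : 0 <= k * (t - s).
Proof. by rewrite mulr_ge0 ?(ltW k0) ?subr_ge0. Qed.

Let decay0 : 0 < decay. Proof. exact: expR_gt0. Qed.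

Let decay_le1 : decay <= 1.
Proof. by rewrite -expR0 ler_expR oppr_le0 divr_ge0. Qed.

Let decay2 : expR (- k * (t - s)) = decay * decay.
Proof. by rewrite /decay -expRD; congr expR; lra. Qed.

Let decay_kt : k * (t - s) * decay <= 1.
Proof. exact: mulr_expR_le. Qed.

(** The overshoot of order [k] appears in h_r' only; h_r itself is bounded without it, since t - s
    <= k (t - s) is absorbed by the exponential. This asymmetry matters because b is forced by h_r
    and not by h_r', so that the integrated forcing is O(1 / k). *)
Lemma flow_tracking_error :
  `|hr rf (x t)| <= 2 * decay * E (x s) /\
  E (x t) <= (4 + k) * decay * E (x s).
Proof.
have hle i : `|hr rf (x s) i 0| <= `|hr rf (x s)| := normr_entry_le _ _ _.
have dle i : `|dhr rb rf (x s) i 0| <= `|dhr rb rf (x s)| := normr_entry_le _ _ _.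
pose h0 := `|hr rf (x s)|; pose d0 := `|dhr rb rf (x s)|.
rewrite -[tracking_error (x s)]/(h0 + d0).
have h00 : 0 <= h0 := normr_ge0 _.
have d00 : 0 <= d0 := normr_ge0 _.
have gle i : `|dhr rb rf (x s) i 0 + k * hr rf (x s) i 0| <= d0 + k * h0.
  apply: le_trans (ler_normD _ _) _; apply: lerD; first exact: dle.
  by rewrite normrM (ger0_norm (ltW k0)) ler_wpM2l ?(ltW k0).
have tle : t - s <= k * (t - s) by rewrite ler_peMl // subr_ge0.
have H1 : `|hr rf (x t)| <= decay * (2 * h0 + d0).
  apply: normr_mx_le => [|i j]; first by rewrite mulr_ge0 ?(ltW decay0) // addr_ge0 ?mulr_ge0.
  rewrite ord1; have [-> _] := flow_hr i.
  rewrite decay2 -mulrA normrM (ger0_norm (ltW decay0)) ler_wpM2l ?(ltW decay0) //.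
  rewrite normrM (ger0_norm (ltW decay0)).
  have st0 : 0 <= t - s by rewrite subr_ge0.
  apply: (@le_trans _ _ (decay * (h0 + (t - s) * (d0 + k * h0)))).
    rewrite ler_wpM2l ?(ltW decay0) //; apply: le_trans (ler_normD _ _) _.
    by apply: lerD; rewrite // normrM (ger0_norm st0) ler_wpM2l.
  have -> : decay * (h0 + (t - s) * (d0 + k * h0)) =
     decay * h0 + decay * (t - s) * d0 + k * (t - s) * decay * h0 by ring.
  have l1 : decay * h0 <= h0 by rewrite ler_piMl.
  have l2 : k * (t - s) * decay * h0 <= h0 by rewrite ler_piMl.
  have l3 : decay * (t - s) * d0 <= d0.
    rewrite ler_piMl // mulrC; apply: le_trans decay_kt.
    by rewrite ler_wpM2r ?(ltW decay0).
  lra.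
have H2 : `|dhr rb rf (x t)| <= decay * (2 * d0 + k * h0).
  apply: normr_mx_le => [|i j].
    by rewrite mulr_ge0 ?(ltW decay0) // addr_ge0 ?mulr_ge0 ?(ltW k0).
  rewrite ord1; have [_ ->] := flow_hr i.
  rewrite decay2 -mulrA normrM (ger0_norm (ltW decay0)) ler_wpM2l ?(ltW decay0) //.
  rewrite normrM (ger0_norm (ltW decay0)).
  apply: (@le_trans _ _ (decay * (d0 + k * (t - s) * (d0 + k * h0)))).
    rewrite ler_wpM2l ?(ltW decay0) //; apply: le_trans (ler_normB _ _) _.
    by apply: lerD; rewrite // normrM (ger0_norm kt0) ler_wpM2l.
  have -> : decay * (d0 + k * (t - s) * (d0 + k * h0)) =
     decay * d0 + k * (t - s) * decay * (d0 + k * h0) by ring.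
  have l1 : decay * d0 <= d0 by rewrite ler_piMl.
  have l2 : k * (t - s) * decay * (d0 + k * h0) <= d0 + k * h0.
    by rewrite ler_piMl // addr_ge0 // mulr_ge0 ?(ltW k0).
  lra.
have kh : 0 <= k * d0 by rewrite mulr_ge0 ?(ltW k0).
split.
  apply: le_trans H1 _; rewrite mulrC -mulrA [decay * _]mulrC mulrA.
  by rewrite ler_wpM2r ?(ltW decay0) //; lra.
apply: le_trans (lerD H1 H2) _.
have -> : (4 + k) * decay * (h0 + d0) = decay * ((4 + k) * (h0 + d0)) by ring.
rewrite -mulrDr ler_wpM2l ?(ltW decay0) //.
have -> : (4 + k) * (h0 + d0) = 4 * h0 + 4 * d0 + k * h0 + k * d0 by ring.
lra.
Qed.

End Arc.

Lemma gravity_factor : exists2 B : R, 0 <= B & forall h q,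
  exists2 u : R, k2 rb rf h q = dS q * Vref rf q + u & `|u| <= B * `|h|.
Proof.
have [f2 [[B HB] Hf]] := k2_factor rfH.
have B0 : 0 <= B by apply: le_trans (HB (0, 0)).
exists (n%:R * B); first by rewrite mulr_ge0.
move=> h q; exists ((h^T *m f2 (h, q)) 0 0).
  by rewrite -Hf addrC subrK.
apply: le_trans (normr_entry_le _ _ _) (le_trans (normr_mulmx_le _ _) _).
rewrite -!mulrA ler_wpM2l // mulrC.
by rewrite ler_pM // ?HB // normr_trmx_le.
Qed.

(** Here b' = - e S'^2 b + <h_r, f2> - S' c. The damping integrates to at least e times the increase
    of A, for any function A of q_N whose time derivative lies between 0 and S'^2. It serves twice:
    with A = 0, when nothing is known about q_N', and with a multiple of the antiderivative of
    S'^2. *)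
Lemma flow_bvar (B S1 : R) (A dA : R -> R) s t x : s <= t -> flow_on rb F s t x ->
  0 <= B ->
  (forall h q, exists2 u : R,
     k2 rb rf h q = dS q * Vref rf q + u & `|u| <= B * `|h|) ->
  (forall u, u \in `[s, t] -> [/\ `|dS (qN (x u))| <= S1,
    0 <= dA (qN (x u)) * dqN (x u) <= dS (qN (x u)) ^+ 2 &
    is_derive (qN (x u)) (1 : R) A (dA (qN (x u)))]) ->
  `|b (x t)| <= expR (- (e * (A (qN (x t)) - A (qN (x s))))) * `|b (x s)| +
    (4 * B + 2 * S1) / k * (E (x s) + `|c (x s)|).
Proof.
move=> st fx B0 HB H.
have S10 : 0 <= S1.
  have /H[h _ _] : s \in `[s, t] by rewrite bound_itvE.
  by apply: le_trans h.
(* The forcing at time u is at most G exp(- k (u - s) / 2), and its integral is at most 2 G / k;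
   this is the origin of 4 B + 2 S1. *)
pose G := 2 * B * E (x s) + S1 * `|c (x s)|.
have G0 : 0 <= G by rewrite addr_ge0 ?mulr_ge0 ?tracking_error_ge0.
have HA : has_derivative_on s t (fun u => e * A (qN (x u)))
    (fun u => e * (dA (qN (x u)) * dqN (x u))).
  have Hq : has_derivative_on s t (fun u => qN (x u)) (fun u => dqN (x u)).
    apply: (has_derivative_on_eq (flow_has_derivative_on fx (@differentiable_qN _ _))).
    by move=> u uI; rewrite (derive_qN_closed_loop rf rbH).
  have HAq : has_derivative_on s t (fun u => A (qN (x u)))
      (fun u => dA (qN (x u)) * dqN (x u)).
    apply: (has_derivative_on_comp (dg := dA) _ Hq).
    by move=> u /H[].
  apply: (has_derivative_on_eq (has_derivative_onM (has_derivative_on_cst s t e) HAq)).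
  by move=> u _; rewrite mulr0 addr0.
have Hg : has_derivative_on s t (fun u => - (2 * G / k) * expR (- (k / 2) * (u - s)))
    (fun u => G * expR (- (k / 2) * (u - s))).
  apply: (has_derivative_on_eq (has_derivative_onM
     (has_derivative_on_cst s t (- (2 * G / k)))
     (has_derivative_on_expR s t (- (k / 2)) s))) => u _.
  by field; rewrite gt_eqF.
have Hb := flow_has_derivative_on fx (differentiable_bvar rfH).
have := gronwall_abs (L := e * S1 ^+ 2) st Hb HA Hg _ _.
rewrite -mulrBr subrr mulr0 expR0 => HG; apply: le_trans (HG _ _) _ => {HG}.
- move=> u; rewrite in_itv/= => /andP[su ut].
  rewrite ler_wnM2l ?oppr_le0 ?divr_ge0 ?mulr_ge0 ?(ltW k0) //.
  rewrite -expR0 ler_expR mulNr oppr_le0 mulr_ge0 ?subr_ge0 //.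
  by rewrite divr_ge0 ?(ltW k0).
- move=> u uI; have uI' : u \in `[s, t] by apply: subset_itv_oo_cc.
  have [hS /andP[v0 vV] _] := H u uI'.
  have [w Ew Bw] := HB (hr rf (x u)) (qN (x u)).
  have [su ut] : s <= u /\ u <= t by move: uI'; rewrite in_itv/= => /andP[].
  have fxu := flow_prefix ut fx.
  have [hE _] := flow_tracking_error su fxu.
  have cE := flow_cvar su fxu.
  exists (e * dS (qN (x u)) ^+ 2), (w - dS (qN (x u)) * c (x u)); split.
  + rewrite (derive_bvar_closed_loop rbH rfH) Ew dqN_shaping; ring.
  + by rewrite ler_pM2l.
  + by apply: mulr_ge0 => //; exact: ltW.
  + by rewrite ler_pM2l // -real_normK ?num_real // ler_sqr ?nnegrE.
  + apply: le_trans (ler_normB _ _) _; rewrite /G mulrDl; apply: lerD.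
      apply: le_trans Bw _.
      have -> : 2 * B * E (x s) * expR (- (k / 2) * (u - s)) =
        B * (2 * expR (- (k * (u - s) / 2)) * E (x s)).
        rewrite (_ : - (k / 2) * (u - s) = - (k * (u - s) / 2)); first by ring.
        by field.
      by rewrite ler_wpM2l.
    rewrite normrM cE normrM (ger0_norm (expR_ge0 _)) -mulrA ler_pM //.
    rewrite mulrC ler_wpM2l // ler_expR.
    have : 0 <= k * (u - s) by rewrite mulr_ge0 ?(ltW k0) ?subr_ge0.
    lra.
- apply: lerD => //.
  have -> : (4 * B + 2 * S1) / k * (E (x s) + `|c (x s)|) =
     2 * G / k + (4 * B * `|c (x s)| + 2 * S1 * E (x s)) / k.
    by rewrite /G; field; rewrite gt_eqF.
  have : 0 <= (4 * B * `|c (x s)| + 2 * S1 * E (x s)) / k.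
    by rewrite divr_ge0 ?(ltW k0) // addr_ge0 ?mulr_ge0 ?tracking_error_ge0.
  have : 0 <= 2 * G / k * expR (- (k / 2) * (t - s)).
    by rewrite mulr_ge0 ?expR_ge0 // divr_ge0 ?(ltW k0) // mulr_ge0.
  lra.
Qed.

End FlowBounds.

(** * Local analysis of the impact *)

Section LocalBounds.
Variable R : realType.
Implicit Types V W : normedModType R.

Lemma near_dist V (a : V) (P : V -> Prop) : (\forall z \near a, P z) <->
  exists2 d : R, 0 < d & forall z, `|z - a| < d -> P z.
Proof.
split=> [/nbhs_normP[d /= d0 H]|[d d0 H]].
  by exists d => // z za; apply: H => /=; rewrite distrC.
by apply/nbhs_normP; exists d => //= z /=; rewrite distrC; exact: H.
Qed.

Lemma differentiable_expansion V W (f : V -> W) a e : differentiable f a -> 0 < e ->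
  \forall z \near a, `|f z - f a - 'd f a (z - a)| <= e * `|z - a|.
Proof.
move=> df e0; have /eqaddoP /(_ e e0) := diff_locally df.
move=> /near_dist[d d0 H]; apply/near_dist; exists d => // z za.
have := H (z - a); rewrite subr0 => /(_ za).
rewrite /= /shift /= -[(_ - _) (z - a)]/(f (z - a + a) - (f a + 'd f a (z - a))).
by rewrite subrK opprD addrA.
Qed.

Lemma differentiable_lipschitz_at V W (f : V -> W) a : differentiable f a ->
  exists2 C : R, 0 <= C & \forall z \near a, `|f z - f a| <= C * `|z - a|.
Proof.
move=> df; have [K K0 HK] := linear_lipschitz (diff_continuous df).
exists (1 + K); first by rewrite addr_ge0 // ltW.
have := differentiable_expansion df (@ltr01 R); apply: filterS => z H.
rewrite -[f z - f a](subrK ('d f a (z - a))).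
rewrite (le_trans (ler_normD _ _)) // mulrDl; exact: lerD.
Qed.

(** A quantitative implicit function estimate from the derivative at one point. Let - m < 0 be the
    slope in q and K bound the derivative in h. A remainder below (m/2)(|h| + |q - q0|) uses up half
    of the slope and leaves (m/2) |q - q0| <= (K + m/2) |h|. With [0 <= f z] in place of a zero,
    only the upper bound on q survives. *)
Lemma transversal_zero V (f : V * R -> R) (q0 : R) : differentiable f (0, q0) ->
  f (0, q0) = 0 -> 'D_((0 : V), 1) f (0, q0) < 0 ->
  exists2 C : R, 0 <= C & \forall z \near ((0 : V), q0),
    (0 <= f z -> z.2 - q0 <= C * `|z.1|) /\
    (f z = 0 -> `|z.2 - q0| <= C * `|z.1|).
Proof.
move=> df f0; rewrite (deriveE _ df); set s := 'd f _ _ => s0.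
have [K K0 HK] := linear_lipschitz (diff_continuous df).
pose m := - s; have m0 : 0 < m by rewrite oppr_gt0.
exists ((2 * K + m) / m).
  by rewrite divr_ge0 ?addr_ge0 ?mulr_ge0 ?(ltW K0) ?(ltW m0).
have := differentiable_expansion df (divr_gt0 m0 (@ltr0Sn R 1)).
apply: filterS => -[h q] /=; rewrite f0 subr0.
have -> : (h, q) - (0, q0) = (h, 0) + (q - q0) *: ((0 : V), 1 : R).
  congr (_, _); rewrite /= ?scaler0 ?addr0 ?subr0 ?add0r //.
  by rewrite /GRing.scale /= mulr1.
rewrite linearD linearZ /= -/s.
have -> : (h, 0) + (q - q0) *: ((0 : V), 1 : R) = (h, q - q0).
  congr (_, _); rewrite /= ?scaler0 ?addr0 ?subr0 ?add0r //.
  by rewrite /GRing.scale /= mulr1.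
have nh : `|(h, q - q0)| <= `|h| + `|q - q0|.
  by rewrite prod_normE /= ge_max lerDl lerDr !normr_ge0.
have := HK (h, 0); have -> : `|(h, 0 : R)| = `|h|.
  by rewrite prod_normE /= normr0; apply/max_idPl.
move: ('d f (0, q0) (h, 0)) => L HL H.
have {}H : `|f (h, q) - (L + (q - q0) *: s)| <= m / 2 * (`|h| + `|q - q0|).
  by apply: le_trans H _; rewrite ler_wpM2l // divr_ge0 ?(ltW m0).
have E : (q - q0) *: s = - (m * (q - q0)) by rewrite /m /GRing.scale /=; ring.
rewrite {}E in H; move: H HL; rewrite !ler_norml => /andP[H1 H2] /andP[H3 H4].
split=> hf.
  rewrite mulrAC ler_pdivlMr //.
  have [q0q|qq0] := leP 0 (q - q0); last first.
    apply: (@le_trans _ _ 0); first by rewrite mulr_le0_ge0 ?(ltW qq0) ?(ltW m0).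
    by rewrite mulr_ge0 // addr_ge0 ?mulr_ge0 ?(ltW K0) ?(ltW m0).
  move: H1 H2; rewrite (ger0_norm q0q); nra.
rewrite hf in H1 H2; rewrite mulrAC -lter_norml ler_pdivlMr //.
have [q0q|qq0] := leP 0 (q - q0).
  by move: H1 H2; rewrite (ger0_norm q0q); nra.
by move: H1 H2; rewrite (ltr0_norm qq0); nra.
Qed.

(** Compactness turns radii that depend on q into a single one; the monotonicity in d allows the
    passage to a smaller radius. *)
Lemma segment_near (a b : R) (P : R -> R -> Prop) : a <= b ->
  (forall d d' q, d' <= d -> P d q -> P d' q) ->
  (forall q, q \in `[a, b] ->
     exists2 d : R, 0 < d & forall q', `|q' - q| < d -> P d q') ->
  exists2 d : R, 0 < d & forall q, q \in `[a, b] -> P d q.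
Proof.
move=> ab mono H.
have cov : \forall d \near (0 : R)^'+, `[a, b] `<=` P d.
  apply: (iffLR (compact_near_coveringP _) (@segment_compact R a b) R _ P) => q qab.
  have [d d0 Hd] := H q qab.
  exists ([set q' | `|q' - q| < d], [set d' | d' <= d]) => /=.
    split=> /=; last exact: nbhs_right_le.
    by apply/nbhs_normP; exists d => //= z /=; rewrite distrC.
  by move=> [q' d'] /= [q'q d'd]; apply: (mono d) => //; exact: Hd.
near ((0 : R)^'+) => d; exists d; first by near: d; exact: nbhs_right_gt.
by near: d; exact: cov.
Unshelve. all: by end_near. Qed.

End LocalBounds.

Section DifferentiableMaps.
Variable R : realType.
Implicit Types U V W : normedModType R.

Lemma differentiable_fst U V W (f : U -> V * W) x :
  differentiable f x -> differentiable (fun y => (f y).1) x.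
Proof.
move=> df; apply: (@differentiable_comp _ _ _ _ f fst) => //.
by apply: linear_differentiable => y; exact: cvg_fst.
Qed.

Lemma differentiable_snd U V W (f : U -> V * W) x :
  differentiable f x -> differentiable (fun y => (f y).2) x.
Proof.
move=> df; apply: (@differentiable_comp _ _ _ _ f snd) => //.
by apply: linear_differentiable => y; exact: cvg_snd.
Qed.

Lemma differentiable_coord_comp U m n (f : U -> 'M[R]_(m, n)) x i j :
  differentiable f x -> differentiable (fun y => f y i j) x.
Proof.
move=> df; apply: (@differentiable_comp _ _ _ _ f (fun M : 'M[R]_(m, n) => M i j)) => //.
exact: differentiable_coord.
Qed.

Lemma differentiable_bigsum U n (f : 'I_n -> U -> R) x :
  (forall i, differentiable (f i) x) -> differentiable (fun y => \sum_(i < n) f i y) x.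
Proof.
move=> df; rewrite (_ : (fun _ => _) = \sum_(i < n) f i); first exact: differentiable_sum.
by apply/funext => y; rewrite fct_sumE.
Qed.

Lemma differentiable_mulmx U m n k (A : U -> 'M[R]_(m, n)) (B : U -> 'M[R]_(n, k)) x :
  differentiable A x -> differentiable B x ->
  differentiable (fun y => A y *m B y) x.
Proof.
move=> dA dB; apply: differentiable_mx => i j.
rewrite (_ : (fun _ => _) = fun y => \sum_l A y i l * B y l j); last first.
  by apply/funext => y; rewrite mxE.
apply: differentiable_bigsum => l.
by apply: differentiableM; exact: differentiable_coord_comp.
Qed.

Lemma differentiable_scale U m n (a : U -> R) (B : U -> 'M[R]_(m, n)) x :
  differentiable a x -> differentiable B x ->
  differentiable (fun y => a y *: B y) x.
Proof.
move=> da dB; apply: differentiable_mx => i j.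
rewrite (_ : (fun _ => _) = fun y => a y * B y i j); last first.
  by apply/funext => y; rewrite mxE.
by apply: differentiableM => //; exact: differentiable_coord_comp.
Qed.

(** Smoothness speaks of directional derivatives in a fixed direction. Here the direction moves with
    the point, so the derivative is expanded over the basis of R^n * R, with differentiable
    coefficients. *)
Lemma differentiable_derive_pair n (f : 'cV[R]_n * R -> R) U
    (z v : U -> 'cV[R]_n * R) x : smooth f ->
  differentiable z x -> differentiable v x ->
  differentiable (fun y => 'D_(v y) f (z y)) x.
Proof.
move=> sf dz dv.
rewrite (_ : (fun _ => _) = fun y =>
    \sum_(i < n) (v y).1 i 0 * 'D_((delta_mx i 0 : 'cV[R]_n), (0 : R)) f (z y) +
    (v y).2 * 'D_((0 : 'cV[R]_n), 1) f (z y)); last first.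
  apply/funext => y; have df := smooth_differentiable sf (z y).
  have E : v y = (\sum_(i < n) (v y).1 i 0 *: ((delta_mx i 0 : 'cV[R]_n), 0 : R))
      + (v y).2 *: ((0 : 'cV[R]_n), 1 : R).
    case: (v y) => v1 v2 /=.
    have -> : \sum_(i < n) v1 i 0 *: ((delta_mx i 0 : 'cV[R]_n), 0 : R) = (v1, 0).
      rewrite [X in (X, _)]matrix_sum_delta.
      rewrite (eq_bigr (fun i => (v1 i 0 *: delta_mx i 0 : 'cV[R]_n, 0 : R))); last first.
        by move=> i _; congr (_, _); rewrite /= scaler0.
      rewrite (_ : \sum_(i < n) \sum_(j < 1) _ = \sum_(i < n) v1 i 0 *: delta_mx i 0).
        by elim/big_rec2: _ => // i y1 y2 _ ->; congr (_, _); rewrite /= addr0.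
      by apply: eq_bigr => i _; rewrite big_ord1.
    by congr (_, _); rewrite /= ?scaler0 ?addr0 ?add0r // /GRing.scale /= mulr1.
  rewrite (deriveE _ df) [in LHS]E linearD linearZ linear_sum /= (deriveE _ df).
  congr (_ + _); apply: eq_bigr => i _; by rewrite linearZ /= deriveE.
have dD (w : 'cV[R]_n * R) : differentiable (fun y => 'D_w f (z y)) x.
  apply: (@differentiable_comp _ _ _ _ z (fun u => 'D_w f u)) => //.
  exact: (smooth_differentiable (smooth_derive sf w)).
apply: differentiableD.
  apply: differentiable_bigsum => i; apply: differentiableM => //.
  exact/differentiable_coord_comp/differentiable_fst.
by apply: differentiableM => //; exact: differentiable_snd.
Qed.

End DifferentiableMaps.

Section BlockVectors.
Variables (R : realType) (n : nat).
Implicit Types (w : 'cV[R]_(links n)) (z : 'cV[R]_n * R).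

(** The unit vector of the first coordinate. Among positions it is the direction of q_d, in omega
    that of sigma_N. Every vector is a multiple of [disc] plus the [embed] of its shape. *)
Definition disc : 'cV[R]_(links n) := col_mx (col_mx 1%:M 0) 0.
Definition embed z : 'cV[R]_(links n) := col_mx (col_mx 0 z.1) z.2%:M.

Lemma first_disc : first disc = 1.
Proof. by rewrite /first /disc !col_mxKu mxE. Qed.
Lemma middle_disc : middle disc = 0.
Proof. by rewrite /middle /disc col_mxKu col_mxKd. Qed.
Lemma final_disc : final disc = 0.
Proof. by rewrite /final /disc col_mxKd mxE. Qed.

Lemma embed_linear : linear embed.
Proof.
move=> a u v; rewrite /embed !scale_col_mx !add_col_mx ?scaler0 ?addr0 /=.
by congr (col_mx _ _); rewrite scale_scalar_mx -raddfD.
Qed.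

Lemma disc_embedE w : w = first w *: disc + embed (Defs.shape w).
Proof.
rewrite [LHS]coordsE /disc /embed !scale_col_mx !add_col_mx !scaler0 !addr0 !add0r.
by rewrite scale_scalar_mx mulr1.
Qed.

Lemma firstD v w : first (v + w) = first v + first w.
Proof. by rewrite -{1}[v]scale1r first_linear scale1r. Qed.
Lemma middleD v w : middle (v + w) = middle v + middle w.
Proof. by rewrite -{1}[v]scale1r middle_linear scale1r. Qed.
Lemma finalD v w : final (v + w) = final v + final w.
Proof. by rewrite -{1}[v]scale1r final_linear scale1r. Qed.
Lemma middleZ a w : middle (a *: w) = a *: middle w.
Proof. by rewrite /middle !linearZ. Qed.
Lemma firstZ a w : first (a *: w) = a * first w.
Proof. by rewrite /first !linearZ /= mxE. Qed.
Lemma finalZ a w : final (a *: w) = a * final w.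
Proof. by rewrite /final !linearZ /= mxE. Qed.

Lemma normr_first_le w : `|first w| <= `|w|.
Proof. by rewrite firstE normr_entry_le. Qed.
Lemma normr_final_le w : `|final w| <= `|w|.
Proof. by rewrite finalE normr_entry_le. Qed.
Lemma normr_middle_le w : `|middle w| <= `|w|.
Proof. by apply: normr_mx_le => // i j; rewrite ord1 middleE normr_entry_le. Qed.

Lemma normr_embed z : `|embed z| <= `|z|.
Proof.
apply: normr_mx_le => // i j; rewrite ord1 prod_normE le_max.
case: (split_ordP i) => k ->; last by rewrite col_mxEd mxE ord1 eqxx mulr1n lexx orbT.
rewrite col_mxEu; case: (split_ordP k) => l ->.
  by rewrite col_mxEu mxE normr0 normr_ge0.
by rewrite col_mxEd normr_entry_le.
Qed.

Lemma differentiable_embed (U : normedModType R) (f : U -> 'cV[R]_n * R) x :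
  differentiable f x -> differentiable (fun y => embed (f y)) x.
Proof.
move=> df; apply: differentiable_mx => i j; rewrite ord1.
case: (split_ordP i) => k ->.
  case: (split_ordP k) => l ->.
    rewrite (_ : (fun _ => _) = cst 0); first exact: differentiable_cst.
    by apply/funext => y; rewrite /embed !col_mxEu mxE.
  rewrite (_ : (fun _ => _) = fun y => (f y).1 l 0).
    exact/differentiable_coord_comp/differentiable_fst.
  by apply/funext => y; rewrite /embed col_mxEu col_mxEd.
rewrite (_ : (fun _ => _) = fun y => (f y).2); first exact: differentiable_snd.
by apply/funext => y; rewrite /embed col_mxEd mxE ord1 mulr1n.
Qed.

Lemma differentiable_final (U : normedModType R) (f : U -> 'cV[R]_(links n)) x :
  differentiable f x -> differentiable (fun y => final (f y)) x.
Proof.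
move=> df; rewrite (_ : (fun _ => _) = fun y => f y (rshift _ 0) 0).
  exact: differentiable_coord_comp.
by apply/funext => y; rewrite finalE.
Qed.

Lemma differentiable_first (U : normedModType R) (f : U -> 'cV[R]_(links n)) x :
  differentiable f x -> differentiable (fun y => first (f y)) x.
Proof.
move=> df; rewrite (_ : (fun _ => _) = fun y => f y (lshift _ (lshift _ 0)) 0).
  exact: differentiable_coord_comp.
by apply/funext => y; rewrite firstE.
Qed.

Lemma differentiable_middle (U : normedModType R) (f : U -> 'cV[R]_(links n)) x :
  differentiable f x -> differentiable (fun y => middle (f y)) x.
Proof.
move=> df; apply: differentiable_mx => i j; rewrite ord1.
rewrite (_ : (fun _ => _) = fun y => f y (lshift _ (rshift _ i)) 0).
  exact: differentiable_coord_comp.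
by apply/funext => y; rewrite middleE.
Qed.

End BlockVectors.

(** * The swing foot near the nominal step *)

Section Nominal.
Variables (R : realType) (n : nat) (rb : robot R n) (rf : reference R n).
Variables (p0 : gains R n) (qplus qminus : R).
Hypothesis rbH : bipedal_robot_with_disc rb.
Hypothesis rfH : reference_functions rb rf.
Hypothesis Zinv : impact_invariant rb (manifoldZ rb rf p0).
Hypothesis stepH : nominal_step rb rf p0 qplus qminus.
Implicit Types x : state R n.
Local Notation V := (Vref rf).
Local Notation S := (Sref rf).
Local Notation sh := (swing_height rb).

(** On Z the term [shaping] vanishes with b, so c = 0 means q_N' = V. The right-hand side is free of
    gains: the hypotheses on Z, stated for [p0], carry over to the gains that will be
    constructed. *)
Lemma manifoldZE p x : manifoldZ rb rf p x <->
  [/\ valid rb x, qr x = href rf (qN x), middle x.2 = V (qN x) *: dhref rf (qN x),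
      dqN x = V (qN x) & sigmaN x = S (qN x)].
Proof.
split=> [[vx h0 d0 b0 c0]|[vx h0 d0 v0 s0]].
  have sE : sigmaN x = S (qN x) by apply/eqP; rewrite -subr_eq0; apply/eqP.
  have vE : dqN x = V (qN x).
    by move: c0; rewrite /cvar /shaping b0 mulr0 subr0 => /eqP; rewrite subr_eq0 => /eqP.
  split=> //; first by apply/eqP; rewrite -subr_eq0; apply/eqP.
  move: d0; rewrite (dhrE rbH rfH) vE => /eqP; rewrite subr_eq0 => /eqP //.
have b0 : bvar rf x = 0 by rewrite /bvar s0 subrr.
split=> //; first by rewrite /hr h0 subrr.
  by rewrite (dhrE rbH rfH) d0 v0 subrr.
by rewrite /cvar /shaping b0 mulr0 v0 !subrr.
Qed.

Let rotate a x : state R n := (x.1 + a *: disc R n, x.2).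

Lemma shape_rotate a x : Defs.shape (rotate a x).1 = Defs.shape x.1.
Proof.
rewrite /Defs.shape /rotate /= middleD finalD middleZ finalZ middle_disc final_disc.
by rewrite scaler0 mulr0 !addr0.
Qed.

Lemma manifoldZ_rotate p a x : manifoldZ rb rf p x -> manifoldZ rb rf p (rotate a x).
Proof.
move=> /manifoldZE[vx h0 d0 v0 s0]; apply/manifoldZE.
have [qE QE] : qr (rotate a x) = qr x /\ qN (rotate a x) = qN x.
  by case: (shape_rotate a x).
rewrite qE QE; split; [exact: valid_cyclic|exact: h0|exact: d0|exact: v0|exact: s0].
Qed.

Lemma impact_surface_rotate a x : impact_surface rb x -> impact_surface rb (rotate a x).
Proof.
by move=> [vx h d]; split; rewrite /p2 /dp2 ?shape_rotate //; exact: valid_cyclic.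
Qed.

Lemma nominal_impact_point : exists x, [/\ manifoldZ rb rf p0 x, impact_surface rb x,
  qN x = qminus, manifoldZ rb rf p0 (impact rb x) & qN (impact rb x) = qplus].
Proof.
have [[x [Zx Sx]] imp] := Zinv; have [q1 q2] := nominal_impact stepH Zx Sx.
by exists x; split=> //; apply: imp; exists x.
Qed.

(* The disc angle is unconstrained on Z, so the post-impact shape cannot depend
   on it. *)
Lemma impact_q_disc :
  middle (impact_q rb *m disc R n) = 0 /\ final (impact_q rb *m disc R n) = 0.
Proof.
have [x [Zx Sx qx Zy qy]] := nominal_impact_point.
have Zx' := manifoldZ_rotate 1 Zx; have Sx' := impact_surface_rotate 1 Sx.
have [_ qy'] := nominal_impact stepH Zx' Sx'.
have Zy' : manifoldZ rb rf p0 (impact rb (rotate 1 x)).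
  by apply: (proj2 Zinv); exists (rotate 1 x).
have E : (impact rb (rotate 1 x)).1 = (impact rb x).1 + impact_q rb *m disc R n.
  by rewrite /impact /= scale1r mulmxDr.
have fE : final (impact_q rb *m disc R n) = 0.
  by apply: (addrI (qN (impact rb x))); rewrite addr0 -finalD -E -/(qN _) qy qy'.
split=> //; apply: (addrI (qr (impact rb x))); rewrite addr0 -middleD -E.
rewrite -[LHS]/(qr _); have /manifoldZE[_ -> _ _ _] := Zy'.
by have /manifoldZE[_ -> _ _ _] := Zy; rewrite qy qy'.
Qed.

Lemma dp2E x : dp2 rb x = 'D_(middle x.2, dqN x) sh (qr x, qN x).
Proof. by []. Qed.

Lemma qplus_lt : qplus < qminus. Proof. exact: nominal_lt stepH. Qed.

(** The change of variables from (h_r, q_N) to (q_r, q_N); it straightens the reference curve into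
    the segment h_r = 0. *)
Definition sweep (z : 'cV[R]_n * R) : 'cV[R]_n * R := (z.1 + href rf z.2, z.2).

Lemma differentiable_sweep (U : normedModType R) (f : U -> 'cV[R]_n * R) u :
  differentiable f u -> differentiable (fun y => sweep (f y)) u.
Proof.
move=> df; apply: differentiable_pair; last exact: differentiable_snd.
apply: differentiableD; first exact: differentiable_fst.
apply: (@differentiable_comp _ _ _ _ (fun y => (f y).2) (href rf)).
  exact: differentiable_snd.
exact: (differentiable_href rfH).
Qed.

Local Notation transverse_space := ('cV[R]_n * 'cV[R]_n * R * R)%type.

(** Height of the swing foot and its rate in the coordinates (h_r, h_r', q_N' - V, q_N), where Z
    lies on the axis (0, 0, 0, q). Using q_N' - V instead of c keeps the gains out. *)
Let gap (u : transverse_space) : R := sh (sweep (u.1.1.1, u.2)).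
Let vel (u : transverse_space) : 'cV[R]_n * R :=
  (u.1.1.2 + (V u.2 + u.1.2) *: dhref rf u.2, V u.2 + u.1.2).
Let gap_rate (u : transverse_space) : R := 'D_(vel u) sh (sweep (u.1.1.1, u.2)).

Let coords x : transverse_space := (hr rf x, dhr rb rf x, dqN x - V (qN x), qN x).

Lemma sweep_hr x : sweep (hr rf x, qN x) = (qr x, qN x).
Proof. by rewrite /sweep /= /hr subrK. Qed.

Lemma gapE x : p2 rb x = gap (coords x).
Proof. by rewrite /gap /coords /= sweep_hr. Qed.

Lemma gap_rateE x : dp2 rb x = gap_rate (coords x).
Proof.
rewrite /gap_rate /vel /coords /= sweep_hr dp2E.
by rewrite [V _ + _]addrC subrK (dhrE rbH rfH) subrK.
Qed.

Let dproj (u : transverse_space) :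
  [/\ differentiable (fun u : transverse_space => u.1.1.1) u,
      differentiable (fun u : transverse_space => u.1.1.2) u,
      differentiable (fun u : transverse_space => u.1.2) u &
      differentiable (fun u : transverse_space => u.2) u].
Proof.
have d1 : differentiable (fun u : transverse_space => u.1) u.
  exact/differentiable_fst.
split.
- exact/differentiable_fst/differentiable_fst.
- exact/differentiable_snd/differentiable_fst.
- exact: differentiable_snd.
- exact: differentiable_snd.
Qed.

Let dbase (u : transverse_space) :
  differentiable (fun u : transverse_space => sweep (u.1.1.1, u.2)) u.
Proof.
have [d1 d2 d3 d4] := dproj u.
apply: (@differentiable_sweep _ (fun u : transverse_space => (u.1.1.1, u.2))).
exact: differentiable_pair.
Qed.

Lemma differentiable_gap u : differentiable gap u.
Proof.
apply: (@differentiable_comp _ _ _ _ _ sh); first exact: dbase.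
exact: (smooth_differentiable (smooth_swing_height rbH)).
Qed.

Lemma differentiable_gap_rate u : differentiable gap_rate u.
Proof.
have [d1 d2 d3 d4] := dproj u.
have dV : differentiable (fun u : transverse_space => V u.2 + u.1.2) u.
  apply: differentiableD => //.
  apply: (@differentiable_comp _ _ _ _ (fun u : transverse_space => u.2) V) => //.
  exact: (smooth_differentiable (smooth_Vref rfH)).
apply: differentiable_derive_pair.
- exact: smooth_swing_height rbH.
- exact: dbase.
- apply: differentiable_pair; last exact: dV.
  apply: differentiableD; first exact: d2.
  apply: differentiable_scale; first exact: dV.
  apply: (@differentiable_comp _ _ _ _ (fun u : transverse_space => u.2) (dhref rf)) => //.
  exact: (differentiable_dhref rfH).
Qed.

Lemma coordsZ x : manifoldZ rb rf p0 x -> coords x = (0, 0, 0, qN x).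
Proof.
move=> Zx; have /manifoldZE[_ _ _ v0 _] := Zx; case: Zx => _ h0 d0 _ _.
by rewrite /coords h0 d0 v0 subrr.
Qed.

(** At height 0 the rate is nonzero by transversality, and a negative rate would be an impact on Z,
    which happens only at [qminus]. The endpoint [qplus] is included: there the foot may be leaving
    the ground. *)
Lemma nominal_gap q : q \in `[qplus, qminus[ ->
  0 < gap (0, 0, 0, q) \/ 0 < gap_rate (0, 0, 0, q).
Proof.
rewrite in_itv/= => /andP[q1 q2].
have : q \in `[qplus, qminus] by rewrite in_itv/= q1 ltW.
move=> /(nominal_range stepH)[x Zx qx].
have vx : valid rb x by case: Zx.
have := valid_above_ground rbH vx; rewrite le_eqVlt gapE (coordsZ Zx) qx.
case/predU1P => [g0|]; [right|by left].
have p20 : p2 rb x = 0 by rewrite gapE (coordsZ Zx) qx.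
have := nominal_transversal stepH Zx p20; rewrite neq_lt.
rewrite gap_rateE (coordsZ Zx) qx => /orP[neg|//].
have Sx : impact_surface rb x by split=> //; rewrite gap_rateE (coordsZ Zx) qx.
by have [E _] := nominal_impact stepH Zx Sx; move: q2; rewrite -qx E ltxx.
Qed.

(** On Z the shape moves along the reference curve with speed V. As V > 0, a negative rate at the
    nominal impact is a negative slope in q_N, as [transversal_zero] requires. *)
Lemma gap_rate_nominal q :
  gap_rate (0, 0, 0, q) = V q * 'D_((0 : 'cV[R]_n), 1) (sh \o sweep) (0, q).
Proof.
have dsh : differentiable sh (sweep (0, q)).
  exact: (smooth_differentiable (smooth_swing_height rbH)).
have dsw : differentiable sweep (0, q).
  by apply: (@differentiable_sweep _ id); exact: ex_diff.
have dsnd : differentiable (snd : 'cV[R]_n * R -> R) (0, q).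
  by apply: (@differentiable_snd _ _ _ _ id); exact: ex_diff.
have dhr' : differentiable (href rf \o (snd : 'cV[R]_n * R -> R)) (0, q).
  by apply: differentiable_comp => //; exact: (differentiable_href rfH).
have dfst : differentiable (fst : 'cV[R]_n * R -> 'cV[R]_n) (0, q).
  by apply: (@differentiable_fst _ _ _ _ id); exact: ex_diff.
have dsum := differentiableD dfst dhr'.
have i1 : is_derive ((0 : 'cV[R]_n), q) (0, 1 : R) fst (0 : 'cV[R]_n).
  by apply: is_derive_linear.
have i2 : is_derive ((0 : 'cV[R]_n), q) (0, 1 : R) snd (1 : R).
  by apply: is_derive_linear.
have i3 : is_derive ((0 : 'cV[R]_n), q) (0, 1 : R)
    (href rf \o (snd : 'cV[R]_n * R -> R)) (1 *: dhref rf q).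
  exact: (@is_derive_comp _ _ _ (href rf) (snd : 'cV[R]_n * R -> R)
    (0, q) (0, 1) 1 (differentiable_href rfH q) dsnd i2).
have E : 'd sweep (0, q) (0, 1) = (dhref rf q, 1).
  transitivity ('D_((0 : 'cV[R]_n), 1 : R) (fst + (href rf \o snd)) (0, q),
     'D_((0 : 'cV[R]_n), 1 : R) (snd : 'cV[R]_n * R -> R) (0, q)).
    by rewrite (deriveE _ dsum) (deriveE _ dsnd) (diff_pair dsum dsnd).
  have [_ ->] := is_deriveD i1 i3; have [_ ->] := i2.
  by rewrite add0r scale1r.
rewrite (deriveE _ (differentiable_comp dsw dsh)) (diff_comp dsw dsh) /= E.
rewrite /gap_rate /vel /= addr0 add0r -(deriveE _ dsh).
have -> : (V q *: dhref rf q, V q) = V q *: (dhref rf q, 1 : R).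
  by congr (_, _); rewrite /GRing.scale /= mulr1.
by rewrite (deriveE _ dsh) (deriveE _ dsh) linearZ.
Qed.

(** The first half is the barrier: a foot above the ground prevents q_N from passing [qminus] by
    more than O(|h_r|). The second half locates impacts; the sign of the rate excludes states in
    which the foot is on the ground but rising, as at lift-off. *)
Let near_nominal (C : R) (u : transverse_space) :=
  (0 <= gap u -> u.2 - qminus <= C * `|u.1.1.1|) /\
  (gap u = 0 -> gap_rate u < 0 -> `|u.2 - qminus| <= C * `|u.1.1.1|).

Lemma near_nominal_qminus : exists2 C, 0 <= C &
  \forall u \near ((0, 0, 0, qminus) : transverse_space), near_nominal C u.
Proof.
have [x [Zx [_ px dx] qx _ _]] := nominal_impact_point.
have dsw : differentiable (sh \o sweep) (0, qminus).
  apply: differentiable_comp; first by apply: (@differentiable_sweep _ id); exact: ex_diff.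
  exact: (smooth_differentiable (smooth_swing_height rbH)).
have f0 : (sh \o sweep) (0, qminus) = 0.
  by move: px; rewrite gapE (coordsZ Zx) qx.
have f1 : 'D_((0 : 'cV[R]_n), 1) (sh \o sweep) (0, qminus) < 0.
  move: dx; rewrite gap_rateE (coordsZ Zx) qx gap_rate_nominal.
  by rewrite pmulr_rlt0 //; exact: (Vref_gt0 rfH).
have [C C0 /near_dist[d d0 H]] := transversal_zero dsw f0 f1.
exists C => //; apply/near_dist; exists d => // u ud.
have := H (u.1.1.1, u.2); case=> [|H1 H2].
  move: ud; rewrite !prod_normE /= !gt_max => /andP[/andP[/andP[H1 _] _] H2].
  by rewrite H1.
by split=> [/H1 //|/H2 //].
Qed.

(** Below [qminus] the barrier holds by sign, and by [nominal_gap] a falling foot at height 0 does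
    not occur nearby. *)
Lemma near_nominal_interior C q : 0 <= C -> q \in `[qplus, qminus[ ->
  \forall u \near ((0, 0, 0, q) : transverse_space), near_nominal C u.
Proof.
move=> C0 qI; have c1 := differentiable_continuous (differentiable_gap (0, 0, 0, q)).
have c2 := differentiable_continuous (differentiable_gap_rate (0, 0, 0, q)).
have c3 : {for ((0, 0, 0, q) : transverse_space), continuous (fun u => u.2)}.
  exact: cvg_snd.
have qm : q < qminus by move: qI; rewrite in_itv/= => /andP[].
have n3 : \forall u \near ((0, 0, 0, q) : transverse_space), u.2 < qminus.
  exact: (cvgr_lt _ c3).
have neg (u : transverse_space) : u.2 < qminus -> u.2 - qminus <= C * `|u.1.1.1|.
  move=> uq; apply: (@le_trans _ _ 0); first by rewrite subr_le0 ltW.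
  by rewrite mulr_ge0.
case: (nominal_gap qI) => g0.
  have n1 : \forall u \near ((0, 0, 0, q) : transverse_space), 0 < gap u.
    exact: (cvgr_gt _ c1).
  near=> u; have gu : 0 < gap u by near: u.
  have uq : u.2 < qminus by near: u.
  split=> [_|gu0]; first exact: neg.
  by move: gu; rewrite gu0 ltxx.
have n2 : \forall u \near ((0, 0, 0, q) : transverse_space), 0 < gap_rate u.
  exact: (cvgr_gt _ c2).
near=> u; have ru : 0 < gap_rate u by near: u.
have uq : u.2 < qminus by near: u.
split=> [_|_ ru0]; first exact: neg.
by move: ru; rewrite ltNge (ltW ru0).
Unshelve. all: by end_near. Qed.

Lemma impact_location : exists C d : R, [/\ 0 <= C, 0 < d & forall x,
  `|hr rf x| < d -> `|dhr rb rf x| < d -> `|dqN x - V (qN x)| < d ->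
  qplus - d < qN x < qminus + d ->
  (0 <= p2 rb x -> qN x - qminus <= C * `|hr rf x|) /\
  (p2 rb x = 0 -> dp2 rb x < 0 -> `|qN x - qminus| <= C * `|hr rf x|)].
Proof.
have [C C0 HC] := near_nominal_qminus.
have [||d d0 Hd] := @segment_near R qplus qminus
  (fun d q => forall u, `|u - (0, 0, 0, q)| < d -> near_nominal C u) (ltW qplus_lt).
- by move=> d d' q d'd H u ud; apply: H; exact: lt_le_trans ud d'd.
- move=> q; rewrite in_itv/= => /andP[q1 q2].
  have /near_dist[d d0 H] : \forall u \near ((0, 0, 0, q) : transverse_space), near_nominal C u.
    move: q2; rewrite le_eqVlt => /predU1P[->//|q2].
    by apply: near_nominal_interior => //; rewrite in_itv/= q1.
  exists (d / 2); first by rewrite divr_gt0.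
  move=> q' q'q u ud; apply: H; move: ud; rewrite !prod_normE /= !gt_max !subr0.
  move=> /andP[/andP[/andP[h1 h2] h3] h4]; have dd : d / 2 < d by lra.
  rewrite (lt_trans h1 dd) (lt_trans h2 dd) (lt_trans h3 dd) /=.
  by rewrite -(subrKA q') (le_lt_trans (ler_normD _ _)) // [d]splitr ltrD.
- exists C, d; split=> // x h g w /andP[q1 q2]; rewrite gapE gap_rateE.
  (* The projection of q_N onto the nominal segment, at distance less than d. *)
  pose q := Num.max qplus (Num.min qminus (qN x)).
  have qI : q \in `[qplus, qminus].
    rewrite in_itv/= /q le_max lexx ge_max ge_min lexx.
    by rewrite (ltW qplus_lt).
  have qd : `|qN x - q| < d.
    rewrite /q maxEge minEge; case: ifP; case: ifP => *; rewrite ltr_norml; lra.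
  apply: (Hd q qI (coords x)).
  by rewrite !prod_normE /= !gt_max !subr0 h g w qd.
Qed.

End Nominal.

Section UniformLipschitz.
Variables (R : realType) (V : normedModType R) (a : V).

(** Truth for all large constants and all small radii, so that finitely many such properties can
    share one constant and one radius. *)
Definition eventually_bounded (P : R -> R -> Prop) : Prop :=
  exists C0 d0 : R, [/\ 0 <= C0, 0 < d0 &
    forall C d, C0 <= C -> d <= d0 -> P C d].

Definition lipschitz_within (W : normedModType R) (f : V -> W) (C d : R) : Prop :=
  forall z, `|z - a| < d -> `|f z - f a| <= C * `|z - a| /\ `|f z| <= C.

Lemma eventually_boundedI (P Q : R -> R -> Prop) :
  eventually_bounded P -> eventually_bounded Q ->
  eventually_bounded (fun C d => P C d /\ Q C d).
Proof.
move=> [C1 [d1 [c1 e1 H1]]] [C2 [d2 [c2 e2 H2]]].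
exists (Num.max C1 C2), (Num.min d1 d2); split.
- by rewrite le_max c1.
- by rewrite lt_min e1 e2.
- move=> C d; rewrite ge_max le_min => /andP[h1 h2] /andP[h3 h4].
  by split; [exact: H1|exact: H2].
Qed.

Lemma differentiable_lipschitz_within (W : normedModType R) (f : V -> W) :
  differentiable f a -> eventually_bounded (lipschitz_within f).
Proof.
move=> /differentiable_lipschitz_at[C C0 /near_dist[d d0 H]].
exists (C + `|f a|), (Num.min d 1); split.
- by rewrite addr_ge0.
- by rewrite lt_min d0 ltr01.
- move=> C' d' hC hd z za; have := lt_le_trans za hd.
  rewrite lt_min => /andP[za1 za2]; have hz := H z za1.
  have fa0 := normr_ge0 (f a); have z0 := normr_ge0 (z - a); split.
    apply: le_trans hz _; apply: ler_wpM2r => //; lra.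
  rewrite -[f z](subrK (f a)); apply: le_trans (ler_normD _ _) _.
  have : C * `|z - a| <= C * 1 by rewrite ler_wpM2l // ltW.
  lra.
Qed.

End UniformLipschitz.

(** * The impact map in transverse coordinates *)

Section Impact.
Variables (R : realType) (n : nat) (rb : robot R n) (rf : reference R n).
Variables (p0 : gains R n) (qplus qminus : R).
Hypothesis rbH : bipedal_robot_with_disc rb.
Hypothesis rfH : reference_functions rb rf.
Hypothesis Zinv : impact_invariant rb (manifoldZ rb rf p0).
Hypothesis stepH : nominal_step rb rf p0 qplus qminus.
Implicit Types (x : state R n) (z : 'cV[R]_n * R).
Local Notation V := (Vref rf).
Local Notation S := (Sref rf).
Local Notation dS := ((Sref rf)^`()%classic).
Local Notation E := (tracking_error rb rf).

Definition next_shape z : 'cV[R]_(links n) := impact_q rb *m embed z.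
Definition next_qN z : R := final (next_shape z).
Definition next_hr z : 'cV[R]_n := middle (next_shape z) - href rf (next_qN z).

(* On W, the joint velocities are [q_N'] times the tangent [(h_ref', 1)] of the
   reference; [next_tangent] is its image under the impact. *)
Definition next_tangent z : 'cV[R]_(links n) :=
  impact_omega rb z *m embed (dhref rf z.2, 1).

Definition next_spread z (g : 'cV[R]_n) : 'cV[R]_(links n) :=
  impact_omega rb z *m embed (g, 0).

(** In omega this means that sigma_N passes through the impact unchanged and affects no other
    component. It yields the 1 in the factor 1 + a e. *)
Lemma impact_disc z : impact_omega rb z *m disc R n = disc R n.
Proof.
rewrite /disc -[RHS](impact_omega_col0 rbH z).
rewrite -[X in X *m _]hsubmxK mul_row_col mulmx0 addr0.
by rewrite -[X in X *m _]hsubmxK mul_row_col mulmx0 addr0 mulmx1.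
Qed.

Lemma impact1 x : (impact rb x).1 =
  first x.1 *: (impact_q rb *m disc R n) + next_shape (qr x, qN x).
Proof. by rewrite /impact /= {1}[x.1]disc_embedE mulmxDr -scalemxAr. Qed.

Lemma impact_qN x : qN (impact rb x) = next_qN (qr x, qN x).
Proof.
have [_ h] := impact_q_disc rbH rfH Zinv stepH.
by rewrite /qN impact1 finalD finalZ h mulr0 add0r.
Qed.

Lemma impact_hr x : hr rf (impact rb x) = next_hr (qr x, qN x).
Proof.
have [h _] := impact_q_disc rbH rfH Zinv stepH.
by rewrite /hr impact_qN /qr impact1 middleD middleZ h scaler0 add0r.
Qed.

Lemma impact2 x : (impact rb x).2 =
  sigmaN x *: disc R n + dqN x *: next_tangent (qr x, qN x) +
  next_spread (qr x, qN x) (dhr rb rf x).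
Proof.
rewrite /impact /= {1}[x.2]disc_embedE mulmxDr -scalemxAr impact_disc -addrA.
congr (_ + _); rewrite /next_tangent /next_spread scalemxAr -mulmxDr.
congr (_ *m _); rewrite -embed_linear; congr embed.
congr (_, _); rewrite /= ?addr0; last by rewrite /GRing.scale /= mulr1.
by rewrite (dhrE rbH rfH) addrC subrK.
Qed.

Lemma impact_dqN x : dqN (impact rb x) =
  dqN x * final (next_tangent (qr x, qN x)) +
  final (next_spread (qr x, qN x) (dhr rb rf x)).
Proof. by rewrite /dqN impact2 !finalD !finalZ final_disc mulr0 add0r. Qed.

Lemma impact_sigmaN x : sigmaN (impact rb x) = sigmaN x +
  dqN x * first (next_tangent (qr x, qN x)) +
  first (next_spread (qr x, qN x) (dhr rb rf x)).
Proof. by rewrite /sigmaN impact2 !firstD !firstZ first_disc mulr1. Qed.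

(** This defect and the two that follow measure by how much the impact fails to map reference
    velocity and momentum to reference ones at the shape [z]. All vanish at the nominal impact
    shape, hence are O(|h_r|) at impacts near Z. *)
Definition tangent_defect z : 'cV[R]_n :=
  middle (next_tangent z) - final (next_tangent z) *: dhref rf (next_qN z).

Lemma impact_dhr x : let r := next_spread (qr x, qN x) (dhr rb rf x) in
  dhr rb rf (impact rb x) = dqN x *: tangent_defect (qr x, qN x) +
  (middle r - final r *: dhref rf (next_qN (qr x, qN x))).
Proof.
move=> r; rewrite (dhrE rbH rfH) impact_dqN impact_qN impact2.
rewrite !middleD !middleZ middle_disc scaler0 add0r /tangent_defect.
rewrite scalerBr scalerA scalerDl opprD addrACA.
by [].
Qed.

Definition momentum_defect z : R :=
  S z.2 - S (next_qN z) + V z.2 * first (next_tangent z).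
Definition velocity_defect z : R :=
  V z.2 * final (next_tangent z) - V (next_qN z).

Local Notation zs := (href rf qminus, qminus).

(** Everything is read off at one point of Z on the impact surface, whose image lies in Z again.
    There h_r' = 0 removes the spread, and V != 0 can be divided out of the tangent equation. *)
Lemma nominal_impactE : [/\ next_qN zs = qplus, next_hr zs = 0,
  tangent_defect zs = 0, momentum_defect zs = 0 & velocity_defect zs = 0].
Proof.
have [x [Zx Sx qx Zy qy]] := nominal_impact_point Zinv stepH.
have /(manifoldZE rbH rfH)[vx h0 d0 v0 s0] := Zx.
have /(manifoldZE rbH rfH)[_ _ _ v1 s1] := Zy.
case: Zy => _ h1 d1 _ _; case: Zx => _ _ d0' _ _.
have r0 z : next_spread z 0 = 0.
  rewrite /next_spread (_ : embed (0, 0) = 0) ?mulmx0 //.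
  by rewrite -[(0, 0)]/(0 : 'cV[R]_n * R) /embed /= !raddf0 !col_mx0.
have zE : (qr x, qN x) = zs by rewrite h0 qx.
have qp : next_qN zs = qplus by rewrite -qy impact_qN zE.
have V0 : V qminus != 0 by rewrite gt_eqF // (Vref_gt0 rfH).
have m0 : middle (0 : 'cV[R]_(links n)) = 0.
  by apply/matrixP => i j; rewrite ord1 middleE !mxE.
have l0 : final (0 : 'cV[R]_(links n)) = 0 by rewrite finalE mxE.
have i0 : first (0 : 'cV[R]_(links n)) = 0 by rewrite firstE mxE.
split; first exact: qp.
- by rewrite -zE -impact_hr.
- move: d1; rewrite impact_dhr d0' r0 zE v0 qx => /eqP.
  rewrite m0 l0 scale0r subr0 addr0.
  by rewrite scaler_eq0 (negbTE V0) => /eqP.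
- move: s1; rewrite impact_sigmaN d0' r0 zE v0 s0 qy qx.
  rewrite i0 addr0.
  by rewrite /momentum_defect qp /= => <-; ring.
- move: v1; rewrite impact_dqN d0' r0 zE v0 qy qx.
  rewrite l0 addr0.
  by rewrite /velocity_defect qp /= => <-; ring.
Qed.

Lemma differentiable_next_shape z : differentiable next_shape z.
Proof.
apply: differentiable_mulmx; first exact: differentiable_cst.
by apply: (@differentiable_embed _ _ _ id); exact: ex_diff.
Qed.

Lemma differentiable_next_qN z : differentiable next_qN z.
Proof. exact/differentiable_final/differentiable_next_shape. Qed.

Lemma differentiable_comp_next_qN (W : normedModType R) (f : R -> W) z :
  smooth f -> differentiable (fun y => f (next_qN y)) z.
Proof.
move=> sf; apply: (@differentiable_comp _ _ _ _ next_qN f).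
  exact: differentiable_next_qN.
exact: (smooth_differentiable sf).
Qed.

Lemma differentiable_comp_qN (W : normedModType R) (f : R -> W) z :
  smooth f -> differentiable (fun y : 'cV[R]_n * R => f y.2) z.
Proof.
move=> sf; apply: (@differentiable_comp _ _ _ _ snd f).
  by apply: (@differentiable_snd _ _ _ _ id); exact: ex_diff.
exact: (smooth_differentiable sf).
Qed.

Let sV := smooth_Vref rfH.
Let sS := smooth_Sref rfH.
Let sdS := smooth_derive1 sS.
Let sh := smooth_href rfH.
Let sdh : smooth (dhref rf) := smooth_derive sh 1.

Lemma differentiable_next_tangent z : differentiable next_tangent z.
Proof.
apply: differentiable_mulmx.
  exact: (smooth_differentiable (smooth_impact rbH)).
apply: differentiable_embed; apply: differentiable_pair; last exact: differentiable_cst.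
exact: differentiable_comp_qN.
Qed.

Let dfirst z := differentiable_first (differentiable_next_tangent z).
Let dfinal z := differentiable_final (differentiable_next_tangent z).

Lemma differentiable_next_hr z : differentiable next_hr z.
Proof.
apply: differentiableB; first exact/differentiable_middle/differentiable_next_shape.
exact: differentiable_comp_next_qN.
Qed.

Lemma differentiable_tangent_defect z : differentiable tangent_defect z.
Proof.
apply: differentiableB; first exact/differentiable_middle/differentiable_next_tangent.
by apply: differentiable_scale; [exact: dfinal|exact: differentiable_comp_next_qN].
Qed.

Lemma differentiable_momentum_defect z : differentiable momentum_defect z.
Proof.
apply: differentiableD.
  apply: differentiableB; first exact: differentiable_comp_qN.
  exact: differentiable_comp_next_qN.
by apply: differentiableM; [exact: differentiable_comp_qN|exact: dfirst].
Qed.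

Lemma differentiable_velocity_defect z : differentiable velocity_defect z.
Proof.
apply: differentiableB; last exact: differentiable_comp_next_qN.
by apply: differentiableM; [exact: differentiable_comp_qN|exact: dfinal].
Qed.

Local Notation lip := (lipschitz_within zs).

Lemma defects_lipschitz : eventually_bounded (fun C d =>
  [/\ lip next_qN C d, lip next_hr C d, lip tangent_defect C d,
      lip momentum_defect C d & lip velocity_defect C d]).
Proof.
have [C [d [C0 d0 H]]] := eventually_boundedI
  (differentiable_lipschitz_within (differentiable_next_qN zs))
  (eventually_boundedI (differentiable_lipschitz_within (differentiable_next_hr zs))
  (eventually_boundedI (differentiable_lipschitz_within (differentiable_tangent_defect zs))
  (eventually_boundedI (differentiable_lipschitz_within (differentiable_momentum_defect zs))
     (differentiable_lipschitz_within (differentiable_velocity_defect zs))))).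
by exists C, d; split=> // C' d' hC hd; have [? [? [? [? ?]]]] := H C' d' hC hd.
Qed.

Lemma coefficients_lipschitz : eventually_bounded (fun C d =>
  [/\ lip (fun z => V z.2) C d, lip (fun z => first (next_tangent z)) C d,
      lip (fun z => final (next_tangent z)) C d,
      lip (fun z => dS z.2 * first (next_tangent z)) C d &
  [/\ lip (fun z => dS z.2 * final (next_tangent z)) C d,
      lip (fun z => dS (next_qN z)) C d, lip (fun z => dhref rf (next_qN z)) C d &
      lip (impact_omega rb) C d]]).
Proof.
have d1 := differentiableM (differentiable_comp_qN zs sdS) (dfirst zs).
have d2 := differentiableM (differentiable_comp_qN zs sdS) (dfinal zs).
have d3 := smooth_differentiable (smooth_impact rbH) zs.
have [C [d [C0 d0 H]]] := eventually_boundedI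
  (differentiable_lipschitz_within (differentiable_comp_qN zs sV))
  (eventually_boundedI (differentiable_lipschitz_within (dfirst zs))
  (eventually_boundedI (differentiable_lipschitz_within (dfinal zs))
  (eventually_boundedI (differentiable_lipschitz_within d1)
  (eventually_boundedI (differentiable_lipschitz_within d2)
  (eventually_boundedI (differentiable_lipschitz_within (differentiable_comp_next_qN zs sdS))
  (eventually_boundedI (differentiable_lipschitz_within (differentiable_comp_next_qN zs sdh))
     (differentiable_lipschitz_within d3))))))).
exists C, d; split=> // C' d' hC hd.
by have [? [? [? [? [? [? [? ?]]]]]]] := H C' d' hC hd.
Qed.

Lemma dSref_bound a b : a <= b ->
  exists2 B : R, 0 <= B & forall q, q \in `[a, b] -> `|dS q| <= B.
Proof.
move=> ab; have cS : {within `[a, b], continuous (fun q => `|dS q|)}.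
  apply: continuous_subspaceT => q.
  apply: (@continuous_comp _ _ _ dS Num.norm); last exact: norm_continuous.
  exact: (smooth_continuous sdS).
have [c _ Hc] := EVT_max ab cS.
by exists `|dS c|.
Qed.

(** Substituting q_N' = V + c + e S' b into the momentum balance moves the shaping term into the
    coefficient of b. At the nominal impact shape that coefficient is 1 + e a, with a = S' times the
    first entry of [next_tangent]. *)
Lemma bvar_impact (e k : R) x : 1 <= k -> let z := (qr x, qN x) in
  bvar rf (impact rb x) =
    (1 + e * (dS (qN x) * first (next_tangent z))) * bvar rf x + momentum_defect z +
    cvar rf (high_gain n e k) x * first (next_tangent z) +
    first (next_spread z (dhr rb rf x)).
Proof.
move=> k1 z; rewrite {1}/bvar impact_sigmaN impact_qN (dqN_shaping rf e k1).
by rewrite /momentum_defect /bvar /z /=; ring.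
Qed.

(** The new c contains the new b through [shaping], so its estimate comes after that of b. *)
Lemma cvar_impact (e k : R) x : 1 <= k -> let z := (qr x, qN x) in
  cvar rf (high_gain n e k) (impact rb x) =
    velocity_defect z + cvar rf (high_gain n e k) x * final (next_tangent z) +
    e * (dS (qN x) * final (next_tangent z)) * bvar rf x +
    final (next_spread z (dhr rb rf x)) -
    e * dS (next_qN z) * bvar rf (impact rb x).
Proof.
move=> k1 z; have := dqN_shaping rf e k1 (impact rb x).
rewrite impact_dqN impact_qN (dqN_shaping rf e k1 x) -/z => E1.
have -> : cvar rf (high_gain n e k) (impact rb x) =
  (V (next_qN z) + cvar rf (high_gain n e k) (impact rb x) +
   e * dS (next_qN z) * bvar rf (impact rb x)) - V (next_qN z) -
   e * dS (next_qN z) * bvar rf (impact rb x) by ring.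
by rewrite -E1 /velocity_defect /z /=; ring.
Qed.

Lemma near_impact : exists C1 d1 : R, [/\ 0 <= C1, 0 < d1 & forall x,
  impact_surface rb x ->
  `|hr rf x| < d1 -> `|dhr rb rf x| < d1 -> `|dqN x - V (qN x)| < d1 ->
  qplus - d1 < qN x < qminus + d1 ->
  `|qN x - qminus| <= C1 * `|hr rf x| /\
  `|((qr x, qN x) : 'cV[R]_n * R) - zs| <= C1 * `|hr rf x|].
Proof.
have [C1 [d1 [C10 d10 H1]]] := impact_location rbH rfH Zinv stepH.
have [C3 C30 /near_dist[d3 d30 H3]] :=
  differentiable_lipschitz_at (differentiable_href rfH qminus).
exists (1 + C3 * C1 + C1), (Num.min d1 (d3 / (C1 + 1))); split.
- by rewrite !addr_ge0 ?mulr_ge0.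
- by rewrite lt_min d10 divr_gt0 // ltr_wpDl.
- move=> x [vx px dpx] + + + /andP[qx1 qx2]; rewrite !lt_min.
  move=> /andP[h1 h2] /andP[g1 _] /andP[w1 _].
  have dd : Num.min d1 (d3 / (C1 + 1)) <= d1 by rewrite ge_min lexx.
  have qx : qplus - d1 < qN x < qminus + d1 by apply/andP; split; lra.
  have [_ /(_ px dpx) qq] := H1 x h1 g1 w1 qx.
  have hr0 : 0 <= `|hr rf x| := normr_ge0 _.
  have C3h : 0 <= C3 * C1 * `|hr rf x| by rewrite !mulr_ge0.
  have qd3 : `|qN x - qminus| < d3.
    move: h2; rewrite ltr_pdivlMr ?ltr_wpDl // => h2.
    have : C1 * `|hr rf x| <= `|hr rf x| * (C1 + 1) by lra.
    lra.
  have hh := H3 _ qd3.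
  have hh' : C3 * `|qN x - qminus| <= C3 * C1 * `|hr rf x|.
    by rewrite -mulrA ler_wpM2l.
  have C1h : 0 <= C1 * `|hr rf x| by rewrite mulr_ge0.
  split; first by apply: le_trans qq _; lra.
  rewrite prod_normE /= ge_max; apply/andP; split.
    have -> : qr x - href rf qminus = hr rf x + (href rf (qN x) - href rf qminus).
      by rewrite /hr addrA subrK.
    apply: le_trans (ler_normD _ _) _; lra.
  by apply: le_trans qq _; lra.
Qed.

End Impact.

(** The coefficient of b at the actual impact differs from the nominal one by O(|h_r|). For |b| <= 1
    the product of this difference with b counts as an error in h_r, and the gain |1 + e a| stays
    exact. *)
Lemma normr_gain_le (R : realDomainType) (a e w y L : R) :
  0 <= e -> 0 <= L -> `|w - a| <= L -> `|y| <= 1 ->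
  `|(1 + e * w) * y| <= `|1 + e * a| * `|y| + e * L.
Proof.
move=> e0 L0 wa y1; have -> : 1 + e * w = 1 + e * a + e * (w - a) by ring.
rewrite mulrDl; apply: le_trans (ler_normD _ _) _; rewrite normrM lerD2l.
rewrite !normrM (ger0_norm e0) -mulrA ler_wpM2l // -[L]mulr1.
exact: ler_pM.
Qed.

Section ImpactBound.
Variables (R : realType) (n : nat) (rb : robot R n) (rf : reference R n).
Variables (p0 : gains R n) (qplus qminus : R).
Hypothesis rbH : bipedal_robot_with_disc rb.
Hypothesis rfH : reference_functions rb rf.
Hypothesis Zinv : impact_invariant rb (manifoldZ rb rf p0).
Hypothesis stepH : nominal_step rb rf p0 qplus qminus.
Local Notation V := (Vref rf).
Local Notation dS := ((Sref rf)^`()%classic).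
Local Notation E := (tracking_error rb rf).
Local Notation b := (bvar rf).
Local Notation c e k := (cvar rf (high_gain n e k)).
Local Notation zs := (href rf qminus, qminus).

(** The choice of gains rests on the order of the quantifiers: [a] precedes [e], and [C], [d]
    precede [k]. Only the factor of b is sharp, because the contraction along the arc must beat it;
    the other constants may be crude. *)
Lemma impact_bound : exists a : R, forall e, 0 < e ->
  exists C d : R, [/\ 0 <= C, 0 < d & forall k x, 1 <= k -> impact_surface rb x ->
    `|hr rf x| < d -> `|dhr rb rf x| < d -> `|b x| < d -> `|c e k x| < d ->
    qplus - d < qN x < qminus + d ->
    [/\ `|qN x - qminus| <= C * E x,
        `|qN (impact rb x) - qplus| <= C * E x,
        E (impact rb x) <= C * E x,
        `|b (impact rb x)| <= `|1 + e * a| * `|b x| + C * (E x + `|c e k x|) &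
        `|c e k (impact rb x)| <= C * (E x + `|b x| + `|c e k x|)]].
Proof.
pose a := dS qminus * first (next_tangent rb rf zs).
exists a => e e0.
have [C1 [d1 [C10 d10 near]]] := near_impact rbH rfH Zinv stepH.
have [C2 [d2 [C20 d20 lips]]] := eventually_boundedI
  (defects_lipschitz qminus rbH rfH) (coefficients_lipschitz qminus rbH rfH).
have [[Lq Lh Lt Lm Lv] [LV Lf Ll Lfa [Lla LS Ld LM]]] := lips C2 d2 (lexx _) (lexx _).
have qpm := qplus_lt stepH.
have [S1 S10 HS1] : exists2 B : R, 0 <= B &
    forall q, q \in `[qplus - 1, qminus + 1] -> `|dS q| <= B.
  by apply: (dSref_bound rfH); lra.
have [Eq Eh Et Em Ev] := nominal_impactE rbH rfH Zinv stepH.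
pose N := (links n)%:R : R; have N0 : 0 <= N by [].
pose Br := N * C2.
have Br0 : 0 <= Br by rewrite mulr_ge0.
pose LK := C2 * C1.
have LK0 : 0 <= LK by rewrite mulr_ge0.
pose Bv := C2 + d1.
have Bv0 : 0 <= Bv by rewrite addr_ge0 // ltW.
(* Constants for E, b and c after impact: [LK] times |h_r| bounds the defects, [Br] times |h_r'| the
   spread, [Bv] bounds q_N' and [C2] the coefficients. *)
pose cE := LK + (Bv * LK + Br * (1 + C2)).
pose cb := e * LK + LK + Br + C2.
pose cc := LK + Br + C2 + e * C2 + e * C2 * (`|1 + e * a| + cb).
have e0' := ltW e0; have A0 : 0 <= `|1 + e * a| := normr_ge0 _.
have cE0 : 0 <= cE by rewrite /cE; do ?[exact: ler01|assumption|apply: addr_ge0|apply: mulr_ge0].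
have cb0 : 0 <= cb by rewrite /cb; do ?[assumption|apply: addr_ge0|apply: mulr_ge0].
have cc0 : 0 <= cc by rewrite /cc; do ?[assumption|apply: addr_ge0|apply: mulr_ge0].
(* The second entry forces |q_N' - V| <= |c| + e S1 |b| < d1, the last one keeps the shape within
   [d2] of the nominal impact; the bound 1 confines q_N to the strip and gives |b| <= 1. *)
pose d := Num.min (Num.min 1 (d1 / (1 + e * S1) / 2)) (Num.min d1 (d2 / (C1 + 1))).
have eS : 0 <= e * S1 by rewrite mulr_ge0.
have eSp : 0 < 1 + e * S1 by rewrite ltr_wpDr.
have C1p : 0 < C1 + 1 by rewrite ltr_wpDl.
have d0 : 0 < d by rewrite !lt_min ltr01 d10 !divr_gt0.
have dle1 : d <= 1 by rewrite !ge_min lexx.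
have dled1 : d <= d1 by rewrite !ge_min lexx !orbT.
have dled2 : d * (C1 + 1) <= d2.
  by rewrite -ler_pdivlMr // !ge_min lexx !orbT.
have dlew : d * (1 + e * S1) < d1.
  have : d <= d1 / (1 + e * S1) / 2 by rewrite !ge_min lexx !orbT.
  rewrite mulrAC ler_pdivlMr //; clear - R n rb rf p0 qplus qminus rbH rfH Zinv stepH d10; lra.
exists (C1 + LK + cE + cb + cc), d; split=> //; first by do ?[assumption|apply: addr_ge0].
move=> k x k1 Sx hd gd bd cd /andP[qx1 qx2].
have hr0 := normr_ge0 (hr rf x); have g0 := normr_ge0 (dhr rb rf x).
have b0 := normr_ge0 (b x); have c0 := normr_ge0 (c e k x).
have qI : qN x \in `[qplus - 1, qminus + 1].
  rewrite in_itv/=; clear - R n rb rf p0 qplus qminus rbH rfH Zinv stepH qx1 qx2 dle1.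
  by apply/andP; split; lra.
have wd : `|dqN x - V (qN x)| < d1.
  have -> : dqN x - V (qN x) = c e k x + e * dS (qN x) * b x.
    by rewrite {1}(dqN_shaping rf e k1); ring.
  apply: le_lt_trans (ler_normD _ _) (le_lt_trans _ dlew).
  rewrite !normrM (ger0_norm e0') mulrDr mulr1; apply: lerD; first exact: ltW.
  rewrite mulrC; apply: ler_pM => //; first by rewrite mulr_ge0.
    exact: ltW.
  by rewrite ler_wpM2l // HS1.
have [||||qq zz] := near x Sx.
- exact: lt_le_trans hd dled1.
- exact: lt_le_trans gd dled1.
- exact: wd.
- by clear - R n rb rf p0 qplus qminus rbH rfH Zinv stepH qx1 qx2 dled1; apply/andP; split; lra.
pose z : 'cV[R]_n * R := (qr x, qN x).
rewrite -/z in zz.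
have zd2 : `|z - zs| < d2.
  apply: le_lt_trans zz (lt_le_trans _ dled2).
  apply: (@le_lt_trans _ _ (C1 * d)); first by rewrite ler_wpM2l // ltW.
  by clear - R n rb rf p0 qplus qminus rbH rfH Zinv stepH d0; lra.
pose h := `|hr rf x|; pose g := `|dhr rb rf x|.
rewrite -[E x]/(h + g); rewrite -/h in hr0 zz qq; rewrite -/g in g0.
have lipE (W : normedModType R) (f : _ -> W) : lipschitz_within zs f C2 d2 ->
    `|f z - f zs| <= LK * h /\ `|f z| <= C2.
  move=> /(_ z zd2)[l1 l2]; split=> //; apply: le_trans l1 _.
  by rewrite /LK -mulrA ler_wpM2l.
have [tq _] := lipE _ _ Lq; have [th _] := lipE _ _ Lh; have [tt _] := lipE _ _ Lt.
have [tm _] := lipE _ _ Lm; have [tv _] := lipE _ _ Lv.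
have [_ uV] := lipE _ _ LV; have [_ uf] := lipE _ _ Lf; have [_ ul] := lipE _ _ Ll.
have [tfa ufa] := lipE _ _ Lfa; have [_ ula] := lipE _ _ Lla.
have [_ uS] := lipE _ _ LS; have [_ ud] := lipE _ _ Ld; have [_ uM] := lipE _ _ LM.
rewrite Eq in tq; rewrite Eh subr0 in th; rewrite Et subr0 in tt.
rewrite Em subr0 in tm; rewrite Ev subr0 in tv.
pose r := next_spread rb z (dhr rb rf x).
have rB : `|r| <= Br * g.
  apply: le_trans (normr_mulmx_le _ _) _; rewrite /Br -/N -mulrA -mulrA.
  rewrite ler_wpM2l //; apply: ler_pM => //.
  apply: le_trans (normr_embed _) _.
  by rewrite prod_normE /= normr0 ge_max lexx.
have vB : `|dqN x| <= Bv.
  rewrite -[dqN x](subrK (V (qN x))) /Bv addrC.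
  by apply: le_trans (ler_normD _ _) (lerD _ (ltW wd)).
pose X := h + g; have X0 : 0 <= X by rewrite addr_ge0.
have [hX gX] : h <= X /\ g <= X by rewrite /X lerDl lerDr.
have LKh : LK * h <= LK * X by rewrite ler_wpM2l.
have Brg : Br * g <= Br * X by rewrite ler_wpM2l.
set C := C1 + LK + cE + cb + cc.
have up K y : 0 <= y -> K <= C -> K * y <= C * y by move=> *; rewrite ler_wpM2r.
have [KC1 KC2 KC3] : [/\ C1 <= C, LK <= C & cE <= C].
  rewrite /C.
  clear - R n rb rf p0 qplus qminus rbH rfH Zinv stepH C10 LK0 cE0 cb0 cc0.
  by split; lra.
have [KC4 KC5] : cb <= C /\ cc <= C.
  rewrite /C.
  clear - R n rb rf p0 qplus qminus rbH rfH Zinv stepH C10 LK0 cE0 cb0 cc0.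
  by split; lra.
have HB : `|b (impact rb x)| <= `|1 + e * a| * `|b x| + cb * (X + `|c e k x|).
  rewrite (bvar_impact rbH rfH Zinv stepH e x k1) -/z -/r.
  have n1 : `|(1 + e * (dS (qN x) * first (next_tangent rb rf z))) * b x| <=
      `|1 + e * a| * `|b x| + e * LK * X.
    have LKh0 : 0 <= LK * h by rewrite mulr_ge0.
    have bd1 : `|b x| <= 1 by exact: le_trans (ltW bd) dle1.
    apply: le_trans (normr_gain_le e0' LKh0 tfa bd1) _.
    by rewrite lerD2l -mulrA ler_wpM2l.
  have n2 : `|c e k x * first (next_tangent rb rf z)| <= C2 * `|c e k x|.
    by rewrite normrM mulrC ler_wpM2r.
  have n3 : `|first r| <= Br * X.
    exact: le_trans (normr_first_le _) (le_trans rB Brg).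
  have n4 : 0 <= C2 * X by rewrite mulr_ge0.
  have n5 : 0 <= (e * LK + LK + Br) * `|c e k x|.
    by do ?[assumption|apply: addr_ge0|apply: mulr_ge0].
  apply: le_trans (ler_normD _ _) _.
  have := lerD (le_trans (ler_normD _ _)
    (lerD (le_trans (ler_normD _ _) (lerD n1 (le_trans tm LKh))) n2)) n3.
  move=> /le_trans; apply; rewrite /cb.
  clear - R n rb rf p0 qplus qminus rbH rfH Zinv stepH n4 n5; lra.
split.
- apply: le_trans qq _; apply: (@le_trans _ _ (C1 * X)); first by rewrite ler_wpM2l.
  exact: up.
- rewrite (impact_qN rbH rfH Zinv stepH) -/z.
  by apply: le_trans tq (le_trans LKh _); exact: up.
- rewrite /E (impact_hr rbH rfH Zinv stepH) (impact_dhr rbH rfH Zinv stepH) -/z -/r.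
  apply: (@le_trans _ _ (cE * X)); last exact: up.
  have n1 : `|dqN x *: tangent_defect rb rf z| <= Bv * (LK * X).
    by rewrite normrZ; apply: ler_pM => //; exact: le_trans tt LKh.
  have n2 : `|middle r - final r *: dhref rf (next_qN rb z)| <= Br * X + Br * X * C2.
    apply: le_trans (ler_normB _ _) _; apply: lerD.
      exact: le_trans (normr_middle_le _) (le_trans rB Brg).
    rewrite normrZ; apply: ler_pM (normr_ge0 _) (normr_ge0 _) _ ud.
    exact: le_trans (normr_final_le _) (le_trans rB Brg).
  have := lerD (le_trans th LKh) (le_trans (ler_normD _ _) (lerD n1 n2)).
  move=> /le_trans; apply; rewrite /cE; clear - R n rb rf p0 qplus qminus rbH rfH Zinv stepH; lra.
- apply: le_trans HB _; rewrite lerD2l; apply: up => //.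
  exact: addr_ge0.
- rewrite (cvar_impact rbH rfH Zinv stepH e x k1) -/z -/r.
  apply: (@le_trans _ _ (cc * (X + `|b x| + `|c e k x|))); last first.
    by apply: up => //; rewrite !addr_ge0.
  have n2 : `|c e k x * final (next_tangent rb rf z)| <= C2 * `|c e k x|.
    by rewrite normrM mulrC ler_wpM2r.
  have n3 : `|final r| <= Br * X.
    exact: le_trans (normr_final_le _) (le_trans rB Brg).
  have n4 : `|e * (dS (qN x) * final (next_tangent rb rf z)) * b x| <= e * C2 * `|b x|.
    by rewrite normrM ler_wpM2r // normrM (ger0_norm e0') ler_wpM2l.
  have n5 : `|e * dS (next_qN rb z) * b (impact rb x)| <=
      e * C2 * (`|1 + e * a| * `|b x| + cb * (X + `|c e k x|)).
    rewrite normrM; apply: ler_pM => //.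
    by rewrite normrM (ger0_norm e0') ler_wpM2l.
  apply: le_trans (ler_normB _ _) _.
  have := lerD (le_trans (ler_normD _ _) (lerD (le_trans (ler_normD _ _) (lerD
     (le_trans (ler_normD _ _) (lerD (le_trans tv LKh) n2)) n4)) n3)) n5.
  move=> /le_trans; apply.
  have eC : 0 <= e * C2 by rewrite mulr_ge0.
  have m1 : 0 <= (LK + Br + C2) * `|b x|.
    by do ?[assumption|apply: addr_ge0|apply: mulr_ge0].
  have m2 : 0 <= (LK + Br + e * C2) * `|c e k x|.
    by do ?[assumption|apply: addr_ge0|apply: mulr_ge0].
  have m3 : 0 <= (C2 + e * C2) * X.
    by do ?[assumption|apply: addr_ge0|apply: mulr_ge0].
  have m4 : 0 <= e * C2 * (`|1 + e * a| * (X + `|c e k x|) + cb * `|b x|).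
    by do ?[assumption|apply: addr_ge0|apply: mulr_ge0].
  rewrite /cc; clear - R n rb rf p0 qplus qminus rbH rfH Zinv stepH m1 m2 m3 m4; lra.
Qed.

End ImpactBound.

(** * Iteration over the steps *)

Lemma growth_arith (R : realFieldType) (E b c E' b' c' k f : R) :
  0 <= E -> E' <= (4 + k) * E -> c' <= c -> b' <= b + f * (E + c) ->
  0 <= (4 + k + f) * b -> 0 <= (4 + k) * c ->
  E' + b' + c' <= (5 + k + f) * (E + b + c).
Proof. lra. Qed.

(** Indices 0, 1, 2 stand for the start of an arc, its end, and the state after impact. The
    coefficient of b0 is 1/4 from a1 L plus 1/4 from the effect of b on c, made small by the weight
    w. All other terms carry a factor eta, and eta (a1 + 4 C) <= w / 2 fits them under half of w c0
    + E0. *)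
Lemma step_arith (R : realFieldType) (E0 b0 c0 E1 b1 c1 E2 b2 c2 a1 L C w th f eta : R) :
  0 <= E0 -> 0 <= b0 -> 0 <= c0 -> 0 <= a1 -> 0 <= L <= 1 -> 0 <= C ->
  0 < w <= 1 -> w * C <= 1 / 4 -> a1 * L <= 1 / 4 ->
  th <= eta -> f <= eta -> 0 <= eta -> eta * (a1 + 4 * C + 1) <= w / 2 ->
  E1 <= th * E0 -> c1 <= th * c0 -> b1 <= L * b0 + f * (E0 + c0) ->
  E2 <= C * E1 -> b2 <= a1 * b1 + C * (E1 + c1) -> c2 <= C * (E1 + b1 + c1) ->
  b2 + w * c2 + E2 <= 1 / 2 * (b0 + w * c0 + E0).
Proof.
move=> E00 b00 c00 a10 /andP[L0 L1] C0 /andP[w0 w1] wC aL th_eta f_eta eta0 Heta.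
move=> HE1 Hc1 Hb1 HE2 Hb2 Hc2.
have hE : E1 <= eta * E0 by apply: le_trans HE1 _; rewrite ler_wpM2r.
have hc : c1 <= eta * c0 by apply: le_trans Hc1 _; rewrite ler_wpM2r.
have X0 : 0 <= E0 + c0 by rewrite addr_ge0.
have hb : b1 <= L * b0 + eta * (E0 + c0).
  by apply: le_trans Hb1 _; rewrite lerD2l ler_wpM2r.
have s1 : b2 <= a1 * (L * b0 + eta * (E0 + c0)) + C * (eta * (E0 + c0)).
  apply: le_trans Hb2 _; apply: lerD; rewrite ler_wpM2l //.
  by rewrite mulrDr; exact: lerD.
have s2 : E2 <= C * (eta * (E0 + c0)).
  apply: le_trans HE2 _; rewrite ler_wpM2l // (le_trans hE) // ler_wpM2l //.
  by rewrite lerDl.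
have s3 : w * c2 <= w * C * (b0 + 2 * (eta * (E0 + c0))).
  rewrite -mulrA ler_wpM2l ?(ltW w0) // (le_trans Hc2) // ler_wpM2l //.
  have : L * b0 <= b0 by rewrite ler_piMl.
  lra.
have s4 : w * C * (b0 + 2 * (eta * (E0 + c0))) <= 1 / 4 * b0 + 2 * (C * (eta * (E0 + c0))).
  have y0 : 0 <= C * (eta * (E0 + c0)) by rewrite !mulr_ge0.
  have : w * (C * (eta * (E0 + c0))) <= C * (eta * (E0 + c0)) by rewrite ler_piMl.
  have : w * C * b0 <= 1 / 4 * b0 by rewrite ler_wpM2r.
  lra.
have s5 : a1 * (L * b0) <= 1 / 4 * b0 by rewrite mulrA ler_wpM2r.
have s6 : eta * (a1 + 4 * C + 1) * (E0 + c0) <= w / 2 * (E0 + c0) by rewrite ler_wpM2r.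
have s7 : w * E0 <= E0 by rewrite ler_piMl.
have s8 : 0 <= eta * (E0 + c0) by rewrite mulr_ge0.
lra.
Qed.

Lemma impact_arith (R : realFieldType) (E b c E' b' c' a1 C : R) :
  0 <= E -> 0 <= b -> 0 <= c -> 0 <= a1 -> 0 <= C ->
  E' <= C * E -> b' <= a1 * b + C * (E + c) -> c' <= C * (E + b + c) ->
  E' + b' + c' <= (3 * C + a1 + 1) * (E + b + c).
Proof.
move=> E0 b0 c0 a0 C0 h1 h2 h3.
have m1 : 0 <= a1 * (E + c) by rewrite mulr_ge0 // addr_ge0.
have m2 : 0 <= C * (b + c) by rewrite mulr_ge0 // addr_ge0.
have m3 : 0 <= C * b by rewrite mulr_ge0.
have m4 : 0 <= C * E by rewrite mulr_ge0.
lra.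
Qed.

Lemma transit_arith (R : realDomainType) (u v p q rho : R) :
  `|u - q| <= rho -> `|v - p| <= rho -> q - p - 2 * rho <= u - v.
Proof. by rewrite !ler_norml => /andP[h1 _] /andP[_ h2]; lra. Qed.

Lemma start_arith (R : realDomainType) (u p q rho r : R) :
  `|u - p| <= rho -> rho < r -> p < q -> p - r < u < q + r.
Proof. by rewrite ler_norml => /andP[h1 h2] h3 h4; apply/andP; split; lra. Qed.

Lemma half_exp_le1 (R : realFieldType) j : (1 / 2 : R) ^+ j <= 1.
Proof. by rewrite exprn_ile1 //; lra. Qed.

(** * Arcs and hybrid solutions near Z *)

Section Arcs.
Variables (R : realType) (n : nat) (rb : robot R n) (rf : reference R n).
Hypothesis rbH : bipedal_robot_with_disc rb.
Hypothesis rfH : reference_functions rb rf.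
Hypothesis dU : forall x, valid rb x -> decoupling rb rf x \in unitmx.
Variables (qplus qminus e k S1 B : R).
Hypotheses (e0 : 0 < e) (k1 : 1 <= k) (B0 : 0 <= B).
Local Notation p := (high_gain n e k).
Local Notation F := (closed_loop rb rf p).
Local Notation V := (Vref rf).
Local Notation dS := ((Sref rf)^`()%classic).
Local Notation E := (tracking_error rb rf).
Local Notation b := (bvar rf).
Local Notation c := (cvar rf p).
Hypothesis HS : forall q, q \in `[qplus - 1, qminus + 1] -> `|dS q| <= S1.
Hypothesis HB : forall h q, exists2 u : R,
  k2 rb rf h q = dS q * V q + u & `|u| <= B * `|h|.

Definition total_error (x : state R n) : R := E x + `|b x| + `|c x|.
Local Notation Y := total_error.

Definition forcing : R := 4 * B + 2 * S1.
Definition arc_growth_rate : R := 5 + k + forcing.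
Local Notation G := arc_growth_rate.

Lemma total_error_ge0 x : 0 <= Y x.
Proof. by rewrite !addr_ge0. Qed.

Lemma error_le_total x :
  [/\ E x <= Y x, `|b x| <= Y x, `|c x| <= Y x & `|hr rf x| <= Y x].
Proof.
have h1 := normr_ge0 (b x); have h2 := normr_ge0 (c x).
have h3 := normr_ge0 (hr rf x); have h4 := normr_ge0 (dhr rb rf x).
by rewrite /total_error /tracking_error; split; lra.
Qed.

Let k0 : 0 < k. Proof. exact: lt_le_trans k1. Qed.

Section Arc.
Variables (s t : R) (x : R -> state R n).
Hypotheses (st : s <= t) (fx : flow_on rb F s t x).
Hypothesis qI : forall u, u \in `[s, t] -> qN (x u) \in `[qplus - 1, qminus + 1].

Lemma forcing_ge0 : 0 <= forcing.
Proof.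
have sI : s \in `[s, t] by rewrite bound_itvE.
have S10 := le_trans (normr_ge0 _) (HS (qI sI)).
by rewrite addr_ge0 ?mulr_ge0.
Qed.

(** [flow_bvar] is used with A = 0: at this stage the sign of q_N' is unknown, and it will be
    deduced from these very bounds. *)
Lemma arc_errors :
  [/\ E (x t) <= (4 + k) * expR (- (k * (t - s) / 2)) * E (x s),
      `|c (x t)| <= expR (- (k * (t - s) / 2)) * `|c (x s)| &
      `|b (x t)| <= `|b (x s)| + forcing / k * (E (x s) + `|c (x s)|)].
Proof.
have kt : 0 <= k * (t - s) by rewrite mulr_ge0 ?(ltW k0) ?subr_ge0.
split.
- by have [_] := flow_tracking_error rbH rfH dU k1 st fx.
- rewrite (flow_cvar rbH rfH dU k1 st fx) normrM ger0_norm ?expR_ge0 //.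
  by rewrite ler_wpM2r // ler_expR; lra.
- have := flow_bvar rbH rfH dU e0 k1 (A := fun=> 0) (dA := fun=> 0) st fx B0 HB.
  move=> /(_ S1); rewrite subrr mulr0 oppr0 expR0 mul1r; apply=> u uI; split.
  + exact/HS/qI.
  + by rewrite mul0r lexx sqr_ge0.
  + exact: is_derive_cst.
Qed.

Lemma arc_growth : Y (x t) <= G * Y (x s).
Proof.
have [h1 h2 h3] := arc_errors; have f0 := forcing_ge0.
have kt : 0 <= k * (t - s) by rewrite mulr_ge0 ?(ltW k0) ?subr_ge0.
have dle : expR (- (k * (t - s) / 2)) <= 1.
  by rewrite -expR0 ler_expR oppr_le0 divr_ge0.
have E0 := tracking_error_ge0 rb rf (x s).
have b0 := normr_ge0 (b (x s)); have c0 := normr_ge0 (c (x s)).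
have g1 : E (x t) <= (4 + k) * E (x s).
  apply: le_trans h1 _; rewrite ler_wpM2r // ler_piMr // addr_ge0 // ltW //.
have g2 : `|c (x t)| <= `|c (x s)| by apply: le_trans h2 _; rewrite ler_piMl.
have g3 : `|b (x t)| <= `|b (x s)| + forcing * (E (x s) + `|c (x s)|).
  apply: le_trans h3 _; rewrite lerD2l ler_wpM2r ?addr_ge0 // ler_pdivrMr // ler_peMr //.
have kb : 0 <= (4 + k + forcing) * `|b (x s)|.
  by apply: mulr_ge0 => //; do ?[exact: ltW|assumption|apply: addr_ge0].
have kc : 0 <= (4 + k) * `|c (x s)| by rewrite mulr_ge0 // addr_ge0 // ltW.
exact: growth_arith.
Qed.

End Arc.

Lemma arc_growth_ge1 : 0 <= S1 -> 1 <= G.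
Proof.
move=> S10; have : 0 <= forcing by rewrite addr_ge0 ?mulr_ge0.
move=> f0; apply: (@le_trans _ _ 5); first by rewrite ler1n.
by rewrite /arc_growth_rate -addrA lerDl; apply: addr_ge0 => //; exact: ltW.
Qed.

Lemma velocity_error_le x : qN x \in `[qplus - 1, qminus + 1] ->
  `|dqN x - V (qN x)| <= (1 + e * S1) * Y x.
Proof.
move=> qI; have -> : dqN x - V (qN x) = c x + e * dS (qN x) * b x.
  by rewrite {1}(dqN_shaping rf e k1); ring.
have [_ h1 h2 _] := error_le_total x; have Sq := HS qI.
apply: le_trans (ler_normD _ _) _; rewrite mulrDl mul1r; apply: lerD => //.
rewrite !normrM (ger0_norm (ltW e0)) -!mulrA ler_wpM2l ?(ltW e0) //.
exact: ler_pM.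
Qed.

(** [Vlo] and [Vhi] will bound q_N', [r] is the margin of the strip, and [delta] bounds the error at
    the start of an arc. The hypotheses make [delta] so small that the error stays harmless even
    after the growth by G. *)
Variables (Vlo Vhi C1 d1 r delta : R).
Hypotheses (Vlo0 : 0 < Vlo) (C10 : 0 <= C1) (r0 : 0 < r).
Hypotheses (r1 : r <= 1) (rd1 : r < d1) (qpm : qplus < qminus).
Hypothesis HV : forall q, q \in `[qplus - 1, qminus + 1] ->
  2 * Vlo <= V q <= Vhi - 1.
Hypothesis Hloc : forall x, `|hr rf x| < d1 -> `|dhr rb rf x| < d1 ->
  `|dqN x - V (qN x)| < d1 -> qplus - d1 < qN x < qminus + d1 ->
  0 <= p2 rb x -> qN x - qminus <= C1 * `|hr rf x|.
Hypotheses (dd1 : G * delta < d1) (dr : C1 * (G * delta) < r).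
Hypotheses (dw1 : (1 + e * S1) * (G * delta) < d1)
  (dw2 : (1 + e * S1) * (G * delta) <= 1)
  (dw3 : (1 + e * S1) * (G * delta) <= Vlo).

Lemma S1_ge0 : 0 <= S1.
Proof.
have : qplus \in `[qplus - 1, qminus + 1].
  by rewrite in_itv/=; have lt_qpm := qpm; apply/andP; split; lra.
by move/HS; exact: le_trans (normr_ge0 _).
Qed.

Lemma arc_velocity x : qN x \in `[qplus - 1, qminus + 1] -> Y x <= G * delta ->
  Vlo <= dqN x <= Vhi.
Proof.
move=> qI Yx; have := velocity_error_le qI; have /andP[v1 v2] := HV qI.
have eS : 0 <= 1 + e * S1.
  by rewrite addr_ge0 // mulr_ge0 ?S1_ge0 // ltW.
have : (1 + e * S1) * Y x <= (1 + e * S1) * (G * delta) by rewrite ler_wpM2l.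
move=> h1 h2; have := le_trans h2 h1; rewrite ler_norml => /andP[h3 h4].
have w2 := dw2; have w3 := dw3; apply/andP; split; lra.
Qed.

Section Stay.
Variables (s t : R) (x : R -> state R n).
Hypotheses (st : s <= t) (fx : flow_on rb F s t x).
Hypotheses (Ys : Y (x s) <= delta) (qs : qplus - r < qN (x s) < qminus + r).

Let inside u := forall v, v \in `[s, u] -> qplus - r <= qN (x v) <= qminus + r.

Let insideI u v : inside u -> v \in `[s, u] -> qN (x v) \in `[qplus - 1, qminus + 1].
Proof.
by have r1' := r1 => H /H /andP[h1 h2]; rewrite in_itv/=; apply/andP; split; lra.
Qed.

Let inside_error u v : u <= t -> inside u -> v \in `[s, u] -> Y (x v) <= G * Y (x s).
Proof.
move=> ut H; rewrite in_itv/= => /andP[sv vu].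
apply: (arc_growth sv (flow_prefix (le_trans vu ut) fx)) => w.
rewrite in_itv/= => /andP[sw wv]; apply: (insideI H).
by rewrite in_itv/= sw (le_trans wv).
Qed.

Let inside_delta u v : u <= t -> inside u -> v \in `[s, u] -> Y (x v) <= G * delta.
Proof.
move=> ut H /(inside_error ut H) /le_trans; apply.
by rewrite ler_wpM2l // (le_trans ler01) // arc_growth_ge1 // S1_ge0.
Qed.

Let inside_progress u : s <= u -> u <= t -> inside u ->
  Vlo * (u - s) <= qN (x u) - qN (x s) <= Vhi * (u - s).
Proof.
move=> su ut H; have fxu := flow_prefix ut fx.
have Hq : has_derivative_on s u (fun v => qN (x v)) (fun v => dqN (x v)).
  apply: (has_derivative_on_eq (flow_has_derivative_on fxu (@differentiable_qN _ _))).
  by move=> v _; rewrite (derive_qN_closed_loop rf rbH).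
have vel v : v \in `]s, u[ -> Vlo <= dqN (x v) <= Vhi.
  move=> vI; have vI' : v \in `[s, u] by apply: subset_itv_oo_cc.
  by apply: arc_velocity; [exact: (insideI H)|exact: (inside_delta ut H)].
have aff a : has_derivative_on s u (fun v => qN (x v) + - (a * v)) (fun v => dqN (x v) - a).
  apply: (has_derivative_on_eq (has_derivative_onD Hq (has_derivative_onN
    (has_derivative_onM (has_derivative_on_cst s u a) (has_derivative_on_id s u))))).
  by move=> v _ /=; ring.
have := has_derivative_on_ndecr su (aff Vlo) _.
have := has_derivative_on_nincr su (aff Vhi) _.
move=> h1 h2; have {}h1 := h1 _; have {}h2 := h2 _.
have h3 : qN (x u) - Vhi * u <= qN (x s) - Vhi * s.
  by apply: h1 => v /vel /andP[_]; rewrite subr_le0.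
have h4 : qN (x s) - Vlo * s <= qN (x u) - Vlo * u.
  by apply: h2 => v /vel /andP[h _]; rewrite subr_ge0.
apply/andP; split; lra.
Qed.

(** At the upper end the ground acts: the state is valid, so [Hloc] gives q_N - qminus <= C1 |h_r| <
    r. At the lower end q_N cannot fall below its initial value, because q_N' >= Vlo. *)
Let inside_strict u : s <= u -> u <= t -> inside u ->
  qplus - r < qN (x u) < qminus + r.
Proof.
move=> su ut H; have /andP[h1 _] := inside_progress su ut H.
have uI : u \in `[s, u] by rewrite bound_itvE.
have Yu := inside_delta ut H uI; have qu := insideI H uI.
have [Eu _ _ hu] := error_le_total (x u).
have gu : `|dhr rb rf (x u)| <= E (x u) by rewrite lerDr.
have h0 := normr_ge0 (hr rf (x u)).
have eS : 0 <= 1 + e * S1 by rewrite addr_ge0 // mulr_ge0 ?S1_ge0 // ltW.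
have wu : `|dqN (x u) - V (qN (x u))| < d1.
  apply: le_lt_trans (velocity_error_le qu) (le_lt_trans _ dw1).
  by rewrite ler_wpM2l.
have p2u : 0 <= p2 rb (x u).
  apply: (valid_above_ground rbH); case: fx => _ + _; apply.
  by rewrite in_itv/= su.
have := H u uI => /andP[q1 q2].
have Vs : 0 <= Vlo * (u - s) by rewrite mulr_ge0 ?(ltW Vlo0) ?subr_ge0.
have r1' := rd1; have dr' := dr.
have qu' : qplus - d1 < qN (x u) < qminus + d1 by apply/andP; split; lra.
have := Hloc (le_lt_trans (le_trans hu Yu) dd1)
  (le_lt_trans (le_trans gu (le_trans Eu Yu)) dd1) wu qu' p2u.
have : C1 * `|hr rf (x u)| <= C1 * (G * delta).
  by rewrite ler_wpM2l // (le_trans hu).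
move: qs => /andP[q3 q4]; move=> h5 h6; apply/andP; split; lra.
Qed.

Lemma arc_stay u : u \in `[s, t] -> qplus - r < qN (x u) < qminus + r.
Proof.
(* The strip is written as |q - m| < l, so that a single scalar function enters [first_exit]. *)
pose m := (qplus + qminus) / 2; pose l := (qminus - qplus) / 2 + r.
have mE q : (`|q - m| < l) = (qplus - r < q < qminus + r).
  by rewrite ltr_norml /m /l; apply/andP/andP => -[h1 h2]; split; lra.
have mE' q : (`|q - m| <= l) = (qplus - r <= q <= qminus + r).
  by rewrite ler_norml /m /l; apply/andP/andP => -[h1 h2]; split; lra.
move=> uI; rewrite -mE.
apply: (first_exit (f := fun v => `|qN (x v) - m|) _ _ _ uI).
- have [cx _ _] := fx => v.
  apply: (@continuous_comp _ _ _ (x : subspace `[s, t] -> _) (fun y => `|qN y - m|)).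
    exact: cx.
  apply: (@continuous_comp _ _ _ (fun y => qN y - m) Num.norm); last exact: norm_continuous.
  apply: differentiable_continuous; apply: differentiableB; last exact: differentiable_cst.
  exact: differentiable_qN.
- by rewrite mE.
- move=> v; rewrite in_itv/= => /andP[sv vt] H; rewrite mE.
  by apply: inside_strict => // w /H; rewrite mE'.
Qed.

Let insideT u : u \in `[s, t] -> inside u.
Proof.
rewrite in_itv/= => /andP[su ut] v; rewrite in_itv/= => /andP[sv vu].
have : v \in `[s, t] by rewrite in_itv/= sv (le_trans vu).
by move=> /arc_stay /andP[h1 h2]; rewrite !ltW.
Qed.

Lemma arc_total_error u : u \in `[s, t] -> Y (x u) <= G * Y (x s).
Proof.
move=> uI; have := uI; rewrite in_itv/= => /andP[su ut].
by apply: (inside_error ut (insideT uI)); rewrite in_itv/= su lexx.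
Qed.

Lemma arc_progress : Vlo * (t - s) <= qN (x t) - qN (x s) <= Vhi * (t - s).
Proof. by apply: inside_progress => //; apply: insideT; rewrite bound_itvE. Qed.

(** As 0 <= q_N' <= Vhi, the time derivative of A(q_N) is at most S'^2. The contraction of b is
    thereby expressed by the values of q_N at the ends of the arc alone, whatever the solution does
    between them. *)
Lemma arc_contraction (A : R -> R) :
  (forall q, q \in `[qplus - 1, qminus + 1] -> is_derive q (1 : R) A (dS q ^+ 2 / Vhi)) ->
  [/\ E (x t) <= (4 + k) * expR (- (k * (t - s) / 2)) * E (x s),
      `|c (x t)| <= expR (- (k * (t - s) / 2)) * `|c (x s)| &
      `|b (x t)| <= expR (- (e * (A (qN (x t)) - A (qN (x s))))) * `|b (x s)| +
        forcing / k * (E (x s) + `|c (x s)|)].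
Proof.
move=> HA; have tI : t \in `[s, t] by rewrite bound_itvE.
have qI u : u \in `[s, t] -> qN (x u) \in `[qplus - 1, qminus + 1].
  exact: (insideI (insideT tI)).
have [h1 h2 _] := arc_errors st fx qI; split=> //.
apply: (flow_bvar rbH rfH dU e0 k1 (dA := fun q => dS q ^+ 2 / Vhi) st fx B0 HB) => u uI.
have /andP[v1 v2] : Vlo <= dqN (x u) <= Vhi.
  by apply: arc_velocity; [exact: qI|exact: (inside_delta (lexx t) (insideT tI))].
have Vhi0 : 0 < Vhi by exact: lt_le_trans (lt_le_trans Vlo0 v1) v2.
have v0 : 0 <= dqN (x u) by exact: le_trans (ltW Vlo0) v1.
split; [exact/HS/qI| |exact/HA/qI].
rewrite mulr_ge0 ?divr_ge0 ?sqr_ge0 ?(ltW Vhi0) //=.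
by rewrite mulrAC ler_pdivrMr // ler_wpM2l ?sqr_ge0.
Qed.

End Stay.

(** [rho] bounds the distance of q_N from [qminus] before an impact and from [qplus] after it, [I]
    is to be the increase of A over the nominal step, [Tmin] bounds the duration of a full arc from
    below, [w] is the weight of c, and [eta] bounds all the factors that a large [k] makes small. *)
Variables (C a I Tmin rho w eta : R) (A : R -> R).
Hypotheses (C0 : 0 <= C) (rho_r : rho < r) (Crho : C * (G * delta) <= rho).
Hypothesis Himp : forall x, impact_surface rb x -> Y x <= G * delta ->
  qplus - r < qN x < qminus + r ->
  [/\ `|qN x - qminus| <= C * E x,
      `|qN (impact rb x) - qplus| <= C * E x,
      E (impact rb x) <= C * E x,
      `|b (impact rb x)| <= `|1 + e * a| * `|b x| + C * (E x + `|c x|) &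
      `|c (impact rb x)| <= C * (E x + `|b x| + `|c x|)].
Hypothesis HA : forall q, q \in `[qplus - 1, qminus + 1] ->
  is_derive q (1 : R) A (dS q ^+ 2 / Vhi).
Hypothesis HI : forall q q', `|q - qminus| <= rho -> `|q' - qplus| <= rho ->
  I / 2 <= A q - A q'.
Hypotheses (I0 : 0 <= I) (Vhi0 : 0 < Vhi) (HT : Vhi * Tmin <= qminus - qplus - 2 * rho).
Hypotheses (w01 : 0 < w <= 1) (wC : w * C <= 1 / 4)
  (aL : `|1 + e * a| * expR (- (e * (I / 2))) <= 1 / 4).
Hypotheses (eta0 : 0 <= eta) (eta1 : (4 + k) * expR (- (k * Tmin / 2)) <= eta)
  (eta2 : forcing / k <= eta) (eta3 : eta * (`|1 + e * a| + 4 * C + 1) <= w / 2).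

Definition weighted_error (x : state R n) : R := `|b x| + w * `|c x| + E x.
Local Notation N := weighted_error.
Local Notation GI := (3 * C + `|1 + e * a| + 1).
Local Notation D := (GI * G).

Lemma weighted_le_total x : N x <= Y x.
Proof.
have /andP[_ w1] := w01.
have : w * `|c x| <= `|c x| by rewrite ler_piMl.
rewrite /weighted_error /total_error.
by move: (E x) `|b x| `|c x| => u v z; lra.
Qed.

Lemma total_le_weighted x : w * Y x <= N x.
Proof.
have /andP[w0 w1] := w01.
have : w * E x <= E x by rewrite ler_piMl // tracking_error_ge0.
have : w * `|b x| <= `|b x| by rewrite ler_piMl.
rewrite /weighted_error /total_error.
by move: (E x) `|b x| `|c x| => u v z; lra.
Qed.

Lemma impact_total_error x : impact_surface rb x -> Y x <= G * delta ->
  qplus - r < qN x < qminus + r -> Y (impact rb x) <= GI * Y x.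
Proof.
move=> Sx Yx qx; have [_ _ h1 h2 h3] := Himp Sx Yx qx.
have E0 := tracking_error_ge0 rb rf x; have b0 := normr_ge0 (b x).
have c0 := normr_ge0 (c x); have a0 := normr_ge0 (1 + e * a).
exact: impact_arith.
Qed.

Lemma arc_expR T : Tmin <= T -> (4 + k) * expR (- (k * T / 2)) <= eta.
Proof.
move=> TT; apply: le_trans eta1; rewrite ler_wpM2l ?addr_ge0 ?(ltW k0) //.
by rewrite ler_expR lerN2 ler_wpM2r ?invr_ge0 // ler_wpM2l ?(ltW k0).
Qed.

(** An arc that starts within [rho] of [qplus] and ends in an impact crosses nearly the whole
    nominal range. This yields both its minimal duration and the increase I / 2 of A. *)
Lemma step_contraction s t x : s <= t -> flow_on rb F s t x -> Y (x s) <= delta ->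
  qplus - r < qN (x s) < qminus + r -> `|qN (x s) - qplus| <= rho ->
  impact_surface rb (x t) -> N (impact rb (x t)) <= 1 / 2 * N (x s).
Proof.
move=> st fx Ys qs qs' Sx.
have tI : t \in `[s, t] by rewrite bound_itvE.
have G0 : 0 <= G by rewrite (le_trans ler01) // arc_growth_ge1 // S1_ge0.
have Yt : Y (x t) <= G * delta.
  by apply: le_trans (arc_total_error fx Ys qs tI) _; rewrite ler_wpM2l.
have qt := arc_stay fx Ys qs tI.
have [i1 _ i3 i4 i5] := Himp Sx Yt qt.
have [h1 h2 h3] := arc_contraction st fx Ys qs HA.
have [Et _ _ _] := error_le_total (x t).
have qt' : `|qN (x t) - qminus| <= rho.
  by apply: le_trans i1 (le_trans _ Crho); rewrite ler_wpM2l // (le_trans Et).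
have Tm : Tmin <= t - s.
  have /andP[_ p1] := arc_progress st fx Ys qs.
  rewrite -(ler_pM2l Vhi0); apply: le_trans p1; apply: le_trans HT _.
  exact: transit_arith.
have th := arc_expR Tm.
have th' : expR (- (k * (t - s) / 2)) <= (4 + k) * expR (- (k * (t - s) / 2)).
  by rewrite ler_peMl ?expR_ge0 // ler_wpDr ?(ltW k0) // ler1n.
have c0 := normr_ge0 (c (x s)).
apply: (step_arith (eta := eta) (L := expR (- (e * (I / 2))))
  (th := (4 + k) * expR (- (k * (t - s) / 2))) (f := forcing / k)
  (tracking_error_ge0 rb rf (x s)) (normr_ge0 (b (x s))) c0 _ _ C0 w01 wC aL
  th eta2 eta0 eta3 h1 _ _ i3 i4 i5) => //.
- by rewrite expR_ge0 -expR0 ler_expR oppr_le0 mulr_ge0 ?(ltW e0) // divr_ge0.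
- by apply: le_trans h2 _; rewrite ler_wpM2r.
- apply: le_trans h3 _; rewrite lerD2r ler_wpM2r // ler_expR lerN2.
  by rewrite ler_wpM2l ?(ltW e0) //; exact: HI.
Qed.

(** Bound on the initial error: after the first arc and impact the weighted error is at most D
    delta0 <= w delta, so the total error is below [delta] again. *)
Variable delta0 : R.
Hypotheses (delta0_le : delta0 <= delta) (Ddelta0 : D * delta0 <= w * delta).

Section Hybrid.
Variables (m : nat) (tau : nat -> R) (phi : nat -> R -> state R n).
Hypothesis sol : hybrid_solution rb F m tau phi.
Hypothesis Y0 : Y (phi 0%N 0) <= delta0.
Hypothesis q0 : qplus - r < qN (phi 0%N 0) < qminus + r.

Let y0 := Y (phi 0%N 0).

(** The index 0 is apart because the solution may start anywhere in the strip: its first arc and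
    impact may multiply the error by D. Each later arc starts near [qplus] and halves N, whence the
    exponent i at j = i + 1. *)
Lemma hybrid_invariants j : (j <= m)%N ->
  [/\ Y (phi j (tau j)) <= delta,
      qplus - r < qN (phi j (tau j)) < qminus + r &
      match j with 0%N => Y (phi j (tau j)) = y0 | i.+1 =>
        `|qN (phi j (tau j)) - qplus| <= rho /\
        N (phi j (tau j)) <= (1 / 2) ^+ i * (D * y0) end].
Proof.
have [tau0 Hflow _ Himpact] := sol.
have G0 : 0 <= G by rewrite (le_trans ler01) // arc_growth_ge1 // S1_ge0.
have /andP[w0 w1] := w01.
have y00 : 0 <= y0 := total_error_ge0 _.
have GI0 : 0 <= GI by rewrite !addr_ge0 ?mulr_ge0.
elim: j => [_|j IH jm].
  by rewrite tau0; split=> //; exact: le_trans delta0_le.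
have [Yj qj Hj] := IH (ltnW jm).
have [tj fj] := Hflow j (ltnW jm).
have [Sj ->] := Himpact j jm.
have tI : tau j.+1 \in `[tau j, tau j.+1] by rewrite bound_itvE.
have Yt := arc_total_error fj Yj qj tI.
have Yt' : Y (phi j (tau j.+1)) <= G * delta.
  by apply: le_trans Yt _; rewrite ler_wpM2l.
have qt := arc_stay fj Yj qj tI.
have [_ i2 _ _ _] := Himp Sj Yt' qt.
have [Et _ _ _] := error_le_total (phi j (tau j.+1)).
have qi : `|qN (impact rb (phi j (tau j.+1))) - qplus| <= rho.
  by apply: le_trans i2 (le_trans _ Crho); rewrite ler_wpM2l // (le_trans Et).
have Ni : N (impact rb (phi j (tau j.+1))) <= (1 / 2) ^+ j * (D * y0).
  case: j Hj {IH jm Et i2 tI qi} tj fj Sj Yt Yt' qt Yj qj => [|i] + tj fj Sj Yt Yt' qt Yj qj.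
    move=> Hj; rewrite expr0 mul1r; apply: le_trans (weighted_le_total _) _.
    apply: le_trans (impact_total_error Sj Yt' qt) _.
    by rewrite -mulrA ler_wpM2l // -Hj.
  move=> [q_i N_i]; rewrite exprS -mulrA.
  apply: le_trans (step_contraction tj fj Yj qj q_i Sj) _.
  by rewrite ler_wpM2l.
have D0 : 0 <= D by rewrite mulr_ge0.
have Yi : Y (impact rb (phi j (tau j.+1))) <= delta.
  rewrite -(ler_pM2l w0); apply: le_trans (total_le_weighted _) (le_trans Ni _).
  apply: le_trans Ddelta0; apply: (@le_trans _ _ (D * y0)); last by rewrite ler_wpM2l.
  by rewrite ler_piMl ?mulr_ge0 // half_exp_le1.
by split=> //; exact: start_arith qi rho_r qpm.
Qed.

Lemma weighted_gain_ge1 : 1 <= D.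
Proof.
rewrite -[leLHS]mulr1; apply: ler_pM => //; last by rewrite arc_growth_ge1 // S1_ge0.
by rewrite lerDr addr_ge0 // mulr_ge0.
Qed.

(** The factor 2 makes up for the first step, which does not halve; 1 / w converts N back to Y. *)
Lemma hybrid_step_decay j : (j <= m)%N ->
  Y (phi j (tau j)) <= 2 * D / w * (1 / 2) ^+ j * y0.
Proof.
move=> jm; have /andP[w0 w1] := w01; have D1 := weighted_gain_ge1.
have y00 : 0 <= y0 := total_error_ge0 _.
have [_ _] := hybrid_invariants jm; case: j jm => [|i] jm.
  move=> ->; rewrite expr0 mulr1 ler_peMl // ler_pdivlMr // mul1r.
  by apply: le_trans w1 _; lra.
move=> [_ Ni]; rewrite -(ler_pM2l w0); apply: le_trans (total_le_weighted _) (le_trans Ni _).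
rewrite exprS le_eqVlt; apply/orP; left; apply/eqP.
by field; rewrite gt_eqF.
Qed.

Lemma hybrid_arc_decay j t : (j <= m)%N -> t \in `[tau j, tau j.+1] ->
  Y (phi j t) <= G * (2 * D / w * (1 / 2) ^+ j * y0).
Proof.
move=> jm tI; have [_ Hflow _ _] := sol; have [_ fj] := Hflow j jm.
have [Yj qj _] := hybrid_invariants jm.
apply: le_trans (arc_total_error fj Yj qj tI) _.
rewrite ler_wpM2l ?hybrid_step_decay //.
by rewrite (le_trans ler01) // arc_growth_ge1 // S1_ge0.
Qed.

(** On each arc q_N advances at speed at least [Vlo] inside a strip of length qminus - qplus + 2 r.
    Without such a bound, decay per step would not be decay in time. *)
Lemma hybrid_time j : (j <= m)%N ->
  tau j.+1 <= j.+1%:R * ((qminus - qplus + 2 * r) / Vlo).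
Proof.
have [tau0 Hflow _ _] := sol.
have step i : (i <= m)%N -> tau i.+1 - tau i <= (qminus - qplus + 2 * r) / Vlo.
  move=> im; have [ti fi] := Hflow i im; have [Yi qi _] := hybrid_invariants im.
  have /andP[h1 _] := arc_progress ti fi Yi qi.
  have tI : tau i.+1 \in `[tau i, tau i.+1] by rewrite bound_itvE.
  have /andP[_ h2] := arc_stay fi Yi qi tI; have /andP[h3 _] := qi.
  rewrite ler_pdivlMr // mulrC; apply: le_trans h1 _.
  by move: h2 h3; move: (qN _) (qN _) => u v; lra.
elim: j => [|j IH] jm; first by have := step 0%N jm; rewrite tau0 subr0 mul1r.
have := step j.+1 jm; have := IH (ltnW jm).
move: ((_ + _) / Vlo) (tau j.+1) (tau j.+2) => T u v.
by rewrite -[j.+2%:R]natr1 (mulrDl _ _ T) mul1r; lra.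
Qed.

End Hybrid.

Lemma high_gain_stable (U : set (state R n)) :
  (forall x, U x -> Y x <= delta0 /\ qplus - r < qN x < qminus + r) ->
  exponentially_stable_on rb F U (transverse rb rf p).
Proof.
move=> HU; pose T := (qminus - qplus + 2 * r) / Vlo.
have T0 : 0 < T.
  by rewrite divr_gt0 //; have h1 := qpm; have h2 := r0; lra.
have /andP[w0 w1] := w01; have D1 := weighted_gain_ge1.
have G1 : 1 <= G by rewrite arc_growth_ge1 // S1_ge0.
(* The first factors come from [hybrid_arc_decay], 2 from t <= (j + 1) T against the exponent j, and
   4 from comparing the sum of four norms with the sup norm. *)
pose M := G * (2 * D / w) * 2 * 4.
have Dw : 1 <= 2 * D / w.
  by rewrite ler_pdivlMr // mul1r; apply: le_trans w1 _; lra.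
have ln2 : 0 < ln (2 : R) by rewrite ln_gt0 // ltr1n.
have GD : 1 <= G * (2 * D / w) by rewrite -[leLHS]mulr1 ler_pM.
exists M, (ln 2 / T); split.
- by rewrite /M; lra.
- exact: divr_gt0.
- move=> m tau phi sol Ux j t jm tI.
  have [Y0 q0] := HU _ Ux.
  have Yt := hybrid_arc_decay sol Y0 q0 jm tI.
  have tT := hybrid_time sol Y0 q0 jm.
  have norm_le x : `|transverse rb rf p x| <= Y x.
    have [h1 h2 h3 h4] := error_le_total x.
    rewrite !prod_normE /= !ge_max h2 h3 h4 !andbT /=.
    by apply: le_trans h1; rewrite lerDr.
  have le_norm x : Y x <= 4 * `|transverse rb rf p x|.
    have : [/\ `|hr rf x| <= `|transverse rb rf p x|,
      `|dhr rb rf x| <= `|transverse rb rf p x|,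
      `|b x| <= `|transverse rb rf p x| & `|c x| <= `|transverse rb rf p x|].
      by rewrite !prod_normE /= !le_max !lexx !orbT.
    rewrite /total_error /tracking_error.
    move: `|transverse _ _ _ _| `|hr _ _| `|dhr _ _ _| `|b _| `|c _| => u1 u2 u3 u4 u5.
    by case; lra.
  apply: le_trans (norm_le _) (le_trans Yt _).
  have decay : (1 / 2) ^+ j <= 2 * expR (- (ln 2 / T) * t).
    have E1 : (1 / 2 : R) = expR (- ln 2) by rewrite expRN lnK ?posrE // mul1r.
    have E2 : (2 : R) = expR (ln 2) by rewrite lnK ?posrE.
    rewrite E1 -expRM_natl {2}E2 -expRD ler_expR.
    have t_le : t <= j.+1%:R * T.
      by move: tI; rewrite in_itv/= => /andP[_ h]; exact: le_trans h tT.
    have : ln 2 / T * t <= ln 2 * j.+1%:R.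
      by rewrite mulrAC ler_pdivrMr // -mulrA ler_wpM2l ?(ltW ln2).
    by rewrite -natr1; lra.
  have y0 := le_norm (phi 0%N 0).
  have Gp : 0 <= G * (2 * D / w) by rewrite (le_trans ler01).
  have ex0 : 0 <= expR (- (ln 2 / T) * t) by exact: expR_ge0.
  have -> : G * (2 * D / w * (1 / 2) ^+ j * Y (phi 0%N 0)) =
    G * (2 * D / w) * ((1 / 2) ^+ j * Y (phi 0%N 0)) by ring.
  have -> : M * expR (- (ln 2 / T) * t) * `|transverse rb rf p (phi 0%N 0)| =
    G * (2 * D / w) * (2 * expR (- (ln 2 / T) * t) * (4 * `|transverse rb rf p (phi 0%N 0)|)).
    by rewrite /M; ring.
  rewrite ler_wpM2l //; apply: ler_pM => //; exact: total_error_ge0.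
Qed.

End Arcs.

(** * Choice of the ratio e and of the gain k *)

Section Constants.
Variable R : realType.

Lemma expRN_half_le (x : R) : 0 < x -> expR (- (x / 2)) <= x^-1.
Proof. by move=> x0; rewrite -[leRHS]mul1r ler_pdivlMr // mulrC mulr_expR_le. Qed.

(* The factor gained at impact is affine in [e], the contraction along the step
   is exponential in [e]. *)
Lemma contracting_ratio (a I : R) : 0 < I ->
  exists2 e : R, 0 < e & `|1 + e * a| * expR (- (e * (I / 2))) <= 1 / 4.
Proof.
move=> I0; have a0 := normr_ge0 a.
(* With x = e I / 2 and y = exp(- x / 2), the product is at most (1 + (2 |a| / I) x) y^2 <= K y <= K
   / x, by x y <= 1; then x = 4 K gives 1/4. *)
pose K := 1 + 2 * `|a| / I; have K1 : 1 <= K by rewrite lerDl divr_ge0 ?mulr_ge0 // ltW.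
pose x := 4 * K; have x0 : 0 < x by rewrite /x; lra.
exists (2 * x / I); first by rewrite divr_gt0 // mulr_gt0.
have -> : 2 * x / I * (I / 2) = x by field; rewrite gt_eqF.
have y0 := expR_ge0 (- (x / 2)).
have y1 : expR (- (x / 2)) <= 1 by rewrite -expR0 ler_expR oppr_le0 divr_ge0 // ltW.
have yx := mulr_expR_le x; have yx' := expRN_half_le x0.
have -> : expR (- x) = expR (- (x / 2)) * expR (- (x / 2)) by rewrite -expRD; congr expR; lra.
set y := expR (- (x / 2)) in y0 y1 yx yx' *.
have h1 : `|1 + 2 * x / I * a| <= 1 + (2 * `|a| / I) * x.
  have c0 : 0 <= 2 * x / I.
    apply: divr_ge0; last exact: ltW.
    by apply: mulr_ge0 => //; exact: ltW.
  apply: le_trans (ler_normD _ _) _; rewrite normr1 lerD2l normrM (ger0_norm c0).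
  by rewrite le_eqVlt; apply/orP; left; apply/eqP; field; rewrite gt_eqF.
apply: (@le_trans _ _ ((1 + (2 * `|a| / I) * x) * (y * y))).
  by rewrite ler_wpM2r // mulr_ge0.
have h2 : 0 <= 2 * `|a| / I by rewrite divr_ge0 ?mulr_ge0 // ltW.
have -> : (1 + 2 * `|a| / I * x) * (y * y) = y * y + 2 * `|a| / I * (x * y) * y by ring.
have h3 : y * y <= y by rewrite ler_piMl.
have h4 : 2 * `|a| / I * (x * y) * y <= 2 * `|a| / I * y.
  by rewrite ler_wpM2r // ler_piMr.
apply: (@le_trans _ _ (K * y)); first by rewrite /K; lra.
apply: (@le_trans _ _ (K * x^-1)); first by rewrite ler_wpM2l //; lra.
by rewrite /x le_eqVlt; apply/orP; left; apply/eqP; field; rewrite gt_eqF //; lra.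
Qed.

Lemma large_gain (T K eta : R) : 0 < T -> 0 <= K -> 0 < eta ->
  exists2 k : R, 1 <= k & (4 + k) * expR (- (k * T / 2)) <= eta /\ K / k <= eta.
Proof.
(* For x = k T / 2 one has exp(- x) <= x^-2, and 4 + k <= 5 k, so the first quantity is at most 20 /
   (T^2 k). *)
move=> T0 K0 eta0; pose L := 20 / (T * T) / eta.
have L0 : 0 <= L by rewrite !divr_ge0 ?mulr_ge0 ?(ltW T0) ?(ltW eta0).
have Ke : 0 <= K / eta by rewrite divr_ge0 // ltW.
pose k := 1 + L + K / eta; have k1 : 1 <= k by rewrite /k; lra.
have k0 : 0 < k by lra.
exists k => //; split; last first.
  have Kk : K / eta <= k by rewrite lerDr addr_ge0.
  by move: Kk; rewrite !ler_pdivrMr // mulrC.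
pose x := k * T / 2; have x0 : 0 < x by rewrite !divr_gt0 ?mulr_gt0.
rewrite -/x; have y0 := expR_ge0 (- (x / 2)).
have yx := mulr_expR_le x; have yx' := expRN_half_le x0.
have -> : expR (- x) = expR (- (x / 2)) * expR (- (x / 2)) by rewrite -expRD; congr expR; lra.
set y := expR (- (x / 2)) in y0 yx yx' *.
have h1 : x * (y * y) <= x^-1.
  by rewrite mulrA; apply: le_trans yx'; rewrite ler_piMl.
have h2 : y * y <= x^-1 / x by rewrite ler_pdivlMr // mulrC.
apply: (@le_trans _ _ (5 * k * (x^-1 / x))).
  by apply: ler_pM => //; [lra|rewrite mulr_ge0|lra].
have -> : 5 * k * (x^-1 / x) = 20 / (T * T) / k.
  by rewrite /x; field; rewrite !gt_eqF.
have Lk : L <= k by rewrite /k addrAC lerDr addr_ge0.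
by rewrite (ler_pdivrMr _ _ k0) [eta * k]mulrC -(ler_pdivrMr _ _ eta0).
Qed.

Lemma min5_gt0 (x1 x2 x3 x4 x5 : R) : 0 < x1 -> 0 < x2 -> 0 < x3 -> 0 < x4 ->
  0 < x5 -> exists2 m : R, 0 < m & [/\ m <= x1, m <= x2, m <= x3, m <= x4 & m <= x5].
Proof.
move=> h1 h2 h3 h4 h5.
exists (Num.min (Num.min x1 x2) (Num.min (Num.min x3 x4) x5)).
  by rewrite !lt_min h1 h2 h3 h4 h5.
by rewrite !ge_min !lexx !orbT.
Qed.

Lemma weight_le (C : R) : 0 <= C -> (4 * C + 1)^-1 * C <= 1 / 4.
Proof. by move=> C0; rewrite mulrC ler_pdivrMr; lra. Qed.

End Constants.

Lemma continuous_total_error (R : realType) n (rb : robot R n) (rf : reference R n)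
    (e k : R) : bipedal_robot_with_disc rb -> reference_functions rb rf ->
  continuous (total_error rb rf e k).
Proof.
move=> rbH rfH x.
have cn (W : normedModType R) (f : state R n -> W) : differentiable f x ->
    {for x, continuous (fun y => `|f y|)}.
  move=> df; apply: (@continuous_comp _ _ _ f Num.norm); last exact: norm_continuous.
  exact: differentiable_continuous.
rewrite (_ : total_error rb rf e k = (fun y => `|hr rf y|) +
  (fun y => `|dhr rb rf y|) + (fun y => `|bvar rf y|) +
  (fun y => `|cvar rf (high_gain n e k) y|)) //.
apply: continuousD; last by apply: cn; exact: differentiable_cvar rfH _ _.
apply: continuousD; last by apply: cn; exact: differentiable_bvar rfH _.
apply: continuousD; apply: cn; first exact: differentiable_hr rfH _.
exact: differentiable_dhr rbH rfH _.
Qed.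

(** The constants are fixed in the order: bounds on V and S', the antiderivative A and its increase
    I, the impact coefficient a; then e, the impact constants, the margins rho and r, the weight w,
    eta; then k; at last delta and delta0'. *)
Theorem corollary2 (R : realType) (n : nat) (rb : robot R n)
    (rf : reference R n) (p0 : gains R n) (qplus qminus : R)
    (robot_hyp : bipedal_robot_with_disc rb)
    (reference_hyp : reference_functions rb rf)
    (p0_adm : admissible p0)
    (W_invariant :
      hybrid_invariant rb (closed_loop rb rf p0) (manifoldW rb rf))
    (Z_invariant :
      hybrid_invariant rb (closed_loop rb rf p0) (manifoldZ rb rf p0))
    (step_hyp : nominal_step rb rf p0 qplus qminus)
    (decoupling_invertible :
      forall x, valid rb x -> decoupling rb rf x \in unitmx) :
  exists p : gains R n, admissible p /\
    exists U : set (state R n),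
      [/\ open U,
          manifoldZ rb rf p `<=` U,
          (forall x, valid rb x ->
             (transverse rb rf p x = 0 <-> manifoldZ rb rf p x)) &
          exponentially_stable_on rb (closed_loop rb rf p) U
            (transverse rb rf p)].
Proof.
have [_ Zinv] := Z_invariant.
have qpm := qplus_lt step_hyp.
have qI q : qplus - 1 <= q <= qminus + 1 -> q \in `[qplus - 1, qminus + 1].
  by rewrite in_itv.
have ab : qplus - 1 <= qminus + 1 by lra.
have [S1 S10 HS] := dSref_bound reference_hyp ab.
have cV : {within `[qplus - 1, qminus + 1], continuous (Vref rf)}.
  by apply: continuous_subspaceT; exact: (smooth_continuous (smooth_Vref reference_hyp)).
have [v1 _ Hv1] := EVT_min ab cV; have [v2 _ Hv2] := EVT_max ab cV.
(* This leaves room for |q_N' - V|, which will be kept below both [Vlo] and 1. *)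
pose Vlo := Vref rf v1 / 2; pose Vhi := Vref rf v2 + 1.
have Vlo0 : 0 < Vlo by rewrite divr_gt0 // (Vref_gt0 reference_hyp).
have Vhi0 : 0 < Vhi by rewrite addr_gt0 // (Vref_gt0 reference_hyp).
have HV q : q \in `[qplus - 1, qminus + 1] -> 2 * Vlo <= Vref rf q <= Vhi - 1.
  move=> qq; rewrite /Vlo /Vhi addrK Hv2 // andbT mulrC divfK ?Hv1 //.
have [B B0 HB] := gravity_factor reference_hyp.
pose dS := (Sref rf)^`()%classic; pose f q := dS q ^+ 2 / Vhi.
have cdS : continuous dS.
  exact: (smooth_continuous (smooth_derive1 (smooth_Sref reference_hyp))).
have cf : continuous f.
  by move=> q; apply: cvgM; [apply: cvgM; exact: cdS|exact: cvg_cst].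
(* The antiderivative is differentiable only in an open interval, so the strip is enlarged to
   include its endpoints. *)
have ab2 : qplus - 2 < qminus + 2 by lra.
have [A HA] := continuous_antiderivative ab2 cf.
have HA' q : q \in `[qplus - 1, qminus + 1] -> is_derive q (1 : R) A (f q).
  by rewrite in_itv/= => /andP[h1 h2]; apply: HA; apply/andP; split; lra.
pose I := A qminus - A qplus; have I0 : 0 < I.
  (* Since S' V = k2(0, q), a nonzero gravity moment gives S' != 0 there, and the integral of S'^2
     over the step is positive. *)
  have [q0 q0I k20] := nominal_moment step_hyp.
  rewrite subr_gt0; apply: (antiderivative_lt qpm cf _ q0I).
  - by move=> q _; rewrite divr_ge0 ?sqr_ge0 // ltW.
  - apply: mulf_neq0; last by rewrite invr_eq0 gt_eqF.
    apply: expf_neq0.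
    by apply: contraNneq k20 => dS0; rewrite -(SrefE reference_hyp) -/dS dS0 mul0r.
  - split=> [|q]; last first.
      rewrite in_itv/= => /andP[h1 h2]; apply: HA; apply/andP; split; lra.
    apply: derivable_within_continuous => q; rewrite in_itv/= => /andP[h1 h2].
    by apply: ex_derive; apply: HA; apply/andP; split; lra.
(* A loss of at most I / 4 at each end of an arc leaves the increase I / 2. *)
have near_A q0 : q0 \in `[qplus - 1, qminus + 1] ->
    exists2 d : R, 0 < d & forall q, `|q - q0| < d -> `|A q - A q0| < I / 4.
  move=> /HA' dA; have /derivable1_diffP/differentiable_continuous cA : derivable A q0 1.
    exact: ex_derive.
  have I4 : 0 < I / 4 by rewrite divr_gt0.
  have /cvgrPdist_lt /(_ _ I4) /nbhs_normP[d /= d0 Hd] := cA.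
  by exists d => // q qd; rewrite distrC; apply: Hd; rewrite /= distrC.
have [r1 r10 Hr1] : exists2 d : R, 0 < d & forall q, `|q - qminus| < d ->
    `|A q - A qminus| < I / 4 by apply/near_A/qI/andP; split; lra.
have [r2 r20 Hr2] : exists2 d : R, 0 < d & forall q, `|q - qplus| < d ->
    `|A q - A qplus| < I / 4 by apply/near_A/qI/andP; split; lra.
have [a Ha] := impact_bound robot_hyp reference_hyp Zinv step_hyp.
have [e e0 He] := contracting_ratio a I0.
have [C [dI [C0 dI0 Himp]]] := Ha e e0.
have [C1 [d1 [C10 d10 Hloc]]] := impact_location robot_hyp reference_hyp Zinv step_hyp.
(* The bounds also have to hold for the margin r = 2 rho, larger than [rho] so that arcs beginning
   after an impact start strictly inside the strip. The last bound ensures that a full arc covers at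
   least half of the nominal range. *)
have [rho rho0 [rho_r rho_half rho_d1 rho_dI rho_q]] : exists2 m : R, 0 < m &
    [/\ m <= Num.min r1 r2 / 2, m <= 1 / 2, m <= d1 / 4, m <= dI / 2 &
        m <= (qminus - qplus) / 8].
  by apply: min5_gt0; rewrite divr_gt0 ?lt_min ?r10 ?subr_gt0.
have [rho_r1 rho_r2] : rho < r1 /\ rho < r2.
  have : 0 < Num.min r1 r2 by rewrite lt_min r10.
  have : Num.min r1 r2 <= r1 by rewrite ge_min lexx.
  have : Num.min r1 r2 <= r2 by rewrite ge_min lexx orbT.
  by move: (Num.min r1 r2) rho_r => mr; clear; split; lra.
pose r := 2 * rho.
pose Tmin := (qminus - qplus) / (2 * Vhi).
have Tmin0 : 0 < Tmin by rewrite divr_gt0 ?subr_gt0 // mulr_gt0.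
have C1p : 0 < 4 * C + 1 by rewrite ltr_wpDl // mulr_ge0.
pose w := (4 * C + 1)^-1.
have w0 : 0 < w by rewrite invr_gt0.
have w1 : w <= 1 by rewrite invf_le1 // lerDr mulr_ge0.
have wC : w * C <= 1 / 4 by exact: weight_le.
have a1 : 0 < `|1 + e * a| + 4 * C + 1 by rewrite -addrA ltr_wpDl.
(* The smallness required by [step_arith]. It involves [e] and the impact constants only, so [k] can
   be chosen after it. *)
pose eta := w / 2 / (`|1 + e * a| + 4 * C + 1).
have eta0 : 0 < eta by rewrite !divr_gt0.
have eta3 : eta * (`|1 + e * a| + 4 * C + 1) <= w / 2 by rewrite divfK // gt_eqF.
have fg0 : 0 <= forcing S1 B by rewrite addr_ge0 ?mulr_ge0.
have [k k1 [eta1 eta2]] := large_gain Tmin0 fg0 eta0.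
have k0 : 0 < k by exact: lt_le_trans k1.
have G1 : 1 <= arc_growth_rate k S1 B by exact: arc_growth_ge1.
set G := arc_growth_rate k S1 B in G1.
have G0 : 0 < G by exact: lt_le_trans G1.
have [mu mu0 [mu_d1 mu_1 mu_V mu_rho mu_dI]] : exists2 m : R, 0 < m &
    [/\ m <= d1 / 2, m <= 1, m <= Vlo, m <= rho & m <= dI / 2].
  by apply: min5_gt0 => //; rewrite divr_gt0.
have eS0 : 0 <= e * S1 by rewrite mulr_ge0 ?(ltW e0).
(* Dividing by [K] keeps each of the multiples 1, 1 + e S1, C1 and C of G delta below [mu]; dividing
   by G then makes up for the growth along an arc. *)
pose K := 1 + e * S1 + C1 + C.
have K1 : 1 <= K by rewrite /K -!addrA lerDl !addr_ge0.
have K0 : 0 < K by exact: lt_le_trans K1.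
pose delta := mu / K / G.
have delta0 : 0 < delta by rewrite !divr_gt0.
have GdE : G * delta = mu / K by rewrite mulrC divfK ?gt_eqF.
have nu_le t : 0 <= t -> t <= K -> t * (G * delta) <= mu.
  move=> t0 tK; rewrite GdE mulrA ler_pdivrMr // mulrC.
  by rewrite ler_wpM2l ?(ltW mu0).
have [K2 K3 K4] : [/\ 1 + e * S1 <= K, C1 <= K & C <= K].
  rewrite /K; split; first by rewrite -addrA lerDl addr_ge0.
    by rewrite addrAC lerDr !addr_ge0.
  by rewrite lerDr !addr_ge0.
have nu1 : G * delta <= mu by rewrite -[leLHS]mul1r nu_le.
have nuS : (1 + e * S1) * (G * delta) <= mu by rewrite nu_le // addr_ge0.
have nuC1 := nu_le _ C10 K3; have nuC := nu_le _ C0 K4.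
pose D := (3 * C + `|1 + e * a| + 1) * G.
have D0 : 0 < D by rewrite mulr_gt0 // ltr_wpDl // addr_ge0 // mulr_ge0.
pose delta0' := w * delta / D.
have d0' : 0 < delta0' by apply: divr_gt0 => //; exact: mulr_gt0.
have w01 : 0 < w <= 1 by rewrite w0.
have D1 : 1 <= D.
  by rewrite -[leLHS]mulr1; apply: ler_pM => //; rewrite lerDr addr_ge0 // mulr_ge0.
have Dd0 : D * delta0' <= w * delta by rewrite mulrC divfK // gt_eqF.
have d0_le : delta0' <= delta.
  by rewrite ler_pdivrMr // mulrC ler_pM ?(ltW w0) ?(ltW delta0) // (le_trans w1).
have rE : r = 2 * rho by [].
have [r0 r1'] : 0 < r /\ r <= 1 by clear - rE rho0 rho_half; split; lra.
have [rd1 rdI rho_lt_r] : [/\ r < d1, r <= dI & rho < r].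
  by clear - rE rho0 rho_d1 rho_dI d10; split; lra.
have GdE' : C1 * (G * delta) < r by apply: le_lt_trans nuC1 (le_lt_trans mu_rho _).
have Gd1 : G * delta < d1.
  by apply: le_lt_trans nu1 (le_lt_trans mu_d1 _); clear - d10; lra.
have GdS1 : (1 + e * S1) * (G * delta) < d1.
  by apply: le_lt_trans nuS (le_lt_trans mu_d1 _); clear - d10; lra.
have GdI : G * delta < dI.
  by apply: le_lt_trans nu1 (le_lt_trans mu_dI _); clear - dI0; lra.
have HT : Vhi * Tmin <= qminus - qplus - 2 * rho.
  have -> : Vhi * Tmin = (qminus - qplus) / 2.
    by rewrite /Tmin; field; rewrite gt_eqF.
  by clear - rho_q rho0 qpm; lra.
have HI q q' : `|q - qminus| <= rho -> `|q' - qplus| <= rho -> I / 2 <= A q - A q'.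
  move=> h1 h2; have := Hr1 q (le_lt_trans h1 rho_r1).
  have := Hr2 q' (le_lt_trans h2 rho_r2).
  rewrite !ltr_norml /I; move: (A q) (A q') (A qminus) (A qplus); clear.
  by move=> t1 t2 t3 t4 /andP[? ?] /andP[? ?]; lra.
have Hloc' x : `|hr rf x| < d1 -> `|dhr rb rf x| < d1 -> `|dqN x - Vref rf (qN x)| < d1 ->
    qplus - d1 < qN x < qminus + d1 -> 0 <= p2 rb x -> qN x - qminus <= C1 * `|hr rf x|.
  by move=> h1 h2 h3 h4; have [] := Hloc x h1 h2 h3 h4.
have Himp' x : impact_surface rb x -> total_error rb rf e k x <= G * delta ->
  qplus - r < qN x < qminus + r ->
  [/\ `|qN x - qminus| <= C * tracking_error rb rf x,
      `|qN (impact rb x) - qplus| <= C * tracking_error rb rf x,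
      tracking_error rb rf (impact rb x) <= C * tracking_error rb rf x,
      `|bvar rf (impact rb x)| <= `|1 + e * a| * `|bvar rf x| +
         C * (tracking_error rb rf x + `|cvar rf (high_gain n e k) x|) &
      `|cvar rf (high_gain n e k) (impact rb x)| <=
        C * (tracking_error rb rf x + `|bvar rf x| + `|cvar rf (high_gain n e k) x|)].
  move=> Sx Yx /andP[q1 q2]; have Yd := le_lt_trans Yx GdI.
  have [h1 h2 h3 h4] := error_le_total rb rf e k x.
  apply: Himp => //; [exact: le_lt_trans h4 Yd| |exact: le_lt_trans h2 Yd
    |exact: le_lt_trans h3 Yd|].
    apply: le_lt_trans (le_trans _ h1) Yd; rewrite lerDr; exact: normr_ge0.
  by apply/andP; split; [apply: le_lt_trans q1; rewrite lerD2l lerN2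
    |apply: lt_le_trans q2 _; rewrite lerD2l].
exists (high_gain n e k); split; first exact: high_gain_admissible.
(* The error does not confine q_N, so the strip is imposed separately; q_d stays free. *)
exists [set x | total_error rb rf e k x < delta0' /\ qplus - r < qN x < qminus + r].
split.
- rewrite (_ : [set x | _] = [set x | total_error rb rf e k x < delta0'] `&`
    ([set x | qplus - r < qN x] `&` [set x | qN x < qminus + r])); last first.
    by apply/seteqP; split=> x /=; [move=> [-> /andP[]]|move=> [-> [-> ->]]].
  have cq : continuous (@qN R n).
    by move=> x; apply: differentiable_continuous; exact: differentiable_qN.
  apply: openI; last apply: openI.
  + apply: (@open_comp _ _ (total_error rb rf e k) [set t : R | t < delta0']).
      by move=> x _; exact: continuous_total_error.
    exact: open_lt.
  + apply: (@open_comp _ _ (@qN R n) [set t : R | qplus - r < t]).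
      by move=> x _; exact: cq.
    exact: open_gt.
  + apply: (@open_comp _ _ (@qN R n) [set t : R | t < qminus + r]).
      by move=> x _; exact: cq.
    exact: open_lt.
(* The range of q_N on Z is known for [p0]; it transfers because Z does not depend on the gains. *)
- move=> x Zx; have Zx0 : manifoldZ rb rf p0 x.
    apply: (proj2 (manifoldZE robot_hyp reference_hyp p0 x)).
    exact: (proj1 (manifoldZE robot_hyp reference_hyp _ x) Zx).
  have : qN x \in `[qplus, qminus] by apply/(nominal_range step_hyp); exists x.
  rewrite in_itv/= => /andP[q1 q2]; split.
    case: Zx => _ h1 h2 h3 h4.
    by rewrite /total_error /tracking_error h1 h2 h3 h4 !normr0 !addr0.
  by clear - q1 q2 r0; apply/andP; split; lra.
- move=> x vx; split=> [|[_ h1 h2 h3 h4]]; last by rewrite /transverse h1 h2 h3 h4.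
  by move=> [h1 h2 h3 h4].
- apply: (high_gain_stable robot_hyp reference_hyp decoupling_invertible e0 k1 B0 HS HB
    Vlo0 C10 r0 r1' rd1 qpm HV Hloc' Gd1 GdE' GdS1 (le_trans nuS mu_1) (le_trans nuS mu_V)
    C0 rho_lt_r (le_trans nuC mu_rho) Himp' HA' HI (ltW I0) Vhi0 HT w01 wC He
    (ltW eta0) eta1 eta2 eta3 d0_le Dd0).
  by move=> x [/ltW].
Qed.
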